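(* Let $N\ge 2$ and let $2^*=\frac{2N}{N-2}$ if $N\ge 3$, $2^*=\infty$ if $N=2$. For every $p$ with $2<p<2^*$ the embedding $H^1_r(\mathbb{B}^N)\hookrightarrow L^p(\mathbb{B}^N)$ is compact.
   Context: $\mathbb{B}^N=\{x\in\mathbb{R}^N:|x|<1\}$ is the ball model of hyperbolic space, with metric $g_{ij}=\left(\frac{2}{1-|x|^2}\right)^2\delta_{ij}$ and volume $dV_{\mathbb{B}^N}=\left(\frac{2}{1-|x|^2}\right)^N dx$. $L^p(\mathbb{B}^N)$ is taken with respect to $dV_{\mathbb{B}^N}$. $H^1(\mathbb{B}^N)$ is the Sobolev space of the Riemannian manifold $(\mathbb{B}^N,g)$, with squared norm $\int_{\mathbb{B}^N}\left(|\nabla_{\mathbb{B}^N}u|^2_{\mathbb{B}^N}+u^2\right)dV_{\mathbb{B}^N}$, where $|\nabla_{\mathbb{B}^N}u|^2_{\mathbb{B}^N}=\left(\frac{1-|x|^2}{2}\right)^2|\nabla u|^2$ and $\nabla$ is the Euclidean gradient. $H^1_r(\mathbb{B}^N)$ is the subspace of radial functions (functions of $|x|$ only) in $H^1(\mathbb{B}^N)$. *)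

(* Defs.v *)
From HB Require Import structures.
From mathcomp Require Import all_boot all_order all_algebra.
From mathcomp Require Import all_classical all_reals all_analysis.
From mathcomp Require Import measurable_realfun.

Set Implicit Arguments.
Unset Strict Implicit.
Unset Printing Implicit Defensive.
Import Order.TTheory GRing.Theory Num.Theory.
Import numFieldNormedType.Exports.

Local Open Scope classical_set_scope.
Local Open Scope ring_scope.

Definition measure_rV_display : measure_display -> measure_display.
Proof. exact. Qed.

(* The product sigma-algebra on row vectors, i.e. the one generated by the
   coordinates; for T = R it is the Borel sigma-algebra of R^n. *)
Section measurable_rV.
Context {d} {T : measurableType d} (n : nat).

Let coors : 'I_n -> 'rV[T]_n -> T := fun i x => x ord0 i.

Let rV_set0 : g_sigma_preimage coors set0.
Proof. exact: sigma_algebra0. Qed.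

Let rV_setC A : g_sigma_preimage coors A -> g_sigma_preimage coors (~` A).
Proof. exact: sigma_algebraC. Qed.

Let rV_bigcup (F : (set 'rV[T]_n)^nat) :
  (forall i, g_sigma_preimage coors (F i)) ->
  g_sigma_preimage coors (\bigcup_i (F i)).
Proof. exact: sigma_algebra_bigcup. Qed.

HB.instance Definition _ := @isMeasurable.Build (measure_rV_display d)
  'rV[T]_n (g_sigma_preimage coors) rV_set0 rV_setC rV_bigcup.

Lemma measurable_coord (i : 'I_n) :
  measurable_fun [set: 'rV[T]_n] (fun x : 'rV[T]_n => x ord0 i).
Proof.
move=> _ Y mY; rewrite setTI; apply: sub_sigma_algebra => /=.
rewrite -bigcup_seq/=; exists i => /=; first by rewrite mem_index_enum.
by exists Y => //; rewrite setTI.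
Qed.

Lemma measurable_fun_rVP d' (T' : measurableType d') (f : T' -> 'rV[T]_n) :
  (forall i, measurable_fun [set: T'] (fun x => f x ord0 i)) ->
  measurable_fun [set: T'] f.
Proof.
move=> mf _ A mA; rewrite setTI.
suff : g_sigma_preimage coors `<=` [set B | measurable (f @^-1` B)] by exact.
apply: smallest_sub.
  split => /=.
  - by rewrite preimage_set0.
  - by move=> B mB; rewrite setTD preimage_setC; exact: measurableC.
  - move=> F mF; rewrite preimage_bigcup; exact: bigcupT_measurable.
rewrite -bigcup_seq => B [i _ [C mC <-]] /=.
by rewrite setTI -comp_preimage -[X in measurable X]setTI; exact: mf.
Qed.

End measurable_rV.

(* Lebesgue measure on R^n as an iterated product: the unit mass on the point
   of R^0, and the product of the Lebesgue measures of R and R^n on R^(n+1). *)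
Section lebesgue_rV.
Context {R : realType}.

Definition consrV n (p : measurableTypeR R * 'rV[R]_n) : 'rV[R]_n.+1 :=
  row_mx (const_mx p.1 : 'rV[R]_1) p.2.

Lemma measurable_consrV n : measurable_fun setT (@consrV n).
Proof.
apply: measurable_fun_rVP => i.
have -> : i = unsplit (@fintype.split 1 n i) by rewrite splitK.
case: fintype.split => j /=; rewrite /consrV.
- rewrite (_ : (fun _ => _) = fst)//.
  by apply/funext => x; apply: etrans (row_mxEl _ _ _ _) _; rewrite mxE.
- rewrite (_ : (fun _ => _) = (fun x : 'rV[R]_n => x ord0 j) \o snd).
    exact: measurableT_comp (measurable_coord j) measurable_snd.
  by apply/funext => x; exact: row_mxEr.
Qed.

Section step.
Context n (m : {sigma_finite_measure set 'rV[R]_n -> \bar R}).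
Local Open Scope ereal_scope.

Definition lebesgue_rVS : set 'rV[R]_n.+1 -> \bar R :=
  pushforward (lebesgue_measure \x m) (@consrV n).

Let measurable_preimage (A : set 'rV[R]_n.+1) :
  measurable A -> measurable (@consrV n @^-1` A).
Proof. by move=> mA; rewrite -[X in measurable X]setTI; exact: measurable_consrV. Qed.

Let lebesgue_rVS0 : lebesgue_rVS set0 = 0.
Proof. by rewrite /lebesgue_rVS /pushforward preimage_set0 measure0. Qed.

Let lebesgue_rVS_ge0 A : 0 <= lebesgue_rVS A.
Proof. by rewrite /lebesgue_rVS /pushforward; apply: measure_ge0. Qed.

Let lebesgue_rVS_sigma_additive : semi_sigma_additive lebesgue_rVS.
Proof.
move=> F mF tF mUF; rewrite /lebesgue_rVS /pushforward preimage_bigcup.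
apply: measure_semi_sigma_additive.
- by move=> k; exact: measurable_preimage.
- apply/trivIsetP => /= i j _ _ ij; rewrite -preimage_setI.
  by move/trivIsetP : tF => /(_ _ _ _ _ ij) ->//; rewrite preimage_set0.
- by rewrite -preimage_bigcup; exact: measurable_preimage.
Qed.

HB.instance Definition _ := isMeasure.Build _ _ _ lebesgue_rVS
  lebesgue_rVS0 lebesgue_rVS_ge0 lebesgue_rVS_sigma_additive.

Definition headrV (x : 'rV[R]_n.+1) : R := x ord0 ord0.
Definition tailrV (x : 'rV[R]_n.+1) : 'rV[R]_n := \row_i x ord0 (lift ord0 i).

Lemma consrVK : cancel (@consrV n) (fun x => (headrV x, tailrV x)).
Proof.
case=> a x; rewrite /headrV /tailrV /consrV /=; congr pair.
  have -> : ord0 = lshift n (ord0 : 'I_1) by apply/val_inj.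
  by apply: etrans (row_mxEl _ _ _ _) _; rewrite mxE.
apply/rowP => i; rewrite mxE.
have -> : lift ord0 i = rshift 1 i by apply/val_inj.
exact: row_mxEr.
Qed.

Let lebesgue_rVS_sigma_finite : sigma_finite setT lebesgue_rVS.
Proof.
have /sigma_finiteP[F [TF ndF Foo]] := sigma_finiteT (@lebesgue_measure R).
have /sigma_finiteP[G [TG ndG Goo]] := sigma_finiteT m.
exists (fun k => (fun x => (headrV x, tailrV x)) @^-1` (F k `*` G k)).
  apply/seteqP; split => // x _.
  have [i _ Fi] : (\bigcup_i F i) (headrV x) by rewrite -TF.
  have [j _ Gj] : (\bigcup_i G i) (tailrV x) by rewrite -TG.
  exists (maxn i j) => //; split => /=.
  - by move: Fi; exact/subsetPset/ndF/leq_maxl.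
  - by move: Gj; exact/subsetPset/ndG/leq_maxr.
move=> k; have [mF Fk] := Foo k; have [mG Gk] := Goo k; split.
  rewrite -[X in measurable X]setTI.
  have mp : measurable_fun [set: 'rV[R]_n.+1]
      (fun x => (headrV x : measurableTypeR R, tailrV x)).
    apply: measurable_fun_pair; first exact: measurable_coord.
    apply: measurable_fun_rVP => i.
    rewrite (_ : (fun _ => _) = fun x : 'rV[R]_n.+1 => x ord0 (lift ord0 i)).
      exact: measurable_coord.
    by apply/funext => x; rewrite mxE.
  by apply: mp => //; exact: measurableX.
rewrite /lebesgue_rVS /pushforward -comp_preimage.
rewrite (_ : _ \o _ = id); last by apply/funext => p; exact: consrVK.
rewrite preimage_id product_measure1E// lte_mul_pinfty//.
by rewrite ge0_fin_numE.
Qed.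

HB.instance Definition _ := Measure_isSigmaFinite.Build _ _ _ lebesgue_rVS
  lebesgue_rVS_sigma_finite.

End step.

Fixpoint lebesgue_rV n : {sigma_finite_measure set 'rV[R]_n -> \bar R} :=
  if n is n'.+1 return {sigma_finite_measure set 'rV[R]_n -> \bar R}
  then lebesgue_rVS (lebesgue_rV n') else dirac (0 : 'rV[R]_0).

End lebesgue_rV.

Section hyperbolic_ball.
Context {R : realType} (N : nat).
Implicit Types (x : 'rV[R]_N) (u v phi : 'rV[R]_N -> R) (A : set 'rV[R]_N).

(* The norm `|x| that the library puts on row vectors is the sup norm. *)
Definition enorm x : R := Num.sqrt (\sum_(i < N) x ord0 i ^+ 2).

Definition unit_ball : set 'rV[R]_N := [set x | enorm x < 1].

(* g_ij = conf x ^+ 2 * delta_ij *)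
Definition conf x : R := 2 / (1 - enorm x ^+ 2).

Definition hvol A : \bar R :=
  (\int[lebesgue_rV N]_(x in A `&` unit_ball) (conf x ^+ N)%:E)%E.

Lemma enorm_sqr x : enorm x ^+ 2 = \sum_(i < N) x ord0 i ^+ 2.
Proof. by rewrite sqr_sqrtr// sumr_ge0// => i _; exact: sqr_ge0. Qed.

Lemma measurable_enorm_sqr :
  measurable_fun [set: 'rV[R]_N] (fun x => enorm x ^+ 2).
Proof.
under eq_fun do rewrite enorm_sqr.
apply: measurable_sum => i; apply: measurable_funX; exact: measurable_coord.
Qed.

Lemma unit_ballE : unit_ball = [set x | enorm x ^+ 2 < 1].
Proof. by apply/seteqP; split=> x /=; rewrite /unit_ball/= expr_lt1// sqrtr_ge0. Qed.

Lemma measurable_unit_ball : measurable unit_ball.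
Proof.
rewrite unit_ballE -[X in measurable X]setTI.
have -> : [set x : 'rV[R]_N | enorm x ^+ 2 < 1] =
  (fun x => enorm x ^+ 2) @^-1` `]-oo, 1[%classic.
  by apply/seteqP; split=> x /=; rewrite in_itv.
exact: measurable_enorm_sqr.
Qed.

Lemma conf_gt0 x : unit_ball x -> 0 < conf x.
Proof. by rewrite unit_ballE /conf => /= x1; rewrite divr_gt0// subr_gt0. Qed.

Lemma measurable_conf : measurable_fun unit_ball conf.
Proof.
apply: (eq_measurable_fun (fun x => 2 * (1 - enorm x ^+ 2) `^ (- 1))).
  move=> x /set_mem; rewrite unit_ballE/= => x1.
  by rewrite /conf powR_inv1// subr_ge0 ltW.
apply: measurable_funM => //; apply: (measurableT_comp (measurable_powR _)).
by apply: measurable_funB => //; apply: measurable_funTS; exact: measurable_enorm_sqr.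
Qed.

Let hvol0 : hvol set0 = 0%E.
Proof. by rewrite /hvol set0I integral_set0. Qed.

Let hvol_ge0 A : (0 <= hvol A)%E.
Proof.
apply: integral_ge0 => x [_ /conf_gt0 x0].
by rewrite lee_fin exprn_ge0// ltW.
Qed.

Let hvol_sigma_additive : semi_sigma_additive hvol.
Proof.
move=> F mF tF mUF.
rewrite /hvol setI_bigcupl ge0_integral_bigcup//.
- apply: is_cvg_ereal_nneg_natsum_cond => k _ _; exact: hvol_ge0.
- by move=> k; apply: measurableI => //; exact: measurable_unit_ball.
- apply/measurable_EFinP; apply: measurable_funX.
  apply: measurable_funS measurable_conf; first exact: measurable_unit_ball.
  by move=> x [k _ []].
- move=> x [k _ [_ /conf_gt0 x0]].
  by rewrite lee_fin exprn_ge0// ltW.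
- exact: trivIset_setIr.
Qed.

HB.instance Definition _ := isMeasure.Build _ _ _ hvol
  hvol0 hvol_ge0 hvol_sigma_additive.

Definition basis_rV (i : 'I_N) : 'rV[R]_N := delta_mx ord0 i.

Definition partials (s : seq 'I_N) phi : 'rV[R]_N -> R :=
  foldr (fun i f => 'D_(basis_rV i) f) phi s.

Definition smooth phi : Prop := forall s : seq 'I_N,
  continuous (partials s phi) /\
  forall i x, derivable (partials s phi) x (basis_rV i).

Definition test_function phi : Prop :=
  smooth phi /\ exists K : set 'rV[R]_N,
    [/\ compact K, K `<=` unit_ball & forall x, ~ K x -> phi x = 0].

Definition loc_integrable u : Prop :=
  forall K : set 'rV[R]_N, compact K -> K `<=` unit_ball ->
    (lebesgue_rV N).-integrable K (EFin \o u).

(* G is the Euclidean gradient of u in the sense of distributions on the ball.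
   Functions are defined on all of R^N, but their values off the ball are
   irrelevant, here and below. *)
Definition weak_gradient u (G : 'rV[R]_N -> 'rV[R]_N) : Prop :=
  [/\ measurable_fun setT G, loc_integrable u,
      forall i, loc_integrable (fun x => G x ord0 i)
    & forall phi, test_function phi -> forall i : 'I_N,
      (\int[lebesgue_rV N]_(x in unit_ball) (u x * 'D_(basis_rV i) phi x)%:E =
       - \int[lebesgue_rV N]_(x in unit_ball) (G x ord0 i * phi x)%:E)%E].

(* The weak gradient, which is unique up to a null set when it exists. *)
Definition wgrad u : 'rV[R]_N -> 'rV[R]_N := xget (fun=> 0) (weak_gradient u).

Definition hgrad_sqr u x : R := (conf x)^-1 ^+ 2 * enorm (wgrad u x) ^+ 2.

Definition H1norm u : \bar R :=
  ((\int[hvol]_x (hgrad_sqr u x + u x ^+ 2)%:E) `^ 2^-1)%E.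

Definition H1 : set ('rV[R]_N -> R) :=
  [set u | [/\ measurable_fun setT u, exists G, weak_gradient u G
             & (H1norm u < +oo)%E]].

(* Elements of H1 being classes modulo equality almost everywhere, a radial
   one is the class of some f(|x|). *)
Definition radial u : Prop :=
  exists2 f : R -> R, measurable_fun setT f &
    {ae hvol, forall x, u x = f (enorm x)}.

Definition H1r : set ('rV[R]_N -> R) := H1 `&` radial.

Definition critical_exponent : \bar R :=
  if N == 2 then +oo%E else (2 * N%:R / (N%:R - 2))%:E.

End hyperbolic_ball.

(* The inclusion of (E, nE) in (F, nF), two spaces of functions given with
   their norms, is a compact embedding: it is well defined, bounded, and maps
   bounded sequences to sequences that have a subsequence converging in F. *)
Definition compact_embedding {R : realType} {V : zmodType}
    (E : set V) (nE : V -> \bar R) (F : set V) (nF : V -> \bar R) : Prop :=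
  [/\ E `<=` F,
      exists C : R, forall u, E u -> (nF u <= C%:E * nE u)%E
    & forall u : V^nat, (forall n, E (u n)) ->
        (exists M : R, forall n, (nE (u n) <= M%:E)%E) ->
        exists2 k : nat^nat, increasing_seq k &
        exists2 v, F v & nF (u (k n) - v) @[n --> \oo] --> 0%E].

(* Main.v *)
(* In the variable s = |x|^N the image of Lebesgue measure is a multiple
   sigma ds of Lebesgue measure on [0, +oo[. Let u = h(s). Testing the weak
   gradient G of u against the fields x eta(s) / s, whose divergence is
   N eta'(s), gives N sigma \int h eta' ds = - \int (G . x) eta(s) / s dx.
   Let eta tend to the indicator function of [a, b], where a and b are Lebesgue
   points of h; by the Cauchy-Schwarz inequality |h a - h b|^2 is then at most a
   constant times ||u||^2 \int_a^b s^(-1-al) (1 - s)^(N-2) ds, for any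
   al >= 1 - 2/N. Hence h is locally Hoelder continuous on its Lebesgue points;
   moreover, comparing h a with a value h b such that b - a <= (1 - a)/2 and
   that is small because u is square integrable, one obtains
   h(s)^2 <= C ||u||^2 (1 - s)^(N-1) s^(-al). The power p/2 of the right-hand
   side is integrable for the hyperbolic volume when 2 < p and al < 2/p, and
   p < 2^* means that 1 - 2/N < 2/p. A bounded sequence of H1r therefore has
   a subsequence that converges almost everywhere (diagonal argument on a
   countable dense set of common Lebesgue points), and it converges in L^p by
   dominated convergence. *)
Require Import Defs.
From mathcomp Require Import all_boot all_order all_algebra.
From mathcomp Require Import all_classical all_reals all_analysis.
From mathcomp Require Import measurable_realfun lra ring.
Import Order.TTheory GRing.Theory Num.Theory.
Import numFieldNormedType.Exports.
Local Open Scope classical_set_scope.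
Local Open Scope ring_scope.

Set Implicit Arguments.
Unset Strict Implicit.
Unset Printing Implicit Defensive.

(** The field x / s is x / |x|^N, which is divergence free off the origin: this is why only eta'
    survives in the tested identity. The price is that eta has to vanish near 0, where the field is
    singular, as well as near 1; such an eta controls only differences of h. The decay therefore
    needs a second point at which h is already small, and the L^2 part of the norm is what supplies
    it. The sharp exponent al = 1 - 2/N would produce a logarithm when N = 2. Taking al strictly
    between 1 - 2/N and 2/p makes it positive, and all dimensions are treated alike. The image of
    Lebesgue measure under |x|^N is found from its behaviour under dilations, together with the
    uniqueness of Lebesgue measure on the line. Since a weak gradient is only known through an
    integral identity, the fields must be built from genuinely smooth functions. Hence the classes
    of functions closed under derivation, with exp(-1/t) at their root. *)

Lemma powR_lt1 (R : realType) (b r : R) : 0 < b -> b < 1 -> 0 < r -> b `^ r < 1.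
Proof.
move=> b0 b1 r0; rewrite [ltRHS](_ : 1 = 1 `^ r); last by rewrite powR1.
by apply: gt0_ltr_powR; rewrite ?nnegrE ?(ltW b0).
Qed.

Lemma powR01_le1 (R : realType) (t e : R) : 0 <= e -> 0 < t < 1 -> t `^ e <= 1.
Proof.
move=> e0 /andP[t0 t1]; rewrite [leRHS](_ : 1 = 1 `^ e); last by rewrite powR1.
by apply: ge0_ler_powR; rewrite ?nnegrE ?(ltW t0) ?(ltW t1).
Qed.

Lemma bernoulli (R : realDomainType) (r : R) n : 0 <= r -> r <= 1 ->
  1 - r ^+ n <= n%:R * (1 - r).
Proof.
move=> r0 r1; elim: n => [|n IH]; first by rewrite expr0 subrr mul0r.
rewrite exprS -natr1 mulrDl mul1r.
have h1 : 0 <= r ^+ n by rewrite exprn_ge0.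
have h2 : r ^+ n <= 1 by rewrite exprn_ile1.
nra.
Qed.

Lemma measurable_inv_onem (R : realType) (c : R) n (D : set R) :
  measurable D -> D `<=` `[0, 1[ -> measurable_fun D (fun t => (c / (1 - t)) ^+ n).
Proof.
move=> mD D01; apply: measurable_funX.
apply: (eq_measurable_fun (fun t : R => c * (1 - t) `^ (- 1))).
  move=> t /set_mem/D01 /=; rewrite in_itv/= => /andP[_ t1].
  by rewrite powR_inv1// subr_ge0 ltW.
apply: measurable_funM => //; apply: (measurableT_comp (measurable_powR _)).
by apply: measurable_funTS; exact: measurable_funB.
Qed.

(** * The image of Lebesgue measure under |x|^N *)

Definition image_measure d d' (T1 : measurableType d) (T2 : measurableType d')
    (R : realFieldType) (m : {measure set T1 -> \bar R}) (f : T1 -> T2)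
    (mf : measurable_fun setT f) : {measure set T2 -> \bar R} :=
  measure_function_pushforward__canonical__measure_function_Measure m mf.

Section scale.
Context {R : realType}.

(** The image measure multiplied by [l] gives []a, b]] the mass [b - a], and Lebesgue measure is
    determined by its values on these intervals. *)
Lemma lebesgue_measure_scale (l : R) (A : set (measurableTypeR R)) :
  0 < l -> measurable A ->
  lebesgue_measure ((fun x : measurableTypeR R => l * x : measurableTypeR R) @^-1` A) =
  (l^-1%:E * lebesgue_measure A)%E.
Proof.
move=> l0 mA.
pose f : measurableTypeR R -> measurableTypeR R := fun x => l * x.
have mf : measurable_fun setT f by exact: measurable_funM.
pose m : {measure set _ -> \bar R} :=
  mscale (NngNum (ltW l0)) (image_measure (@lebesgue_measure R) mf).
rewrite (_ : lebesgue_measure A = m A).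
  rewrite /m/= /mscale /image_measure/= /pushforward muleA -EFinM mulVf ?mul1e ?gt_eqF//.
apply: lebesgue_measure_unique => // _ [[a b]] _ <-.
rewrite /m/= /mscale /image_measure/= /pushforward.
rewrite (_ : preimage _ _ = `]l^-1 * a, l^-1 * b]%classic); last first.
  apply/seteqP; split=> x /=; rewrite !in_itv/= /f;
  by rewrite ltr_pdivrMl// ler_pdivlMl.
rewrite !lebesgue_measure_itv/= !lte_fin ltr_pM2l ?invr_gt0//.
case: ifPn => _; last by rewrite mule0.
by rewrite -!EFinB -EFinM -mulrBr mulrA mulfV ?mul1r ?gt_eqF.
Qed.

Lemma ge0_integral_scale (l : R) (F : R -> \bar R) :
  0 < l -> measurable_fun setT F -> (forall x, 0 <= F x)%E ->
  (\int[lebesgue_measure]_x F (l * x)%R = l^-1%:E * \int[lebesgue_measure]_x F x)%E.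
Proof.
move=> l0 mF F0.
pose f : measurableTypeR R -> measurableTypeR R := fun x => l * x.
have mf : measurable_fun setT f by exact: measurable_funM.
have := @ge0_integral_pushforward _ _ _ _ R f mf lebesgue_measure setT F
  measurableT mF (fun y _ => F0 y).
rewrite preimage_setT => <-.
have l1 : 0 <= l^-1 by rewrite invr_ge0 ltW.
rewrite -(@ge0_integral_mscale _ _ _ lebesgue_measure setT measurableT (NngNum l1))//.
apply: eq_measure_integral => A mA _; rewrite /pushforward /mscale.
exact: lebesgue_measure_scale.
Qed.

Lemma scale_consrV n (l a : R) (x : 'rV[R]_n) :
  l *: consrV (a, x) = consrV (l * a, l *: x).
Proof.
apply/rowP => i; rewrite mxE /consrV/=.
have -> : i = unsplit (@fintype.split 1 n i) by rewrite splitK.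
case: fintype.split => j /=.
  rewrite (row_mxEl (const_mx a : 'rV_1) x) (row_mxEl (const_mx (l * a) : 'rV_1)).
  by rewrite !mxE.
rewrite (row_mxEr (const_mx a : 'rV_1) x) (row_mxEr (const_mx (l * a) : 'rV_1)).
by rewrite !mxE.
Qed.

(** By induction on [n]: the slice over [a] of the preimage is the preimage of the slice over
    [l * a], and each coordinate contributes one factor [l^-1]. *)
Lemma lebesgue_rV_scale n (l : R) (A : set 'rV[R]_n) :
  0 < l -> measurable A ->
  lebesgue_rV n ((fun x => l *: x) @^-1` A) =
  ((l^-1 ^+ n)%:E * lebesgue_rV n A)%E.
Proof.
move=> l0; elim: n A => [|n IH] A mA.
  rewrite expr0 mul1e/= /dirac.
  congr ((\1_ _ _)%:E); apply/seteqP; split => x /=;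
  by rewrite (_ : l *: x = x)//; apply/rowP => -[].
rewrite /= /lebesgue_rVS /pushforward /product_measure1/=.
set B := consrV (n:=n) @^-1` A.
have mB : measurable B.
  by rewrite -[B]setTI; exact: measurable_consrV.
transitivity (\int[lebesgue_measure]_x
   ((l^-1 ^+ n)%:E * (lebesgue_rV n (xsection B (l * x)%R))))%E.
  apply: eq_integral => a _ /=; rewrite -IH; last exact: measurable_xsection.
  congr (lebesgue_rV n _); apply/seteqP; split => y;
  by rewrite /xsection/= !inE /B/= scale_consrV.
have mx : measurable_fun setT (fun x => lebesgue_rV n (xsection B x)).
  exact: measurable_fun_xsection.
rewrite ge0_integralZl//; last 2 first.
  apply: (measurableT_comp mx); exact: measurable_funM.
  by rewrite lee_fin exprn_ge0// invr_ge0 ltW.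
rewrite (ge0_integral_scale (F := fun x => lebesgue_rV n (xsection B x)))//.
by rewrite muleA -EFinM exprSr.
Qed.

(** Cubes are products, so their measure is explicit; they serve to show that the unit ball has
    finite and positive measure. *)
Definition cube n (a : R) : set 'rV[R]_n :=
  [set x | forall i, x ord0 i \in `[- a, a]].

Arguments cube : clear implicits.

Lemma measurable_cube n (a : R) : measurable (cube n a).
Proof.
rewrite (_ : cube n a = \bigcap_(i in [set: 'I_n])
  ((fun x : 'rV[R]_n => x ord0 i) @^-1` `[- a, a]%classic)).
  apply: fin_bigcap_measurable => // i _.
  by rewrite -[X in measurable X]setTI; exact: measurable_coord.
by apply/seteqP; split => x /= H i; [move=> _|]; exact: H.
Qed.

Lemma lebesgue_rV_cube n (a : R) : 0 <= a ->
  lebesgue_rV n (cube n a) = ((a *+ 2) ^+ n)%:E.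
Proof.
move=> a0; elim: n => [|n IH].
  rewrite expr0/= /dirac indicE mem_set//= => -[]//.
rewrite /= /lebesgue_rVS /pushforward.
rewrite (_ : _ @^-1` _ = `[- a, a]%classic `*`
   cube n a); last first.
  apply/seteqP; split => -[x y] /=.
    move=> H; split.
      have := H (lshift n (ord0 : 'I_1)).
      by rewrite /consrV/= (row_mxEl (const_mx x : 'rV_1) y) mxE.
    move=> i; have := H (rshift 1 i).
      by rewrite /consrV/= (row_mxEr (const_mx x : 'rV_1) y).
  move=> [Hx Hy] i.
  have -> : i = unsplit (@fintype.split 1 n i) by rewrite splitK.
  case: fintype.split => j /=; rewrite /consrV.
    by rewrite (row_mxEl (const_mx x : 'rV_1) y) mxE.
  by rewrite (row_mxEr (const_mx x : 'rV_1) y).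
rewrite product_measure1E//; last exact: measurable_cube.
rewrite [X in (_ * X)%E = _]IH exprS EFinM; congr (_ * _)%E.
apply: etrans (lebesgue_measure_itv `[- a, a]) _; rewrite /= lte_fin.
case: ifPn => [_|]; first by rewrite -EFinB opprK mulr2n.
rewrite -leNgt -subr_le0 opprK -mulr2n pmulrn_lle0// => a0'.
by have/eqP -> : a == 0; [rewrite eq_le a0 a0'|rewrite mul0rn].
Qed.

End scale.

Arguments cube {R} n a.

Section radial_measure.
Context {R : realType} (N : nat).
Hypothesis N0 : (0 < N)%N.

Definition rad (x : 'rV[R]_N) : R := enorm x ^+ N.

Lemma enorm_ge0 (x : 'rV[R]_N) : 0 <= enorm x.
Proof. exact: sqrtr_ge0. Qed.

Lemma rad_ge0 x : 0 <= rad x.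
Proof. exact: exprn_ge0 (enorm_ge0 x). Qed.

Lemma measurable_enorm : measurable_fun setT (@enorm R N).
Proof.
rewrite (_ : @enorm R N = Num.sqrt \o (fun x => enorm x ^+ 2)).
  have ms : measurable_fun [set: R] (@Num.sqrt R).
    by apply: continuous_measurable_fun; exact: sqrt_continuous.
  exact: (measurableT_comp ms (@measurable_enorm_sqr R N)).
by apply/funext => x /=; rewrite sqrtr_sqr ger0_norm// enorm_ge0.
Qed.

Lemma measurable_rad : measurable_fun setT (rad : _ -> measurableTypeR R).
Proof. by apply: measurable_funX; exact: measurable_enorm. Qed.

Lemma enormZ (l : R) (x : 'rV[R]_N) : 0 <= l -> enorm (l *: x) = l * enorm x.
Proof.
move=> l0; rewrite /enorm; under eq_bigr do rewrite mxE exprMn.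
by rewrite -mulr_sumr sqrtrM ?sqr_ge0// sqrtr_sqr ger0_norm.
Qed.

Lemma rad_lt1 x : (rad x < 1) = (enorm x < 1).
Proof. by rewrite /rad expr_lt1 ?enorm_ge0. Qed.

Let B r := rad @^-1` `]-oo, r]%classic.

Let mB r : measurable (B r).
Proof. by rewrite /B -[X in measurable X]setTI; exact: measurable_rad. Qed.

Let leB r s : r <= s -> (lebesgue_rV N (B r) <= lebesgue_rV N (B s))%E.
Proof.
move=> rs; apply: le_measure; rewrite ?inE; [exact: mB|exact: mB|].
by move=> x; rewrite /B/= !in_itv/= => /le_trans; exact.
Qed.

Let B_scale r : 0 < r -> (lebesgue_rV N (B r) = r%:E * lebesgue_rV N (B 1%R))%E.
Proof.
(* The dilation by [l] multiplies [rad] by [l ^+ N = r^-1], which makes the volume of [B r] linear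
   in [r]. *)
move=> r0; pose l := r `^ (- N%:R^-1).
have l0 : 0 < l by exact: powR_gt0.
have lN : l ^+ N = r^-1.
  rewrite -powR_mulrn ?ltW// /l -powRrM mulNr mulVf ?powR_inv1 ?ltW//.
  by rewrite pnatr_eq0 -lt0n.
rewrite (_ : B r = (fun x => l *: x) @^-1` B 1).
  by rewrite lebesgue_rV_scale// exprVn lN invrK.
apply/seteqP; split => x;
by rewrite /B/= !in_itv/= /rad (enormZ _ (ltW l0)) exprMn lN ler_pdivrMl// mulr1.
Qed.

Let B1_fin : (lebesgue_rV N (B 1%R) < +oo)%E.
Proof.
pose C : set 'rV[R]_N := cube N 1.
have mC : measurable C by exact: measurable_cube.
apply: (@le_lt_trans _ _ (lebesgue_rV N C)).
  apply: le_measure; rewrite ?inE//.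
  move=> x; rewrite /B/C/= in_itv/= /rad (expr_le1 N0 (enorm_ge0 x)) => x1 i.
  rewrite in_itv/= -ler_norml -sqrtr_sqr.
  apply: le_trans x1; apply: ler_wsqrtr.
  by rewrite (bigD1 i)//= lerDl sumr_ge0// => j _; rewrite sqr_ge0.
by rewrite lebesgue_rV_cube// ltry.
Qed.

Let B1_gt0 : (0 < lebesgue_rV N (B 1%R))%E.
Proof.
(* A cube of half-side 1/N lies in the unit ball because N (1/N)^2 = 1/N <= 1. *)
pose a : R := N%:R^-1.
have Np : 0 < N%:R :> R by rewrite ltr0n.
have a0 : 0 < a by rewrite invr_gt0.
pose C : set 'rV[R]_N := cube N a.
have mC : measurable C by exact: measurable_cube.
apply: (@lt_le_trans _ _ (lebesgue_rV N C)).
  by rewrite lebesgue_rV_cube ?ltW// lte_fin exprn_gt0// pmulrn_lgt0.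
apply: le_measure; rewrite ?inE//.
move=> x; rewrite /B/C/= in_itv/= => xa.
rewrite /rad (expr_le1 N0 (enorm_ge0 x)).
rewrite -(@ler_pXn2r _ 2) ?nnegrE ?enorm_ge0// expr1n enorm_sqr.
apply: (@le_trans _ _ (\sum_(i < N) a ^+ 2)).
  apply: ler_sum => i _; rewrite -[leLHS]ger0_norm ?sqr_ge0// normrX.
  by rewrite ler_pXn2r ?nnegrE ?normr_ge0 ?(ltW a0)// ler_norml; exact: xa.
rewrite sumr_const card_ord (_ : a ^+ 2 *+ N = a).
  by rewrite /a invf_le1// ler1n.
by rewrite -mulr_natl /a expr2 mulrA mulfV ?mul1r ?gt_eqF.
Qed.

(** The volume of the Euclidean unit ball, since [rad x <= 1] means |x| <= 1. *)
Definition sigma : R := fine (lebesgue_rV N (rad @^-1` `]-oo, 1]%classic)).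

Lemma sigma_gt0 : 0 < sigma.
Proof. by rewrite fine_gt0// B1_gt0 B1_fin. Qed.

Let B_E r : (lebesgue_rV N (B r) = (Num.max r 0 * sigma)%:E)%E.
Proof.
have Bf : (sigma%:E = lebesgue_rV N (B 1%R))%E.
  by rewrite fineK// ge0_fin_numE ?measure_ge0// B1_fin.
have [r0|r0|->] := ltgtP r 0.
- rewrite mul0r (_ : B r = set0) ?measure0//.
  apply/seteqP; split => // x; rewrite /B/= in_itv/= => xr.
  by have := rad_ge0 x; rewrite leNgt (le_lt_trans xr).
- by rewrite EFinM Bf B_scale.
- rewrite mul0r; apply/eqP; rewrite eq_le measure_ge0 andbT.
  apply/lee_addgt0Pr => e e0; rewrite add0e.
  apply: (@le_trans _ _ (lebesgue_rV N (B (e / sigma)%R))).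
    by apply: leB; exact/ltW/divr_gt0/sigma_gt0.
  by rewrite B_scale ?divr_gt0 ?sigma_gt0// -Bf -EFinM divfK// gt_eqF ?sigma_gt0.
Qed.

(** Lebesgue measure is identified by its values on intervals of the whole line, whereas the image
    measure lives on the half-line. The normalized image is therefore completed by Lebesgue measure
    on the negative reals before uniqueness is applied. *)
Lemma radial_measure (A : set (measurableTypeR R)) :
  measurable A -> A `<=` `[0, +oo[%classic ->
  (lebesgue_rV N (rad @^-1` A) = sigma%:E * lebesgue_measure A)%E.
Proof.
move=> mA A0.
have s0 := sigma_gt0.
have si : 0 <= sigma^-1 by rewrite invr_ge0 ltW.
pose neg : set (measurableTypeR R) := `]-oo, 0[%classic.
have mneg : measurable neg by exact: measurable_itv.
pose m1 : {measure set _ -> \bar R} :=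
  mscale (NngNum si) (image_measure (lebesgue_rV N) measurable_rad).
pose m2 : {measure set _ -> \bar R} := mrestr (@lebesgue_measure R) mneg.
pose m : {measure set _ -> \bar R} := measure_add m1 m2.
have m1E X : (m1 X = sigma^-1%:E * lebesgue_rV N (rad @^-1` X))%E by [].
have m2E X : m2 X = lebesgue_measure (X `&` neg) by [].
have mE X : (m X = m1 X + m2 X)%E by exact: measure_addE.
suff H : (lebesgue_measure A = m A)%E.
  rewrite H mE m1E m2E (_ : A `&` neg = set0) ?measure0 ?adde0.
    by rewrite muleA -EFinM mulfV ?mul1e// gt_eqF.
  apply/seteqP; split => // x [/A0]; rewrite /neg/= !in_itv/= andbT => x0.
  by rewrite ltNge x0.
apply: lebesgue_measure_unique => // _ [[a b]] _ <- /=.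
rewrite mE m1E m2E lebesgue_measure_itv/= lte_fin.
have [ab|ba] := ltP a b; last first.
  rewrite set_itv_ge ?bnd_simp -?leNgt//.
  by rewrite preimage_set0 set0I !measure0 mule0 adde0.
have -> : (lebesgue_rV N (rad @^-1` `]a, b]) =
   ((Num.max b 0 - Num.max a 0) * sigma)%:E)%E.
  rewrite (_ : rad @^-1` _ = B b `\` B a); last first.
    apply/seteqP; split => x; rewrite /B/= !in_itv/=.
      by move=> /andP[ax xb]; split => //; apply/negP; rewrite -ltNge.
    by move=> [xb /negP]; rewrite -ltNge => ->.
  rewrite measureD; [|exact: mB|exact: mB|by rewrite [X in (X < _)%E]B_E ltry].
  rewrite (_ : B b `&` B a = B a).
    by rewrite [X in (X - _)%E]B_E [X in (_ - X)%E]B_E -EFinB mulrBl.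
  by apply/setIidPr => x; rewrite /B/= !in_itv/= => /le_trans; apply; exact: ltW.
rewrite -EFinM (mulrC _ sigma) mulrA mulVf ?gt_eqF// mul1r.
have [b0|b0] := ltP b 0.
  rewrite (_ : _ `&` _ = `]a, b]%classic); last first.
    apply/setIidPl => x; rewrite /neg/= !in_itv/= => /andP[_ xb].
    exact: le_lt_trans xb b0.
  rewrite lebesgue_measure_itv/= lte_fin ab.
  rewrite (max_idPr (ltW (lt_trans ab b0))) subrr add0e.
  by [].
have [a0|a0] := ltP a 0.
  rewrite (_ : _ `&` _ = `]a, 0[%classic); last first.
    apply/seteqP; split => x; rewrite /neg/= !in_itv/=.
      by move=> [/andP[-> _] ->].
    by move=> /andP[-> x0]; split => //; rewrite (le_trans (ltW x0)).
  rewrite lebesgue_measure_itv/= lte_fin a0.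
  by rewrite -EFinB -EFinD; congr EFin; ring.
rewrite (_ : _ `&` _ = set0) ?measure0 ?adde0 //.
apply/seteqP; split => // x; rewrite /neg/= !in_itv/= => -[/andP[ax _]].
by rewrite ltNge (ltW (le_lt_trans a0 ax)).
Qed.

End radial_measure.
Arguments sigma {R} N.

(** * Integration for the hyperbolic volume *)

Section density.
Local Open Scope ereal_scope.
Context d (T : measurableType d) (R : realType).
Variables (mu nu : {measure set T -> \bar R}) (D : set T) (g : T -> R).
Hypotheses (mD : measurable D) (mg : measurable_fun D g).
Hypothesis g0 : forall x, D x -> (0 <= g x)%R.
Hypothesis nuE : forall A, measurable A -> nu A = \int[mu]_(x in A `&` D) (g x)%:E.

Import HBNNSimple.

(** Both sides are monotone limits along the simple functions that approximate [f]; on the indicator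
    of a level set the equality is [nuE]. *)
Lemma ge0_integral_density (f : T -> \bar R) :
  measurable_fun setT f -> (forall x, 0 <= f x) ->
  \int[nu]_x f x = \int[mu]_(x in D) (f x * (g x)%:E).
Proof.
move=> mf f0.
pose f_ := nnsfun_approx measurableT mf.
have mfn n : measurable_fun D (fun x => (f_ n x)%:E).
  by apply/measurable_EFinP/measurable_funTS.
transitivity (limn (fun n => \int[nu]_x (f_ n x)%:E)).
  rewrite -monotone_convergence//.
  - apply: eq_integral => y _; apply/esym/cvg_lim => //.
    by apply: cvg_nnsfun_approx.
  - by move=> n; exact/measurable_EFinP/measurable_funP.
  - by move=> n y _; rewrite lee_fin.
  - by move=> y _ m n mn; rewrite lee_fin; exact/lefP/nd_nnsfun_approx.
transitivity (limn (fun n => \int[mu]_(x in D) ((f_ n x)%:E * (g x)%:E))); last first.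
  rewrite -monotone_convergence//.
  - apply: eq_integral => y /[!inE] Dy; apply/cvg_lim => //.
    by apply: cvgeZr => //; exact: cvg_nnsfun_approx.
  - by move=> n; apply: emeasurable_funM => //; exact/measurable_EFinP.
  - by move=> n y Dy; rewrite mule_ge0 ?lee_fin ?g0//.
  - move=> y Dy m n mn; rewrite lee_wpmul2r ?lee_fin ?g0//.
    exact/lefP/nd_nnsfun_approx.
congr (limn _); apply: eq_fun => n.
transitivity (\sum_(k \in range (f_ n)) k%:E * nu (f_ n @^-1` [set k])).
  by rewrite integralT_nnsfun sintegralE.
transitivity (\int[mu]_(x in D) \sum_(k \in range (f_ n))
    ((k * \1_(f_ n @^-1` [set k]) x)%:E * (g x)%:E)); last first.
  apply: eq_integral => x _.
  rewrite [in RHS]fimfunE -fsumEFin// ge0_mule_fsuml// => k.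
  by rewrite EFinM nnfun_muleindic_ge0.
rewrite ge0_integral_fsum//; last 2 first.
- move=> k; apply: emeasurable_funM => //.
  by apply/measurable_EFinP/measurable_funM.
  exact/measurable_EFinP.
- by move=> k x Dx; rewrite mule_ge0 ?(lee_fin, g0)// -lee_fin EFinM nnfun_muleindic_ge0.
apply: eq_fsbigr => k /[!inE] -[x _ <-].
under eq_integral do rewrite EFinM -muleA.
rewrite ge0_integralZl//; first 1 last.
- apply: emeasurable_funM; last exact/measurable_EFinP.
  by apply/measurable_EFinP/measurable_indic.
- by move=> y Dy; rewrite mule_ge0 ?lee_fin ?g0.
- by rewrite lee_fin.
congr (_ * _); rewrite nuE// setIC integral_mkcondr.
apply: eq_integral => y _; rewrite patchE indicE.
by case: ifPn => _; rewrite ?mul1e ?mul0e.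
Qed.
End density.

Section hyperbolic.
Context {R : realType} (N : nat).
Hypothesis N0 : (0 < N)%N.
Local Notation leb := (@lebesgue_rV R N).
Local Notation ball := (@unit_ball R N).

Lemma ge0_integral_hvol (f : 'rV[R]_N -> \bar R) :
  measurable_fun setT f -> (forall x, 0 <= f x)%E ->
  (\int[@hvol R N]_x f x = \int[leb]_(x in ball) (f x * (conf x ^+ N)%:E))%E.
Proof.
move=> mf f0; apply: (@ge0_integral_density _ _ _ _ _ _ (fun x => conf x ^+ N)) => //.
- exact: measurable_unit_ball.
- by apply: measurable_funX; exact: measurable_conf.
- by move=> x /conf_gt0/ltW; exact: exprn_ge0.
Qed.

Lemma hvol_null (A : set 'rV[R]_N) : measurable A ->
  leb (A `&` ball) = 0%E -> hvol A = 0%E.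
Proof.
move=> mA A0; have mAb : measurable (A `&` ball).
  by apply: measurableI => //; exact: measurable_unit_ball.
rewrite /hvol null_set_integral//; apply/measurable_EFinP.
apply: measurable_funX; apply: measurable_funS (@measurable_conf R N) => //.
exact: measurable_unit_ball.
Qed.

(** The density [conf ^+ N] is positive on the ball, so a subset of the ball over which it
    integrates to 0 is null for Lebesgue measure. *)
Lemma ae_hvol_leb (P : 'rV[R]_N -> Prop) :
  {ae @hvol R N, forall x, P x} -> {ae leb, forall x, ball x -> P x}.
Proof.
move=> [A [mA A0 PA]]; exists (A `&` ball); split.
- by apply: measurableI => //; exact: measurable_unit_ball.
- have mAb : measurable (A `&` ball).
    by apply: measurableI => //; exact: measurable_unit_ball.
  have mc : measurable_fun (A `&` ball) (fun x => (conf x ^+ N)%:E).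
    apply/measurable_EFinP.
    apply: measurable_funX; apply: measurable_funS (@measurable_conf R N) => //.
    exact: measurable_unit_ball.
  have : (\int[leb]_(x in A `&` ball) `|(conf x ^+ N)%:E| = 0)%E.
    rewrite -[RHS]A0; apply: eq_integral => x; rewrite inE => -[_ /conf_gt0 c0].
    by rewrite gee0_abs// lee_fin exprn_ge0// ltW.
  move/(ae_eq_integral_abs _ mAb mc) => -[Z [mZ Z0 AZ]].
  apply/eqP; rewrite eq_le measure_ge0 andbT -[leRHS]Z0.
  apply: le_measure; rewrite ?inE// => x [Ax bx]; apply: AZ => /=.
  move=> /(_ (conj Ax bx)) [] /eqP.
  by rewrite gt_eqF// exprn_gt0// conf_gt0.
- move=> x /= /not_implyP[bx Px]; split => //; exact: PA.
Qed.

Lemma ge0_integral_rad (D : set R) (g : R -> \bar R) :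
  measurable D -> D `<=` `[0, +oo[%classic -> measurable_fun D g ->
  (forall t, D t -> 0 <= g t)%E ->
  (\int[leb]_(x in (@rad R N) @^-1` D) g (rad x) =
   (@sigma R N)%:E * \int[lebesgue_measure]_(t in D) g t)%E.
Proof.
move=> mD D0 mg g0.
rewrite -(@ge0_integral_pushforward _ _ _ _ R _ (@measurable_rad R N) leb D g)//;
  last by move=> t /[!inE]; exact: g0.
rewrite -(@ge0_integral_mscale _ _ _ lebesgue_measure D mD
  (NngNum (ltW (sigma_gt0 N0))))//.
apply: eq_measure_integral => [|mr A mA AD]; first exact: measurable_rad.
rewrite /pushforward /mscale/=.
by apply: (radial_measure N0) => //; exact: subset_trans D0.
Qed.

Lemma integrable_rad (D : set R) (g : R -> R) :
  measurable D -> D `<=` `[0, +oo[%classic -> measurable_fun D g ->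
  leb.-integrable ((@rad R N) @^-1` D) (fun x => (g (rad x))%:E) ->
  (@lebesgue_measure R).-integrable D (EFin \o g).
Proof.
move=> mD D0 mg /integrableP[_ gi]; apply/integrableP; split.
  exact/measurable_EFinP.
have : ((@sigma R N)%:E * \int[lebesgue_measure]_(t in D) `|(EFin \o g) t| < +oo)%E.
  by rewrite -ge0_integral_rad//; do 2 apply: measurableT_comp => //.
have s0 : 0 < @sigma R N by exact: sigma_gt0.
apply: contraTT; rewrite -!leNgt !leye_eq => /eqP ->.
by rewrite gt0_muley ?lte_fin.
Qed.

Lemma integral_rad (D : set R) (g : R -> R) :
  measurable D -> D `<=` `[0, +oo[%classic -> measurable_fun D g ->
  leb.-integrable ((@rad R N) @^-1` D) (fun x => (g (rad x))%:E) ->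
  (\int[leb]_(x in (@rad R N) @^-1` D) (g (rad x))%:E =
   (@sigma R N)%:E * \int[lebesgue_measure]_(t in D) (g t)%:E)%E.
Proof.
move=> mD D0 mg gi; have gi' := integrable_rad mD D0 mg gi.
rewrite integralE [in RHS]integralE.
have Hp : (\int[leb]_(x in (@rad R N) @^-1` D) (fun x => (g (rad x))%:E)^\+ x =
   (@sigma R N)%:E * \int[lebesgue_measure]_(t in D) (fun t => (g t)%:E)^\+ t)%E.
  rewrite -ge0_integral_rad//; first by apply: eq_integral => x _; rewrite ?funeposE ?funenegE.
  by apply: measurable_funepos; exact/measurable_EFinP.
have Hn : (\int[leb]_(x in (@rad R N) @^-1` D) (fun x => (g (rad x))%:E)^\- x =
   (@sigma R N)%:E * \int[lebesgue_measure]_(t in D) (fun t => (g t)%:E)^\- t)%E.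
  rewrite -ge0_integral_rad//; first by apply: eq_integral => x _; rewrite ?funeposE ?funenegE.
  by apply: measurable_funeneg; exact/measurable_EFinP.
apply: (etrans (congr2 (fun a b => a - b)%E Hp Hn)).
rewrite -muleBr//; apply: fin_num_adde_defr.
by apply: integrable_fin_num => //; exact: integrable_funepos gi'.
Qed.

Lemma ball_rad : ball = @rad R N @^-1` `[0, 1[%classic.
Proof.
apply/seteqP; split => x; rewrite /unit_ball/= in_itv/= rad_ge0 rad_lt1//.
Qed.

Lemma measurable_ball_sqr b : measurable [set x : 'rV[R]_N | enorm x ^+ 2 <= b].
Proof.
rewrite (_ : [set x | _] = (fun x => enorm x ^+ 2) @^-1` `]-oo, b]%classic).
  by rewrite -[X in measurable X]setTI; exact: measurable_enorm_sqr.
by apply/seteqP; split => x /=; rewrite in_itv.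
Qed.

Lemma ball_sqr_sub b : b < 1 -> [set x : 'rV[R]_N | enorm x ^+ 2 <= b] `<=` ball.
Proof. by move=> b1 x /= xb; rewrite unit_ballE/=; exact: le_lt_trans b1. Qed.

Lemma measurable_comp_rad (f : R -> \bar R) :
  measurable_fun (`[0, 1[%classic : set R) f -> measurable_fun ball (fun x => f (rad x)).
Proof.
move=> mf; rewrite ball_rad.
have mI : measurable (`[0, 1[%classic : set (measurableTypeR R)) by exact: measurable_itv.
have mr : measurable_fun (@rad R N @^-1` `[0, 1[%classic) (@rad R N : _ -> measurableTypeR R).
  by apply: measurable_funTS; exact: measurable_rad.
by apply: (measurable_comp mI _ mf mr); move=> _ [x + <-].
Qed.

Lemma measurable_energy (u : 'rV[R]_N -> R) (G : 'rV[R]_N -> 'rV[R]_N) :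
  measurable_fun setT u -> measurable_fun setT G ->
  measurable_fun setT (fun x => (conf x)^-1 ^+ 2 * enorm (G x) ^+ 2 + u x ^+ 2).
Proof.
move=> mu mG.
have mGs : measurable_fun setT (fun x => enorm (G x) ^+ 2).
  exact: (measurableT_comp (@measurable_enorm_sqr R N) mG).
have mc : measurable_fun setT (fun x : 'rV[R]_N => (conf x)^-1).
  rewrite (_ : (fun x => _) = (fun x : 'rV[R]_N => (1 - enorm x ^+ 2) / 2)).
    by apply: measurable_funM => //; apply: measurable_funB => //; exact: measurable_enorm_sqr.
  by apply/funext => x; rewrite /conf invf_div.
exact: measurable_funD (measurable_funM (measurable_funX 2 mc) mGs) (measurable_funX 2 mu).
Qed.

Lemma energy_ge0 (u : 'rV[R]_N -> R) (G : 'rV[R]_N -> 'rV[R]_N) x :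
  0 <= (conf x)^-1 ^+ 2 * enorm (G x) ^+ 2 + u x ^+ 2.
Proof. by rewrite addr_ge0 ?sqr_ge0//; apply: mulr_ge0; exact: sqr_ge0. Qed.

(** From 1 - s <= N (1 - |x|), which is Bernoulli's inequality, and |x|^2 <= |x|. Together with
    [conf_ge] this makes [conf x] comparable to 1 / (1 - s): the upper bound serves for the
    integrability of the envelope, the lower one for the decay. *)
Lemma conf_le (x : 'rV[R]_N) : ball x -> conf x <= 2 * N%:R / (1 - rad x).
Proof.
move=> bx; have r1 : rad x < 1 by move: bx; rewrite ball_rad//= in_itv/= => /andP[].
have x0 := enorm_ge0 x.
have x1 : enorm x < 1 by exact: bx.
have q1 : enorm x ^+ 2 <= enorm x by rewrite expr2 ler_piMl// ltW.
have B : 1 - rad x <= N%:R * (1 - enorm x) by apply: bernoulli => //; exact: ltW.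
rewrite /conf ler_pdivlMr ?subr_gt0// mulrAC ler_pdivrMr; last first.
  by rewrite subr_gt0; exact: le_lt_trans x1.
rewrite -mulrA ler_pM2l//; apply: (le_trans B).
by rewrite ler_wpM2l// lerD2l lerN2.
Qed.

Section dim_ge2.
Hypothesis N2 : (2 <= N)%N.

Lemma rad_le_sqr (x : 'rV[R]_N) : ball x -> rad x <= enorm x ^+ 2.
Proof.
rewrite unit_ballE/= => x1.
rewrite /rad (_ : enorm x ^+ N = enorm x ^+ (N - 2) * enorm x ^+ 2); last by rewrite -exprD subnK.
rewrite ler_piMl ?sqr_ge0//.
by rewrite exprn_ile1 ?enorm_ge0// -(@expr_le1 _ 2)// ?enorm_ge0// ltW.
Qed.

Lemma conf_ge (x : 'rV[R]_N) : ball x -> 2 / (1 - rad x) <= conf x.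
Proof.
move=> bx; have H := rad_le_sqr bx; move: bx; rewrite unit_ballE/= => x1.
rewrite /conf ler_pM2l// lef_pV2 ?posrE ?subr_gt0//; last exact: le_lt_trans x1.
by rewrite lerD2l lerN2.
Qed.

End dim_ge2.

Lemma ae_hvol_rad (P : R -> Prop) :
  {ae @lebesgue_measure R, forall t, 0 < t < 1 -> P t} ->
  {ae @hvol R N, forall x, P (rad x)}.
Proof.
move=> [Z [mZ Z0 PZ]].
(* The origin joins the exceptional set because [P] is only assumed for [0 < t]. *)
pose Z' : set (measurableTypeR R) := (Z `|` [set 0]) `&` `[0, +oo[%classic.
have mZ' : measurable Z'.
  by apply: measurableI; [apply: measurableU|] => //; exact: measurable_itv.
have mr : measurable (@rad R N @^-1` Z').
  by rewrite -[X in measurable X]setTI; exact: measurable_rad.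
have mb := @measurable_unit_ball R N.
exists (@rad R N @^-1` Z' `|` ~` ball); split.
- by apply: measurableU => //; exact: measurableC.
- apply: hvol_null.
    by apply: measurableU => //; exact: measurableC.
  apply/eqP; rewrite eq_le measure_ge0 andbT.
  apply: (@le_trans _ _ (leb (@rad R N @^-1` Z'))).
    apply: le_measure; rewrite ?inE//; last by move=> x [[]].
    by apply: measurableI => //; apply: measurableU => //; exact: measurableC.
  rewrite radial_measure//; last by move=> x [].
  rewrite [X in (_ * X)%E](_ : _ = 0%E) ?mule0//.
  apply/eqP; rewrite eq_le measure_ge0 andbT.
  apply: (@le_trans _ _ (lebesgue_measure (Z `|` [set 0]))).
    apply: le_measure; rewrite ?inE//; first exact: measurableU.
    by move=> x [].
  apply: (le_trans (measureU2 _ mZ (measurable_set1 _))).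
  by rewrite [X in (X + _ <= _)%E]Z0 [X in (_ + X <= _)%E]lebesgue_measure_set1 adde0.
- move=> x /= Px; have [bx|bx] := pselect (ball x); [left|by right].
  split; last by rewrite /= in_itv/= rad_ge0.
  have [r0|r0] := eqVneq (rad x) 0; [by right|left; apply: PZ => /= H].
  apply/Px/H; rewrite lt_neqAle eq_sym r0 rad_ge0/=.
  by move: bx; rewrite ball_rad/= in_itv/= => /andP[].
Qed.

End hyperbolic.

(** * Smooth functions *)

Section flat.
Context {R : realType}.
Implicit Types (P : {poly R}).

(** For [P = 1] this is the classical function exp(-1/t), flat at 0; the polynomial in 1/t makes the
    family closed under derivation. *)
Definition flat P (t : R) : R := if 0 < t then P.[t^-1] * expR (- t^-1) else 0.

(** The rate is left free for the sake of the induction on the polynomial: each new factor y is paid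
    with half of the exponent, by y <= (2m + 2) exp(y / (2m + 2)). *)
Lemma horner_le_expR P (m : nat) : exists2 C : R, 0 <= C &
  forall y, 0 <= y -> `|P.[y]| <= C * expR (y / m.+1%:R).
Proof.
elim/poly_ind: P m => [|P c IH] m.
  by exists 0 => // y _; rewrite horner0 normr0 mul0r.
have [C C0 HC] := IH (m.*2.+1)%N.
exists (C * m.*2.+2%:R + `|c|); first by rewrite addr_ge0// mulr_ge0.
move=> y y0; rewrite hornerMXaddC (le_trans (ler_normD _ _))// mulrDl lerD//.
  have E : expR (y / m.+1%:R) = expR (y / m.*2.+2%:R) * expR (y / m.*2.+2%:R) :> R.
    rewrite -expRD; congr expR.
    rewrite -doubleS -muln2 natrM invfM.
    by field; rewrite nat1r pnatr_eq0.
  rewrite normrM (ger0_norm y0) E.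
  rewrite (_ : C * _ * (_ * _) = C * expR (y / m.*2.+2%:R) *
    (m.*2.+2%:R * expR (y / m.*2.+2%:R))); last by ring.
  rewrite ler_pM ?normr_ge0 ?HC//.
  rewrite -ler_pdivrMl ?ltr0n// mulrC.
  by rewrite (le_trans _ (expR_ge1Dx _))// lerDr.
by rewrite ler_peMr// (le_trans _ (expR_ge1Dx _))// lerDl divr_ge0.
Qed.

Lemma is_derive_flat P (t : R) :
  is_derive t (1 : R) (flat P) (flat ('X^2 * (P - P^`()))%R t).
Proof.
have [t0|t0|->] := ltgtP t 0.
- have -> : flat ('X^2 * (P - P^`())) t = 0 by rewrite /flat ltNge (ltW t0).
  apply: (@near_eq_is_derive _ _ _ (cst 0)).
  near=> z; rewrite /flat ifF//; apply/negbTE; rewrite -leNgt.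
  by apply: ltW; near: z; exact: lt_nbhsl.
- have di : is_derive t (1 : R) (fun y : R => y^-1) (- t ^- 2 *: 1).
    by apply: is_deriveV; rewrite gt_eqF.
  have -> : flat ('X^2 * (P - P^`())) t =
      P.[t^-1] *: (expR (- t^-1) * (- (- t ^- 2 *: 1))) +
      expR (- t^-1) *: (P^`().[t^-1] * (- t ^- 2 *: 1)).
    rewrite /flat t0 hornerM hornerXn !hornerE /GRing.scale/= exprVn.
    by ring.
  have dP : is_derive t (1 : R) (fun t : R => P.[t^-1]) (P^`().[t^-1] * (- t ^- 2 *: 1)).
    exact: (@is_derive1_comp _ (horner P) (fun t : R => t^-1)).
  have dE : is_derive t (1 : R) (fun t : R => expR (- t^-1))
      (expR (- t^-1) * (- (- t ^- 2 *: 1))).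
    exact: (@is_derive1_comp _ expR (fun t : R => - t^-1)).
  have H := is_deriveM dP dE.
  apply: near_eq_is_derive H.
  near=> z; rewrite /flat ifT//.
  by near: z; exact: lt_nbhsr.
have -> : flat ('X^2 * (P - P^`())) 0 = 0 by rewrite /flat ltxx.
(* Applied to X^2 P, the bound reads y^2 |P(y)| <= C exp(y). With y = 1/z it makes the difference
   quotient at 0 at most C z. *)
have [C C0 HC] := horner_le_expR ('X^2 * P) 0.
apply/is_derive1_caratheodory.
exists (fun z => flat P z / z); split.
- move=> z; rewrite subr0 /flat ltxx subr0.
  by have [->|z0] := eqVneq z 0; rewrite ?ltxx ?mul0r// divfK.
- have H0 : flat P 0 / 0 = 0 by rewrite invr0 mulr0.
  rewrite /prop_for /continuous_at H0; apply/cvgr0Pnorm_le => e e0.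
  near=> z.
  apply: (@le_trans _ _ (C * `|z|)).
    rewrite /flat; case: ifPn => z0; last by rewrite mul0r normr0 mulr_ge0.
    have := HC z^-1; rewrite invr_ge0 (ltW z0) => /(_ isT).
    rewrite hornerM hornerXn divr1 normrM normrX.
    rewrite (ger0_norm (ltW z0)) gtr0_norm ?invr_gt0// => H.
    rewrite !normrM normfV (gtr0_norm z0) (gtr0_norm (expR_gt0 _)) expRN.
    rewrite -mulrA -invfM ler_pdivrMr ?mulr_gt0 ?expR_gt0//.
    apply: (@le_trans _ _ (z ^+ 2 * (C * expR z^-1))); last first.
      by rewrite expr2 le_eqVlt; apply/orP; left; apply/eqP; ring.
    rewrite -ler_pdivrMl ?exprn_gt0//; apply: le_trans H.
    by rewrite exprVn.
  have C1 : C * `|z| <= (C + 1) * `|z| by rewrite ler_wpM2r// lerDl.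
  apply: (le_trans C1); rewrite -ler_pdivlMl ?ltr_wpDl//.
  near: z; apply: (@nbhs0_le R R).
  by rewrite mulr_gt0// invr_gt0 ltr_wpDl.
- by rewrite invr0 mulr0.
Unshelve. all: by end_near. Qed.

End flat.

Section smooth1.
Context {R : realType}.

(* A class closed under derivation. In smooth1_pow the test 0 < t is needed
   because t `^ r = 1 when t < 0. *)
Inductive smooth1 : (R -> R) -> Prop :=
| smooth1_flat P : smooth1 (flat P)
| smooth1_cst c : smooth1 (fun=> c)
| smooth1_add f g : smooth1 f -> smooth1 g -> smooth1 (fun t => f t + g t)
| smooth1_mul f g : smooth1 f -> smooth1 g -> smooth1 (fun t => f t * g t)
| smooth1_affine f a b : smooth1 f -> smooth1 (fun t => f (a * t + b))
| smooth1_inv f : smooth1 f -> (forall t, f t != 0) -> smooth1 (fun t => (f t)^-1)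
| smooth1_pow f d r a : smooth1 f -> 0 < d -> (forall t, t < d -> f t = 0) ->
    0 < r -> smooth1 (fun t => if 0 < t then f (t `^ r) * t `^ a else 0).

Lemma is_derive_near_cst (f : R -> R) (t d c : R) :
  is_derive t (1 : R) f d -> (\near t, f t = c) -> d = 0.
Proof.
move=> fd fc; have H := @near_eq_is_derive _ _ _ f (cst c) t (1:R) d fc fd.
by case: H => _ <-; exact: derive_cst.
Qed.

Lemma smooth1_derive f : smooth1 f ->
  exists2 f', smooth1 f' & forall t : R, is_derive t (1 : R) f (f' t).
Proof.
elim => {f} [P|c|f g _ [f' sf df] _ [g' sg dg]|f g sf [f' sf' df] sg [g' sg' dg]
  |f a b _ [f' sf df]|f sf [f' sf' df] fn0|f d r a sf [f' sf' df] d0 fd r0].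
- exists (flat ('X^2 * (P - P^`()))); first exact: smooth1_flat.
  by move=> t; exact: is_derive_flat.
- by exists (fun=> 0); [exact: smooth1_cst|move=> t; exact: is_derive_cst].
- exists (fun t => f' t + g' t); first exact: smooth1_add.
  by move=> t; exact: is_deriveD.
- exists (fun t => f t * g' t + g t * f' t).
    by apply: smooth1_add; apply: smooth1_mul.
  by move=> t; exact: is_deriveM.
- exists (fun t => f' (a * t + b) * a).
    by apply: (@smooth1_mul _ (fun=> a)); [exact: smooth1_affine|exact: smooth1_cst].
  move=> t; apply: (@is_derive1_comp _ f (fun t => a * t + b)).
  have -> : (fun t => a * t + b) = (a \*: id) + cst b by [].
  by apply: is_derive_eq; rewrite addr0 /GRing.scale/= mulr1.
- exists (fun t => - 1 * ((f t)^-1 * (f t)^-1) * f' t).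
    apply: smooth1_mul => //; apply: (@smooth1_mul (fun=> - 1)).
      exact: smooth1_cst.
    by apply: smooth1_mul; exact: smooth1_inv.
  move=> t; apply: (is_derive_eq (is_deriveV (fn0 t) (df t))).
  by rewrite /GRing.scale/= mulN1r -expr2 exprVn.
have f'd t : t < d -> f' t = 0.
  move=> td; apply: (is_derive_near_cst (df t) (c := 0)).
  by near=> z; apply: fd; near: z; exact: lt_nbhsl.
exists (fun t => r * (if 0 < t then f' (t `^ r) * t `^ (r - 1 + a) else 0) +
                 a * (if 0 < t then f (t `^ r) * t `^ (a - 1) else 0)).
  apply: smooth1_add; (apply: smooth1_mul; first exact: smooth1_cst).
    exact: smooth1_pow f'd r0.
  exact: smooth1_pow fd r0.
(* Below [e] the function is identically 0, and from [e] on [t] is positive: the singularity of the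
   real power at 0 is never met. *)
move=> t; set e := d `^ r^-1.
have e0 : 0 < e by exact: powR_gt0.
have er x : 0 < x -> x < e -> x `^ r < d.
  move=> x0 xe; have -> : d = e `^ r by rewrite /e -powRrM mulVf ?powRr1 ?gt_eqF ?ltW.
  by apply: gt0_ltr_powR => //; rewrite nnegrE ltW.
have [te|te] := ltP t e.
  have -> : (if 0 < t then f' (t `^ r) * t `^ (r - 1 + a) else 0) = 0.
    by case: ifPn => // t0; rewrite f'd ?mul0r// er.
  have -> : (if 0 < t then f (t `^ r) * t `^ (a - 1) else 0) = 0.
    by case: ifPn => // t0; rewrite fd ?mul0r// er.
  rewrite !mulr0 addr0.
  apply: (@near_eq_is_derive _ _ _ (cst 0)).
  near=> z; case: ifPn => // z0; rewrite fd ?mul0r// er//.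
  by near: z; exact: lt_nbhsl.
have t0 : 0 < t by exact: lt_le_trans te.
rewrite t0.
have -> : r * (f' (t `^ r) * t `^ (r - 1 + a)) + a * (f (t `^ r) * t `^ (a - 1)) =
  f (t `^ r) *: (a * t `^ (a - 1)) + t `^ a *: (f' (t `^ r) * (r * t `^ (r - 1))).
  by rewrite (@powRD _ t (r - 1) a) ?(gt_eqF t0) ?implybT// /GRing.scale/=; ring.
have H1 : is_derive t (1 : R) (fun t => f (t `^ r)) (f' (t `^ r) * (r * t `^ (r - 1))).
  exact: (@is_derive1_comp _ f (fun t => t `^ r) _ _ _ _ (is_derive1_powR _ t0)).
have H := is_deriveM H1 (is_derive1_powR a t0).
apply: near_eq_is_derive H.
by near=> z; rewrite ifT//; near: z; exact: lt_nbhsr.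
Unshelve. all: by end_near. Qed.

Lemma smooth1_continuous f : smooth1 f -> continuous f.
Proof.
move=> /smooth1_derive[f' _ df] t; apply: differentiable_continuous.
exact/derivable1_diffP/ex_derive.
Qed.

(** The quotient e(t) / (e(t) + e(1 - t)), where e(t) is exp(-1/t) for t > 0 and 0 otherwise; at
    every t one of the two summands is positive. The derivative is exported too, because its support
    in [0, 1] is what localizes the averages in [mollify]. *)
Lemma smooth_step : exists s s' : R -> R,
  [/\ smooth1 s, smooth1 s', forall t : R, is_derive t (1 : R) s (s' t) &
   [/\ forall t, 0 <= s t <= 1, forall t, t <= 0 -> s t = 0, forall t, 1 <= t -> s t = 1
   & forall t, ~~ (0 <= t <= 1) -> s' t = 0]].
Proof.
pose e : R -> R := flat 1.
have e0 t : 0 <= e t by rewrite /e /flat; case: ifPn => // _; rewrite hornerC mul1r expR_ge0.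
have ep t : 0 < t -> 0 < e t by rewrite /e /flat => ->; rewrite hornerC mul1r expR_gt0.
have en t : t <= 0 -> e t = 0 by rewrite /e /flat ltNge => ->.
have D t : 0 < e t + e (-1 * t + 1).
  have [t0|t0] := ltP 0 t; first by rewrite ltr_wpDr// ep.
  by rewrite ltr_wpDl// ep//; lra.
pose s t := e t * (e t + e (-1 * t + 1))^-1.
have ss : smooth1 s.
  apply: smooth1_mul; first exact: smooth1_flat.
  apply: smooth1_inv; last by move=> t; rewrite gt_eqF.
  apply: smooth1_add; first exact: smooth1_flat.
  exact: (@smooth1_affine e (-1) 1 (smooth1_flat 1)).
have [s' ss' ds] := smooth1_derive ss.
have s0 t : t <= 0 -> s t = 0 by move=> t0; rewrite /s (en t)// mul0r.
have s1 t : 1 <= t -> s t = 1.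
  move=> t1; rewrite /s (en (-1 * t + 1)); last by lra.
  by rewrite addr0 mulfV// gt_eqF// ep//; lra.
exists s, s'; split => //; split => //.
- move=> t; rewrite /s divr_ge0 /= ?e0 ?(ltW (D t))//.
  by rewrite ler_pdivrMr// mul1r lerDl e0.
- move=> t; rewrite negb_and -!ltNge => /orP[t0|t1].
    apply: (is_derive_near_cst (ds t) (c := 0)).
    by near=> z; apply: s0; apply: ltW; near: z; exact: lt_nbhsl.
  apply: (is_derive_near_cst (ds t) (c := 1)).
  by near=> z; apply: s1; apply: ltW; near: z; exact: lt_nbhsr.
Unshelve. all: by end_near. Qed.

End smooth1.

(** * Smooth functions on R^N *)

Section smoothV.
Context {R : realType} (N : nat).
Local Notation q := (fun x : 'rV[R]_N => enorm x ^+ 2).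

(** A class closed under partial derivatives. Radial functions enter through |x|^2, a polynomial, so
    that deriving g(|x|^2) only brings out the factor 2 x_i. *)
Inductive smoothV : ('rV[R]_N -> R) -> Prop :=
| smoothV_coord i : smoothV (fun x => x ord0 i)
| smoothV_cst c : smoothV (fun=> c)
| smoothV_add f g : smoothV f -> smoothV g -> smoothV (fun x => f x + g x)
| smoothV_mul f g : smoothV f -> smoothV g -> smoothV (fun x => f x * g x)
| smoothV_rad g : smooth1 g -> smoothV (fun x => g (enorm x ^+ 2)).

Lemma continuous_enorm_sqr : continuous q.
Proof.
rewrite (_ : q = fun x => \sum_(i < N) x ord0 i ^+ 2); last first.
  by apply/funext => y; rewrite enorm_sqr.
apply: continuous_big => [[a b]|i _ x]; first exact: add_continuous.
apply: (@continuous_comp _ _ _ (fun y : 'rV[R]_N => y ord0 i) (fun t => t ^+ 2)).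
  exact: coord_continuous.
exact: exprn_continuous.
Qed.

Lemma enorm_sqr_shift (x : 'rV[R]_N) (h : R) i :
  enorm (h *: basis_rV i + x) ^+ 2 = h ^+ 2 + h * (2 * x ord0 i) + enorm x ^+ 2.
Proof.
rewrite !enorm_sqr (bigD1 i)//= [in RHS](bigD1 i)//= !mxE !eqxx mulr1.
rewrite addrA; congr (_ + _); first by ring.
apply: eq_bigr => j ji; rewrite !mxE eqxx (negbTE ji) mulr0 add0r//.
Qed.

Lemma is_derive_line (f : 'rV[R]_N -> R) x v d :
  is_derive (0 : R) (1 : R) (fun h => f (h *: v + x)) d -> is_derive x v f d.
Proof.
have E : (fun h : R => h^-1 *: (((fun h => f (h *: v + x)) \o shift 0) (h *: (1 : R)) -
   f (0 *: v + x))) = (fun h : R => h^-1 *: ((f \o shift x) (h *: v) - f x)).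
  by apply/funext => h /=; rewrite scale0r add0r addr0 /GRing.scale/= mulr1.
move=> [d1 d2]; split.
  by move: d1; rewrite /derivable E.
by move: d2; rewrite /derive E.
Qed.

Lemma is_derive_quadratic (b c : R) :
  is_derive (0 : R) (1 : R) (fun h : R => h ^+ 2 + h * b + c) b.
Proof.
have Hi : is_derive (0 : R) (1 : R) (fun h : R => h) 1 by exact: is_derive_id.
have H1 := is_deriveM Hi Hi; have H2 := is_deriveZ b Hi.
have H3 := is_deriveD (is_deriveD H1 H2) (is_derive_cst c (0 : R) (1 : R)).
rewrite (_ : (fun h : R => _) = (id * id + b \*: id + cst c : R -> R)); last first.
  by apply/funext => h; rewrite expr2 (mulrC h b).
by apply: (is_derive_eq H3); rewrite /GRing.scale/= !mul0r !add0r mulr1 addr0.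
Qed.

Lemma smoothV_derive f : smoothV f -> continuous f /\
  forall i, exists2 f', smoothV f' & forall x, is_derive x (basis_rV i) f (f' x).
Proof.
elim => {f} [i|c|f g _ [cf df] _ [cg dg]|f g sf [cf df] sg [cg dg]|g sg].
- split; first exact: coord_continuous.
  move=> j; exists (fun=> (i == j)%:R); first exact: smoothV_cst.
  move=> x; apply: is_derive_line.
  rewrite (_ : (fun h : R => (h *: basis_rV j + x) ord0 i) =
    ((i == j)%:R \*: id) + cst (x ord0 i)); last first.
    by apply/funext => h; rewrite !mxE eqxx mulrC.
  by apply: is_derive_eq; rewrite addr0 /GRing.scale/= mulr1.
- split; first by exact: cst_continuous.
  by move=> j; exists (fun=> 0); [exact: smoothV_cst|move=> x; exact: is_derive_cst].
- split; first by move=> x; apply: continuousD; [exact: cf|exact: cg].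
  move=> i; have [f' sf' df'] := df i; have [g' sg' dg'] := dg i.
  exists (fun x => f' x + g' x); first exact: smoothV_add.
  by move=> x; exact: is_deriveD.
- split; first by move=> x; apply: continuousM; [exact: cf|exact: cg].
  move=> i; have [f' sf' df'] := df i; have [g' sg' dg'] := dg i.
  exists (fun x => f x * g' x + g x * f' x).
    by apply: smoothV_add; apply: smoothV_mul.
  by move=> x; exact: is_deriveM.
- split.
    move=> x; apply: (@continuous_comp _ _ _ q g).
      exact: continuous_enorm_sqr.
    exact: smooth1_continuous.
  move=> i; have [g' sg' dg] := smooth1_derive sg.
  exists (fun x => g' (enorm x ^+ 2) * (2 * x ord0 i)).
    apply: smoothV_mul; first exact: smoothV_rad.
    by apply: smoothV_mul; [exact: smoothV_cst|exact: smoothV_coord].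
  move=> x; apply: is_derive_line.
  pose k (h : R) := h ^+ 2 + h * (2 * x ord0 i) + enorm x ^+ 2.
  rewrite (_ : (fun h : R => g _) = g \o k); last first.
    by apply/funext => h /=; rewrite enorm_sqr_shift.
  have k0 : k 0 = enorm x ^+ 2 by rewrite /k expr0n/= mul0r !add0r.
  apply: is_derive1_comp; first by rewrite k0.
  exact: is_derive_quadratic.
Qed.

Lemma smoothV_smooth f : smoothV f -> smooth f.
Proof.
move=> sf s; have {sf} : smoothV (partials s f).
  elim: s => [//|i s IH] /=.
  have [_ /(_ i)[f' sf' df']] := smoothV_derive IH.
  by rewrite (_ : 'D__ _ = f')//; apply/funext => x; case: (df' x).
move=> /smoothV_derive[cf df]; split => // i x.
by have [f' _ /(_ x)[]] := df i.
Qed.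

Lemma compact_ball_sqr b : compact [set x : 'rV[R]_N | enorm x ^+ 2 <= b].
Proof.
apply: bounded_closed_compact.
  exists (Num.sqrt b); split; first exact: num_real.
  move=> M bM x /= xb; rewrite [leLHS]/Num.Def.normr/= mx_normrE; apply/bigmax_leP; split.
    by rewrite (le_trans (sqrtr_ge0 b))// ltW.
  move=> [i j] _ /=; rewrite ord1 (le_trans _ (ltW bM))// -sqrtr_sqr.
  apply: ler_wsqrtr; apply: le_trans xb; rewrite enorm_sqr.
  by rewrite (bigD1 j)//= lerDl sumr_ge0// => k _; rewrite sqr_ge0.
rewrite (_ : [set x | _] = q @^-1` [set t | t <= b])//.
apply: preimage_closed; last exact: closed_le.
by move=> x _; exact: continuous_enorm_sqr.
Qed.

End smoothV.

(** * Radial test fields *)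

Section radial_test.
Context {R : realType} (N : nat).
Hypothesis N0 : (0 < N)%N.
Variables (eta eta' : R -> R) (d b : R).
Hypotheses (se : smooth1 eta) (de : forall t : R, is_derive t (1 : R) eta (eta' t)).
Hypotheses (d0 : 0 < d) (b1 : b < 1).
Hypotheses (ed : forall t, t < d -> eta t = 0) (eb : forall t, b < t -> eta t = 0).
Hypothesis b0 : 0 < b.

(** With q = |x|^2 one has s = q^r; a support bounded by [b] in the variable s is bounded by [b2] in
    the variable q. *)
Let r : R := N%:R / 2.
Let r0 : 0 < r. Proof. by rewrite divr_gt0// ltr0n. Qed.
Let b2 := b `^ r^-1.

Lemma radE (x : 'rV[R]_N) : rad x = (enorm x ^+ 2) `^ (N%:R / 2).
Proof.
rewrite -powR_mulrn ?enorm_ge0// -powRrM mulrCA mulfV ?mulr1 ?pnatr_eq0//.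
by rewrite powR_mulrn// enorm_ge0.
Qed.

(** The witness g(q) = eta(q^r) q^(-r) turns x g(|x|^2) into the field x eta(s) / s. In the
    divergence N g + 2 q g' the terms that contain eta itself cancel because r = N/2, which leaves N
    eta'(s). *)
Lemma radial_test : exists g g' : R -> R,
  [/\ smooth1 g, smooth1 g', forall t, b2 < t -> g t = 0 /\ g' t = 0,
   forall x : 'rV[R]_N, g (enorm x ^+ 2) = eta (rad x) / rad x &
   [/\ forall x : 'rV[R]_N, g (enorm x ^+ 2) *+ N + 2 * enorm x ^+ 2 * g' (enorm x ^+ 2) =
      N%:R * eta' (rad x),
    forall i : 'I_N, test_function (fun x : 'rV[R]_N => x ord0 i * g (enorm x ^+ 2)) &
    forall (i : 'I_N) (x : 'rV[R]_N),
      'D_(basis_rV i) (fun x : 'rV[R]_N => x ord0 i * g (enorm x ^+ 2)) x =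
      g (enorm x ^+ 2) + 2 * x ord0 i ^+ 2 * g' (enorm x ^+ 2)]].
Proof.
pose g t := if 0 < t then eta (t `^ r) * t `^ (- r) else 0.
have sg : smooth1 g by exact: smooth1_pow ed r0.
have [g' sg' dg] := smooth1_derive sg.
have b20 : 0 < b2 by exact: powR_gt0.
have b2b : b2 `^ r = b by rewrite /b2 -powRrM mulVf ?powRr1 ?(ltW b0) ?(gt_eqF r0).
have b21 : b2 < 1 by apply: powR_lt1 => //; rewrite invr_gt0.
have gb t : b2 < t -> g t = 0.
  move=> bt; rewrite /g ifT; last exact: lt_trans bt.
  rewrite eb ?mul0r// -b2b; apply: gt0_ltr_powR => //; rewrite nnegrE ltW//.
  exact: lt_trans bt.
exists g, g'; split => //.
- move=> t bt; split; first exact: gb.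
  apply: (is_derive_near_cst (dg t) (c := 0)).
  by near=> z; apply: gb; near: z; exact: lt_nbhsr.
- move=> x; rewrite /g -/r radE -/r; case: ifPn => [q0|]; first by rewrite powRN.
  rewrite -leNgt => q0; have -> : enorm x ^+ 2 = 0.
    by apply/eqP; rewrite eq_le q0 sqr_ge0.
  by rewrite powR0 ?gt_eqF// ed// mul0r.
split.
- move=> x; have := sqr_ge0 (enorm x); rewrite radE -/r le_eqVlt => /orP[/eqP <-|].
    rewrite /g ltxx mul0rn mulr0 mul0r add0r powR0 ?gt_eqF//.
    rewrite (_ : eta' 0 = 0) ?mulr0//.
    apply: (is_derive_near_cst (de 0) (c := 0)).
    by near=> z; apply: ed; near: z; exact: lt_nbhsl.
  set t := enorm x ^+ 2 => t0.
  have H1 : is_derive t (1 : R) (fun t => eta (t `^ r)) (eta' (t `^ r) * (r * t `^ (r - 1))).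
    exact: (@is_derive1_comp _ eta (fun t => t `^ r) _ _ _ _ (is_derive1_powR _ t0)).
  have H := is_deriveM H1 (is_derive1_powR (- r) t0).
  have {}H : is_derive t (1 : R) g (eta (t `^ r) *: (- r * t `^ (- r - 1)) +
      t `^ (- r) *: (eta' (t `^ r) * (r * t `^ (r - 1)))).
    apply: near_eq_is_derive H.
    by near=> z; rewrite /g ifT//; near: z; exact: lt_nbhsr.
  have -> : g' t = eta (t `^ r) *: (- r * t `^ (- r - 1)) +
      t `^ (- r) *: (eta' (t `^ r) * (r * t `^ (r - 1))).
    by case: H => _ <-; case: (dg t).
  rewrite /g t0 /GRing.scale/= -[_ *+ N]mulr_natl.
  have E1 : t `^ (- r - 1) = t `^ (- r) / t.
    by rewrite powRB ?(gt_eqF t0) ?implybT// powRr1// ltW.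
  have E2 : t `^ (r - 1) = t `^ r / t.
    by rewrite powRB ?(gt_eqF t0) ?implybT// powRr1// ltW.
  have E3 : t `^ (- r) = (t `^ r)^-1 by rewrite powRN.
  rewrite E1 E2 E3 (_ : N%:R = 2 * r); last by rewrite /r; field.
  have t1 : t `^ r != 0 by rewrite gt_eqF// powR_gt0.
  by field; rewrite t1 gt_eqF.
- move=> i; split.
    apply: smoothV_smooth; apply: smoothV_mul; first exact: smoothV_coord.
    exact: smoothV_rad.
  exists [set x | enorm x ^+ 2 <= b2]; split.
  + exact: compact_ball_sqr.
  + exact: ball_sqr_sub.
  + by move=> x /negP; rewrite -ltNge => /gb ->; rewrite mulr0.
- move=> i x.
  have H : is_derive x (basis_rV i) (fun x : 'rV[R]_N => x ord0 i * g (enorm x ^+ 2))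
    (g (enorm x ^+ 2) + 2 * x ord0 i ^+ 2 * g' (enorm x ^+ 2)).
    apply: is_derive_line.
    pose k (h : R) := h ^+ 2 + h * (2 * x ord0 i) + enorm x ^+ 2.
    have k0 : k 0 = enorm x ^+ 2 by rewrite /k expr0n/= mul0r !add0r.
    have dk : is_derive (0 : R) (1 : R) k (2 * x ord0 i) by exact: is_derive_quadratic.
    have H1 : is_derive (0 : R) (1 : R) (g \o k) (g' (enorm x ^+ 2) * (2 * x ord0 i)).
      by apply: is_derive1_comp; rewrite k0.
    have H2 : is_derive (0 : R) (1 : R) (id + cst (x ord0 i)) (1 + 0) by exact: is_deriveD.
    rewrite (_ : (fun h : R => _) = (id + cst (x ord0 i)) * (g \o k)); last first.
      by apply/funext => h; rewrite /= enorm_sqr_shift !mxE !eqxx mulr1.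
    apply: (is_derive_eq (is_deriveM H2 H1)).
    by rewrite /= k0 /GRing.scale/= addr0 mulr1 (_ : (_ + _) 0 = x ord0 i)
      ?(_ : k 0 = enorm x ^+ 2)//; [ring|rewrite /cst/= fctE add0r].
  by case: H.
Unshelve. all: by end_near. Qed.

End radial_test.

(** * The weak derivative of the profile *)

Section weak_radial.
Context {R : realType} (N : nat).
Hypothesis N2 : (2 <= N)%N.
Local Notation leb := (@lebesgue_rV R N).
Local Notation ball := (@unit_ball R N).
Local Notation rad := (@rad R N).

Let N0 : (0 < N)%N. Proof. exact: leq_trans N2. Qed.

Lemma continuous_bounded01 (g : R -> R) : continuous g ->
  exists C, forall t, 0 <= t <= 1 -> `|g t| <= C.
Proof.
move=> cg; have cn : {within `[0, 1], continuous (fun t => `|g t|)}.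
  apply: continuous_subspaceT => t.
  apply: (@continuous_comp _ _ _ g (@Num.norm R R)); first exact: cg.
  exact: norm_continuous.
by have [c _ H] := EVT_max ler01 cn; exists `|g c| => t t01; exact: H.
Qed.

(** Integrability over the whole ball reduces to the compact ball |x|^2 <= b, outside which [psi]
    vanishes. *)
Lemma integrable_loc_mul (v psi : 'rV[R]_N -> R) (b C : R) : b < 1 ->
  loc_integrable v -> measurable_fun setT v -> measurable_fun setT psi ->
  (forall x, ball x -> `|psi x| <= C) -> (forall x, b < enorm x ^+ 2 -> psi x = 0) ->
  leb.-integrable ball (fun x => (v x * psi x)%:E).
Proof.
move=> b1 lv mv mpsi pC p0.
pose K := [set x : 'rV[R]_N | enorm x ^+ 2 <= b].
have mb := @measurable_unit_ball R N.
have mK : measurable K by exact: measurable_ball_sqr.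
have Kb : K `<=` ball by exact: ball_sqr_sub.
have iK : leb.-integrable K (fun x => (v x * psi x)%:E).
  apply: (@integrableMl _ _ _ leb K mK (EFin \o v) psi).
  - by apply: lv => //; exact: compact_ball_sqr.
  - exact: measurable_funTS.
  - exists C; split; first exact: num_real.
    by move=> M CM x /= Kx; rewrite (le_trans (pC _ (Kb _ Kx)))// ltW.
rewrite (_ : (fun x => _) = (fun x => (v x * psi x)%:E) \_ K); last first.
  apply/funext => x; rewrite patchE; case: ifPn => // /negP.
  rewrite inE /K/= => /negP; rewrite -ltNge => /p0 ->; by rewrite mulr0.
apply/integrable_restrict => //.
by rewrite (setIidr Kb).
Qed.

Variables (u : 'rV[R]_N -> R) (G : 'rV[R]_N -> 'rV[R]_N) (h : R -> R).
Hypothesis mu : measurable_fun setT u.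
Hypothesis uG : weak_gradient u G.
Hypothesis mh : measurable_fun setT h.
Hypothesis uh : {ae leb, forall x, ball x -> u x = h (rad x)}.
Variable Q : R.
Hypothesis HQ : (\int[@hvol R N]_x
  ((conf x)^-1 ^+ 2 * enorm (G x) ^+ 2 + u x ^+ 2)%:E <= Q%:E)%E.

Let mG : measurable_fun setT G. Proof. by case: uG. Qed.

Let mGi i : measurable_fun setT (fun x => G x ord0 i).
Proof. exact: measurableT_comp (measurable_coord i) mG. Qed.

Variables (eta eta' : R -> R) (d b : R).
Hypotheses (se : smooth1 eta) (de : forall t : R, is_derive t (1 : R) eta (eta' t)).
Hypotheses (d0 : 0 < d) (b0 : 0 < b) (b1 : b < 1).
Hypotheses (ed : forall t, t < d -> eta t = 0) (eb : forall t, b < t -> eta t = 0).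
Hypothesis e1 : forall t, `|eta t| <= 1.

Let b21 : b `^ (N%:R / 2)^-1 < 1.
Proof. by apply: powR_lt1 => //; rewrite invr_gt0 divr_gt0// ltr0n. Qed.

Let enorm_sqr01 x : ball x -> 0 <= enorm x ^+ 2 <= 1.
Proof. by rewrite unit_ballE/= => /ltW ->; rewrite sqr_ge0. Qed.

Let coord_sqr01 x i : ball x -> x ord0 i ^+ 2 <= 1.
Proof.
rewrite unit_ballE/= => /ltW; apply: le_trans; rewrite enorm_sqr.
by rewrite (bigD1 i)//= lerDl sumr_ge0// => k _; rewrite sqr_ge0.
Qed.

(** A weak gradient is tested one coordinate at a time, so the field enters through its components
    x_i g(|x|^2), and the identities are summed over i. Each summand is integrable on its own, which
    permits the exchange of sum and integral. *)
Lemma weak_radial :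
  leb.-integrable ball (fun x => (u x * (N%:R * eta' (rad x)))%:E) /\
  exists F : 'rV[R]_N -> R,
  [/\ measurable_fun setT F,
     (\int[leb]_(x in ball) (u x * (N%:R * eta' (rad x)))%:E =
     - \int[leb]_(x in ball) (F x)%:E)%E &
     forall x, F x = (\sum_(i < N) G x ord0 i * x ord0 i) * (eta (rad x) / rad x)].
Proof.
have [g [g' [sg sg' g0 gE [Hdiv tst Dphi]]]] := radial_test N0 se de d0 b1 ed eb b0.
have cg := smooth1_continuous sg; have cg' := smooth1_continuous sg'.
have [C HC] := continuous_bounded01 cg; have [C' HC'] := continuous_bounded01 cg'.
have mb := @measurable_unit_ball R N.
have [_ lu lG wk] := uG.
have mq : measurable_fun setT (fun x : 'rV[R]_N => enorm x ^+ 2) by exact: measurable_enorm_sqr.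
have mg : measurable_fun setT (fun x : 'rV[R]_N => g (enorm x ^+ 2)).
  exact: measurableT_comp (continuous_measurable_fun cg) mq.
have mg' : measurable_fun setT (fun x : 'rV[R]_N => g' (enorm x ^+ 2)).
  exact: measurableT_comp (continuous_measurable_fun cg') mq.
pose psi i (x : 'rV[R]_N) := g (enorm x ^+ 2) + 2 * x ord0 i ^+ 2 * g' (enorm x ^+ 2).
pose phi i (x : 'rV[R]_N) := x ord0 i * g (enorm x ^+ 2).
have iu i : leb.-integrable ball (fun x => (u x * psi i x)%:E).
  apply: (integrable_loc_mul (C := C + 2 * C') b21 lu mu).
  - apply: measurable_funD => //; apply: measurable_funM => //.
    by apply: measurable_funM => //; apply: measurable_funX; exact: measurable_coord.
  - move=> x bx; rewrite (le_trans (ler_normD _ _))// lerD ?HC ?enorm_sqr01//.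
    rewrite (normrM (2 * x ord0 i ^+ 2)) (normrM 2) (ger0_norm (sqr_ge0 (x ord0 i))) normr_nat -mulrA ler_pM2l//.
    rewrite -[leRHS]mul1r ler_pM ?sqr_ge0 ?coord_sqr01//.
    by rewrite HC' ?enorm_sqr01.
  - by move=> x /g0[gx gx']; rewrite /psi gx gx' mulr0 addr0.
have iG i : leb.-integrable ball (fun x => (G x ord0 i * phi i x)%:E).
  apply: (integrable_loc_mul (C := C) b21 (lG i) (mGi i)).
  - by apply: measurable_funM => //; exact: measurable_coord.
  - move=> x bx; rewrite normrM -[leRHS]mul1r ler_pM ?HC ?enorm_sqr01//.
    by rewrite -(@ler_pXn2r _ 2)// ?nnegrE// -normrX expr1n ger0_norm ?sqr_ge0 ?coord_sqr01.
  - by move=> x /g0[gx _]; rewrite /phi gx mulr0.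
have E1 x : \sum_(i < N) (u x * psi i x) = u x * (N%:R * eta' (rad x)).
  rewrite -mulr_sumr -Hdiv; congr (_ * _).
  rewrite big_split/= sumr_const card_ord; congr (_ + _).
  by rewrite -mulr_suml -mulr_sumr enorm_sqr.
pose F x := \sum_(i < N) (G x ord0 i * phi i x).
have iu' : leb.-integrable ball (fun x => (u x * (N%:R * eta' (rad x)))%:E).
  under eq_fun do rewrite -E1 -sumEFin.
  exact: integrable_sum.
split => //; exists F; split.
- apply: measurable_sum => i; apply: measurable_funM; first exact: mGi.
  by apply: measurable_funM => //; exact: measurable_coord.
- under eq_integral do rewrite -E1 -sumEFin.
  under [in RHS]eq_integral do rewrite -sumEFin.
  rewrite integral_sum// integral_sum// -sumeN//; last first.
    by move=> i j _ _; apply: fin_num_adde_defr; exact: integrable_fin_num.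
  apply: eq_bigr => i _; rewrite -wk; last exact: tst.
  by apply: eq_integral => x _; rewrite Dphi.
- move=> x; rewrite /F /phi -gE mulr_suml.
  by apply: eq_bigr => i _; rewrite mulrA.
Qed.

Variable al : R.
Hypothesis al1 : 1 - 2 / N%:R <= al.

(** What the Cauchy-Schwarz inequality leaves against the energy density conf^(N-2) |G|^2: the first
    factor bounds |x|^2 / s^2 = s^(2/N - 2), where [al1] is used, and the second bounds
    conf^(2-N). *)
Definition weight (t : R) := t `^ (- 1 - al) * (1 - t) ^+ (N - 2).

Let conf_inv_le x : ball x -> (conf x)^-1 <= 1 - rad x.
Proof.
move=> bx; rewrite /conf invf_div ler_pdivrMr//.
have H := rad_le_sqr N2 bx.
have x1 : enorm x ^+ 2 < 1 by move: bx; rewrite unit_ballE.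
lra.
Qed.

Let rad_weight x : ball x -> 0 < rad x ->
  enorm x ^+ 2 / rad x ^+ 2 <= rad x `^ (- 1 - al).
Proof.
move=> bx r0; have e0 : 0 < enorm x.
  rewrite lt_neqAle enorm_ge0 andbT; apply: contraTneq r0 => e0.
  by rewrite /rad -e0 expr0n gtn_eqF// ltxx.
have r1 : rad x <= 1.
  by move: bx; rewrite ball_rad//= in_itv/= => /andP[_ /ltW].
have -> : enorm x ^+ 2 = rad x `^ (2 / N%:R).
  rewrite /rad -[enorm x ^+ N]powR_mulrn ?(ltW e0)// -powRrM mulrCA mulfV ?mulr1 ?pnatr_eq0 ?gtn_eqF//.
  by rewrite powR_mulrn// ltW.
rewrite -(powR_mulrn _ (ltW r0)) -powRB ?(gt_eqF r0) ?implybT//.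
apply: ger_powR; first by rewrite r0.
by have := al1; set z := 2 / N%:R => al1z; lra.
Qed.

(* The Cauchy-Schwarz inequality in the form 2 A B <= l A^2 + l^-1 B^2: only
   integrals of squares occur, and l is optimized in profile_difference_sqr_le. *)
Lemma radial_bound (l : R) : 0 < l ->
  ((2 * N%:R)%:E * `| (sigma N)%:E * \int[lebesgue_measure]_(t in `[0%R, 1%R[) (h t * eta' t)%:E |
   <= l%:E * Q%:E + (l^-1 * sigma N)%:E *
       \int[lebesgue_measure]_(t in `[d, b]) (weight t)%:E)%E.
Proof.
move=> l0; have [iu [F [mF IF FE]]] := weak_radial.
have mb := @measurable_unit_ball R N.
have me' : measurable_fun setT eta'.
  have [e2 se2 de2] := smooth1_derive se.
  rewrite (_ : eta' = e2); first by apply: continuous_measurable_fun; exact: smooth1_continuous.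
  by apply/funext => t; case: (de t) => _ <-; case: (de2 t).
pose f t := h t * (N%:R * eta' t).
have mf : measurable_fun setT f.
  by apply: measurable_funM => //; exact: measurable_funM.
have mfr : measurable_fun ball (fun x => (f (rad x))%:E).
  apply/measurable_EFinP/measurable_funTS.
  exact: (measurableT_comp mf (@measurable_rad R N)).
have mu' : measurable_fun ball (fun x => (u x * (N%:R * eta' (rad x)))%:E).
  exact: measurable_int iu.
have aeuf : ae_eq leb ball (fun x => (u x * (N%:R * eta' (rad x)))%:E)
    (fun x => (f (rad x))%:E).
  by apply: filterS uh => x H bx; rewrite H.
have if_ : leb.-integrable ball (fun x => (f (rad x))%:E).
  apply/integrableP; split => //; have /integrableP[_] := iu.
  apply: le_lt_trans; rewrite le_eqVlt; apply/orP; left; apply/eqP.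
  apply: ae_eq_integral => //; [exact: measurableT_comp..|].
  by apply: filterS aeuf => x H bx; rewrite H.
have I1 : (\int[leb]_(x in ball) (u x * (N%:R * eta' (rad x)))%:E =
  (sigma N)%:E * \int[lebesgue_measure]_(t in `[0%R, 1%R[) (f t)%:E)%E.
  apply: etrans (_ : (\int[leb]_(x in ball) (f (rad x))%:E = _)%E); first exact: ae_eq_integral.
  rewrite ball_rad// integral_rad//.
  - by move=> t /=; rewrite !in_itv/= => /andP[->].
  - exact: measurable_funTS.
  - by rewrite -ball_rad.
have I2 : (\int[lebesgue_measure]_(t in `[0%R, 1%R[) (f t)%:E =
   N%:R%:E * \int[lebesgue_measure]_(t in `[0%R, 1%R[) (h t * eta' t)%:E)%E.
  rewrite -integralZl//; first by apply: eq_integral => t _; rewrite -EFinM /f mulrCA.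
  have : (@lebesgue_measure R).-integrable `[0%R, 1%R[ (EFin \o f).
    apply: (integrable_rad N0) => //; last by rewrite -ball_rad.
      by move=> t /=; rewrite !in_itv/= => /andP[->].
    exact: measurable_funTS.
  have mD : measurable (`[0%R, 1%R[%classic : set (measurableTypeR R)) by exact: measurable_itv.
  move=> H; have := integrableZl mD N%:R^-1 H.
  apply: eq_integrable => // t _ /=; rewrite -EFinM /f; congr EFin.
  by field; rewrite pnatr_eq0 gtn_eqF.
pose A x := ((conf x)^-1 ^+ 2 * enorm (G x) ^+ 2 + u x ^+ 2) * conf x ^+ N.
pose B := weight \_ `[d, b].
have mA0 := measurable_energy mu mG.
have A00 := energy_ge0 u G.
have mA : measurable_fun ball A.
  apply: measurable_funM; first exact: measurable_funTS.
  by apply: measurable_funX; exact: measurable_conf.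
have A0 x : ball x -> 0 <= A x.
  by move=> /conf_gt0 c0; rewrite mulr_ge0// exprn_ge0// ltW.
have IA : (\int[leb]_(x in ball) (A x)%:E <= Q%:E)%E.
  have mE : measurable_fun setT
      (fun x => ((conf x)^-1 ^+ 2 * enorm (G x) ^+ 2 + u x ^+ 2)%:E).
    exact/measurable_EFinP.
  have := HQ; rewrite (ge0_integral_hvol mE); last by move=> x; rewrite lee_fin.
  by under eq_integral do rewrite -EFinM.
have mw : measurable_fun setT weight.
  apply: measurable_funM; first exact: measurable_powR.
  by apply: measurable_funX; exact: measurable_funB.
have mB : measurable_fun setT B.
  by apply/(measurable_restrictT _ _).1 => //; exact: measurable_funTS.
have B0 t : 0 <= B t.
  rewrite /B patchE; case: ifPn => //; rewrite inE/= in_itv/= => /andP[_ tb].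
  by rewrite mulr_ge0 ?powR_ge0// exprn_ge0// subr_ge0 (le_trans tb)// ltW.
have mBr : measurable_fun setT (fun x : 'rV[R]_N => B (rad x)).
  exact: (measurableT_comp mB (@measurable_rad R N)).
have IB : (\int[leb]_(x in ball) (B (rad x))%:E =
    (sigma N)%:E * \int[lebesgue_measure]_(t in `[d, b]) (weight t)%:E)%E.
  rewrite ball_rad// (ge0_integral_rad N0 (g := fun t => (B t)%:E))//.
  - congr (_ * _)%E.
    have -> : `[d, b]%classic = `[0, 1[ `&` `[d, b] :> set R.
      apply/seteqP; split => t /=; last by case.
      rewrite !in_itv/= => /andP[dt tb]; split; last by rewrite dt tb.
      by rewrite (le_trans (ltW d0) dt) (le_lt_trans tb).
    rewrite integral_mkcondr; apply: eq_integral => t _.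
    by rewrite /B !patchE; case: ifPn.
  - by move=> t /=; rewrite !in_itv/= => /andP[->].
  - by apply/measurable_EFinP/measurable_funTS.
  - by move=> t _; rewrite lee_fin.
have FAB x : ball x -> 2 * `|F x| <= l * A x + l^-1 * B (rad x).
  move=> bx; have c0 := conf_gt0 bx.
  have [e0|en0] := eqVneq (eta (rad x)) 0.
    rewrite FE e0 mul0r mulr0 normr0 mulr0.
    by rewrite addr_ge0// mulr_ge0 ?A0 ?B0 ?invr_ge0 ?(ltW l0).
  have dr : d <= rad x by rewrite leNgt; apply: contra_neqN en0 => /ed.
  have rb : rad x <= b by rewrite leNgt; apply: contra_neqN en0 => /eb.
  have r0 : 0 < rad x by exact: lt_le_trans dr.
  have -> : B (rad x) = weight (rad x).
    by rewrite /B patchE mem_set//= in_itv/= dr rb.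
  (* The density conf^N times conf^(-2) is [c], so [A] dominates c |G|^2; the factor [c^-1] left to
     the other term becomes (1 - s)^(N-2). *)
  pose c := conf x ^+ (N - 2); have cp : 0 < c by rewrite exprn_gt0.
  apply: (@le_trans _ _ (l * (c * enorm (G x) ^+ 2) + l^-1 * (c^-1 * (enorm x ^+ 2 / rad x ^+ 2)))).
    apply: (@le_trans _ _ (\sum_(i < N) 2 * (`|G x ord0 i| * (`|x ord0 i| / rad x)))).
      rewrite FE -mulr_sumr ler_pM2l// normrM.
      apply: (@le_trans _ _ (`|\sum_(i < N) G x ord0 i * x ord0 i| / rad x)).
        rewrite ler_wpM2l// normrM normfV (gtr0_norm r0) ler_piMl ?invr_ge0 ?(ltW r0)//.
      rewrite ler_pdivrMr// mulr_suml (le_trans (ler_norm_sum _ _ _))//.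
      by apply: ler_sum => i _; rewrite normrM -!mulrA mulVf ?mulr1// gt_eqF.
    rewrite (enorm_sqr (G x)) (enorm_sqr x) mulr_suml !mulr_sumr -big_split/=.
    apply: ler_sum => i _.
    rewrite -(real_normK (num_real (G x ord0 i))) -(real_normK (num_real (x ord0 i))).
    set p := `|G x ord0 i|; set s := `|x ord0 i|; set r := rad x.
    (* Completing the square with the parameter [l * c], coordinate by coordinate. *)
    have -> : l * (c * p ^+ 2) + l^-1 * (c^-1 * (s ^+ 2 / r ^+ 2)) =
       2 * (p * (s / r)) + (l * c)^-1 * (l * c * p - s / r) ^+ 2.
      by field; rewrite !gt_eqF.
    by rewrite lerDl mulr_ge0 ?sqr_ge0// invr_ge0 mulr_ge0 ?(ltW l0) ?(ltW cp).
  apply: lerD.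
    rewrite ler_pM2l// /A mulrDl -[leLHS]addr0 lerD//; last first.
      by rewrite mulr_ge0 ?sqr_ge0// exprn_ge0// ltW.
    rewrite (_ : conf x ^+ N = c * conf x ^+ 2); last by rewrite /c -exprD subnK.
    rewrite le_eqVlt; apply/orP; left; apply/eqP; field.
    by rewrite gt_eqF.
  rewrite ler_pM2l ?invr_gt0// mulrC /weight ler_pM//.
  - by rewrite divr_ge0 ?sqr_ge0.
  - by rewrite invr_ge0 ltW.
  - exact: rad_weight.
  - rewrite /c -exprVn lerXn2r ?nnegrE//; first by rewrite invr_ge0 ltW.
      by rewrite subr_ge0 (le_trans rb)// ltW.
    exact: conf_inv_le.
have I3 : (2%:E * \int[leb]_(x in ball) `|(F x)%:E| <= l%:E * Q%:E + (l^-1 * sigma N)%:E *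
       \int[lebesgue_measure]_(t in `[d, b]) (weight t)%:E)%E.
  have Z (k : R) (v : 'rV[R]_N -> \bar R) : 0 <= k -> measurable_fun ball v ->
      (forall x, ball x -> 0 <= v x)%E ->
      (k%:E * \int[leb]_(x in ball) v x = \int[leb]_(x in ball) (k%:E * v x))%E.
    by move=> k0 mv v0; rewrite ge0_integralZl ?lee_fin.
  have mFE : measurable_fun ball (fun x => `|(F x)%:E|)%E.
    apply: measurableT_comp => //; apply/measurable_EFinP; exact: measurable_funTS.
  have mAE : measurable_fun ball (fun x => (A x)%:E) by exact/measurable_EFinP.
  have mBE : measurable_fun ball (fun x => (B (rad x))%:E).
    by apply/measurable_EFinP/measurable_funTS.
  have A0E x : ball x -> (0 <= (A x)%:E)%E by move=> /A0; rewrite lee_fin.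
  have B0E x : ball x -> (0 <= (B (rad x))%:E)%E by rewrite lee_fin.
  have l1 : 0 <= l^-1 by rewrite invr_ge0 ltW.
  rewrite EFinM -muleA -IB (Z 2)//.
  apply: (@le_trans _ _ (l%:E * \int[leb]_(x in ball) (A x)%:E +
     l^-1%:E * \int[leb]_(x in ball) (B (rad x))%:E)%E); last first.
    by rewrite leeD2r// lee_wpmul2l// lee_fin ltW.
  rewrite (Z l) ?(ltW l0)// (Z l^-1)// -ge0_integralD//; last 4 first.
  - by move=> x /A0E; apply: mule_ge0; rewrite lee_fin ltW.
  - by apply: emeasurable_funM.
  - by move=> x /B0E; apply: mule_ge0; rewrite lee_fin.
  - by apply: emeasurable_funM.
  apply: ge0_le_integral => //.
  - by apply: emeasurable_funM.
  - by apply: emeasurable_funD; apply: emeasurable_funM.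
apply: le_trans I3.
rewrite EFinM -muleA lee_wpmul2l ?lee_fin//.
apply: (@le_trans _ _ (`|\int[leb]_(x in ball) (F x)%:E|)%E); last first.
  by apply: le_abse_integral => //; apply/measurable_EFinP/measurable_funTS.
have -> : (`|\int[leb]_(x in ball) (F x)%:E| = `|(sigma N)%:E * (N%:R%:E *
   \int[lebesgue_measure]_(t in `[0%R, 1%R[) (h t * eta' t)%:E)|)%E.
  by rewrite -I2 -I1 IF abseN.
by rewrite muleCA [in leRHS]abseM (@gee0_abs _ N%:R%:E) ?lee_fin.
Qed.

End weak_radial.

(** * Lebesgue points from the right *)

Section right_lebesgue_pt.
Context {R : realType}.
Local Notation mu := (@lebesgue_measure R).

(** One-sided, because the derivative of the smoothed step at [a] is supported in [a, a + ep]; the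
    average over that interval is written with its length multiplied out. *)
Definition right_lebesgue_pt (h : R -> R) (a : R) := forall e, 0 < e ->
  exists2 d, 0 < d & forall ep, 0 < ep -> ep < d ->
  (\int[mu]_(t in `[a, (a + ep)%R]) `|(h t - h a)%:E| <= (e * ep)%:E)%E.

(** Integrability is only available on [0, b] with b < 1. Lebesgue differentiation is therefore
    applied to the truncations of [h] at 1 - 1/(n + 2), and the countably many exceptional sets are
    collected. *)
Lemma ae_right_lebesgue_pt (h : R -> R) : measurable_fun setT h ->
  (forall b, 0 < b < 1 -> mu.-integrable `[0, b] (EFin \o h)) ->
  {ae mu, forall a, 0 < a < 1 -> right_lebesgue_pt h a}.
Proof.
move=> mh ih.
pose b n : R := 1 - n.+2%:R^-1.
have b01 n : 0 < b n < 1.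
  by rewrite /b subr_gt0 invf_lt1 ?ltr0n// ltr1n/= ltrBlDr ltrDl invr_gt0 ltr0n.
have H n : {ae mu, forall a, lebesgue_pt (h \_ `[0, b n]) a}.
  by apply: lebesgue_differentiation; apply: integrable_locally => //; exact: ih.
have {}H := ae_foralln H.
apply: filterS H => a H /andP[a0 a1] e e0.
have [n an] : exists n, a < b n.
  have a1' : 0 < 1 - a by rewrite subr_gt0.
  have [n _ /(_ n (leqnn _))/= Hn] := near_infty_natSinv_lt (PosNum a1').
  exists n; rewrite /b ltrBrDr -ltrBrDl (le_lt_trans _ Hn)//.
  by rewrite lef_pV2 ?posrE// ler_nat.
(* The closed interval [a, a + ep] is placed in the open ball of radius 2 ep, whose length 4 ep
   accounts for the factor 1/4. *)
have e40 : 0 < e / 4 by rewrite divr_gt0.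
have /= := H n; rewrite /lebesgue_pt => /fine_cvgP[+ /cvgrPdist_le].
move=> [d1 /= d10 Hd1] /(_ _ e40)[d2 /= d20 Hd2].
pose d := Num.min (Num.min d1 d2 / 2) (b n - a).
have d0 : 0 < d by rewrite !lt_min ?divr_gt0// ?lt_min ?d10 ?d20// subr_gt0.
exists d => // ep ep0; rewrite !lt_min => /andP[]; rewrite ltr_pdivlMr// lt_min.
move=> /andP[ed1 ed2] eb.
have D1 : ball 0 d1 (ep * 2).
  by rewrite /ball/= sub0r normrN gtr0_norm// mulr_gt0.
have D2 : ball 0 d2 (ep * 2).
  by rewrite /ball/= sub0r normrN gtr0_norm// mulr_gt0.
have e2 : 0 < ep * 2 by rewrite mulr_gt0.
have := Hd1 _ D1 e2; have := Hd2 _ D2 e2.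
rewrite sub0r normrN ger0_norm; last by apply: fine_ge0; exact: davg_ge0.
move=> F1 F2.
have {F1 F2} : (davg (h \_ `[0%R, b n]) a (ep * 2) <= (e / 4)%:E)%E.
  by rewrite -(fineK F2) lee_fin.
rewrite /davg /iavg lebesgue_measure_ball ?(ltW e2)//=.
rewrite inver gt_eqF ?pmulrn_lgt0// lee_pdivrMl; last by rewrite pmulrn_lgt0.
rewrite -EFinM (_ : ep * 2 *+ 2 * (e / 4) = e * ep); last by rewrite -mulr_natr; field.
apply: le_trans.
have sub : `[a, (a + ep)] `<=` ball a (ep * 2).
  move=> t /=; rewrite in_itv/= ball_itv/= in_itv/= => /andP[at_ ta].
  by apply/andP; split; lra.
have mhb : measurable_fun [set: R] (h \_ `[0, b n]).
  by apply/(measurable_restrictT _ _).1 => //; exact: measurable_funTS.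
have mB : measurable (ball a (ep * 2) : set (measurableTypeR R)).
  exact: measurable_ball.
apply: (@le_trans _ _ (\int[mu]_(t in `[a, (a + ep)%R])
  `|((center ((h \_ `[0%R, b n]) a) \o h \_ `[0%R, b n]) t)%:E|)%E).
  apply: ge0_le_integral => //.
  - by do 2 apply: measurableT_comp => //; apply: measurable_funB => //; exact: measurable_funTS.
  - do 2 apply: measurableT_comp => //; apply: measurable_funB => //.
    exact: measurable_funTS.
  - move=> t /=; rewrite in_itv/= => /andP[at_ ta].
    rewrite !patchE !mem_set//= ?in_itv/= ?(ltW a0) ?(ltW an)//.
    by apply/andP; split; [exact: le_trans (ltW a0) at_|rewrite (le_trans ta)//; lra].
apply: ge0_subset_integral => //.
do 2 apply: measurableT_comp => //; apply: measurable_funB => //.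
exact: measurable_funTS.
Qed.

End right_lebesgue_pt.

(** * Smoothed steps and point values *)

Section mollify.
Context {R : realType}.
Local Notation mu := (@lebesgue_measure R).
Variables s s' : R -> R.
Hypotheses (ss : smooth1 s) (ss' : smooth1 s').
Hypothesis ds : forall t : R, is_derive t (1 : R) s (s' t).
Hypothesis s0 : forall t, t <= 0 -> s t = 0.
Hypothesis s1 : forall t, 1 <= t -> s t = 1.
Hypothesis s'0 : forall t, ~~ (0 <= t <= 1) -> s' t = 0.

(** A smoothed indicator of [a, +oo[ that rises on [a, a + ep]. The argument (t - a) / ep is spelled
    as an affine function to match [smooth1_affine]. *)
Definition step (a ep t : R) := s (ep^-1 * t + - a / ep).
Definition step' (a ep t : R) := s' (ep^-1 * t + - a / ep) * ep^-1.

Lemma smooth1_step a ep : smooth1 (step a ep).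
Proof. exact: smooth1_affine. Qed.

Lemma smooth1_step' a ep : smooth1 (step' a ep).
Proof. by apply: smooth1_mul; [exact: smooth1_affine|exact: smooth1_cst]. Qed.

Lemma is_derive_step a ep (t : R) : is_derive t (1 : R) (step a ep) (step' a ep t).
Proof.
apply: (@is_derive1_comp _ s (fun t => ep^-1 * t + - a / ep)).
have -> : (fun t => ep^-1 * t + - a / ep) = (ep^-1 \*: id) + cst (- a / ep) by [].
by apply: is_derive_eq; rewrite addr0 /GRing.scale/= mulr1.
Qed.

Lemma step_arg (a ep t : R) : ep^-1 * t + - a / ep = (t - a) / ep.
Proof. by rewrite mulrC -mulrDl. Qed.

Lemma step'_out a ep t : 0 < ep -> ~~ (a <= t <= a + ep) -> step' a ep t = 0.
Proof.
move=> e0 H; rewrite /step' step_arg s'0 ?mul0r//; apply: contra H.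
by rewrite ler_pdivlMr// mul0r ler_pdivrMr// mul1r subr_ge0 lerBlDl.
Qed.

Lemma integral_step' a ep : 0 < ep ->
  (\int[mu]_(t in `[a, (a + ep)%R]) (step' a ep t)%:E = 1)%E.
Proof.
move=> e0; rewrite (@continuous_FTC2 _ _ (step a ep))//.
- by rewrite /step !step_arg addrAC subrr add0r mul0r mulfV ?gt_eqF// (s1 (lexx 1)) (s0 (lexx 0)) sube0.
- by rewrite ltrDl.
- by apply: continuous_subspaceT; exact/smooth1_continuous/smooth1_step'.
- have cs := smooth1_continuous (smooth1_step a ep).
  split; last 2 first.
    by apply: cvg_at_right_filter; exact: cs.
    by apply: cvg_at_left_filter; exact: cs.
  by move=> t _; case: (is_derive_step a ep t).
- by move=> t _; rewrite derive1E; case: (is_derive_step a ep t).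
Qed.

(** [step'] has integral 1 over [a, a + ep] and is at most C / ep in absolute value, so the error is
    at most C / ep times the integral of |h - h a| there, which is small compared with ep at a right
    Lebesgue point. *)
Lemma mollify (h : R -> R) (a b : R) : measurable_fun setT h ->
  mu.-integrable `[0, b] (EFin \o h) -> 0 < a -> a < b -> b < 1 -> right_lebesgue_pt h a ->
  forall e, 0 < e -> exists2 d, 0 < d & forall ep, 0 < ep -> ep < d ->
  mu.-integrable `[0, 1[ (fun t => (h t * step' a ep t)%:E) /\
  (`|\int[mu]_(t in `[0%R, 1%R[) (h t * step' a ep t)%:E - (h a)%:E| <= e%:E)%E.
Proof.
move=> mh ih a0 ab b1 rh e e0.
have [C HC] := continuous_bounded01 (smooth1_continuous ss').
have C0 : 0 <= C by apply: le_trans (HC 0 _); rewrite ?lexx ?ler01.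
have Cs t : `|s' t| <= C.
  by have [/HC//|/s'0 ->] := boolP (0 <= t <= 1); rewrite normr0.
have C1 : 0 < C + 1 by rewrite ltr_wpDl.
have [d d0 Hd] := rh _ (divr_gt0 e0 C1).
exists (Num.min d (b - a)); first by rewrite lt_min d0 subr_gt0.
move=> ep ep0; rewrite lt_min => /andP[epd epb].
pose D : set R := `[a, a + ep]%classic.
have mD : measurable (D : set (measurableTypeR R)) by exact: measurable_itv.
have mI : measurable (`[0, 1[%classic : set (measurableTypeR R)) by exact: measurable_itv.
have DI : D `<=` `[0, 1[.
  move=> t; rewrite /D/= !in_itv/= => /andP[at_ ta]; apply/andP; split; lra.
have D0b : D `<=` `[0, b].
  move=> t; rewrite /D/= !in_itv/= => /andP[at_ ta]; apply/andP; split; lra.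
have ihD : mu.-integrable D (EFin \o h) by apply: integrableS ih => //.
have cst' := smooth1_continuous (smooth1_step' a ep).
have mst' : measurable_fun setT (step' a ep) by exact: continuous_measurable_fun.
have Cst t : `|step' a ep t| <= C / ep.
  have ei : 0 <= ep^-1 by rewrite invr_ge0 ltW.
  by rewrite /step' normrM (ger0_norm ei) ler_wpM2r.
have bst : [bounded step' a ep x | x in D].
  exists (C / ep); split; first exact: num_real.
  by move=> M CM x /= _; rewrite (le_trans (Cst x))// ltW.
have iD : mu.-integrable D (fun t => (h t * step' a ep t)%:E).
  apply: (@integrableMl _ _ _ mu D mD (EFin \o h) (step' a ep)) => //.
  exact: measurable_funTS.
have E : (fun t => (h t * step' a ep t)%:E) = (fun t => (h t * step' a ep t)%:E) \_ D.
  apply/funext => t; rewrite patchE; case: ifPn => // /negP.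
  by rewrite inE /D/= in_itv/= => /negP H; rewrite step'_out ?mulr0.
have finmu : (mu D < +oo)%E.
  by rewrite lebesgue_measure_itv/= lte_fin; case: ifP => _; rewrite ?ltry// -EFinB ltry.
have ist : mu.-integrable D (fun t => (h a * step' a ep t)%:E).
  apply: measurable_bounded_integrable => //.
    by apply: measurable_funM => //; exact: measurable_funTS.
  exists (`|h a| * (C / ep)); split; first exact: num_real.
  move=> M CM x /= _; rewrite normrM (le_trans _ (ltW CM))// ler_wpM2l//.
split.
  by rewrite E; apply/integrable_restrict => //; rewrite (setIidr DI).
rewrite E -integral_mkcondr (setIidr DI).
have -> : (h a)%:E = (\int[mu]_(t in D) (h a * step' a ep t)%:E)%E.
  under eq_integral do rewrite EFinM.
  rewrite integralZl//.
    by rewrite integral_step'// mule1.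
  apply: measurable_bounded_integrable => //; exact: measurable_funTS.
rewrite -integralB//.
apply: le_trans.
  apply: le_abse_integral => //.
  by apply: emeasurable_funB; [exact: measurable_int iD|exact: measurable_int ist].
apply: (@le_trans _ _ (\int[mu]_(t in D) ((C / ep)%:E * `|(h t - h a)%:E|))%E).
  apply: ge0_le_integral => //.
  - apply: measurableT_comp => //.
    by apply: emeasurable_funB; [exact: measurable_int iD|exact: measurable_int ist].
  - apply: emeasurable_funM => //; do 2 apply: measurableT_comp => //.
    by apply: measurable_funB => //; exact: measurable_funTS.
  - move=> t _; rewrite -EFinB -mulrBl !abse_EFin -EFinM lee_fin normrM mulrC.
    by rewrite ler_wpM2r.
rewrite ge0_integralZl//; last 2 first.
- do 2 apply: measurableT_comp => //.
  by apply: measurable_funB => //; exact: measurable_funTS.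
- by rewrite lee_fin divr_ge0// ltW.
apply: (@le_trans _ _ ((C / ep)%:E * (e / (C + 1) * ep)%:E)%E).
  by rewrite lee_wpmul2l ?lee_fin ?divr_ge0 ?(ltW ep0)// Hd.
rewrite -EFinM lee_fin (_ : C / ep * (e / (C + 1) * ep) = e * (C / (C + 1))); last first.
  by field; rewrite !gt_eqF.
by rewrite ler_piMr ?(ltW e0)// ler_pdivrMr// mul1r lerDl.
Qed.

End mollify.

(** The optimal choice is l = X / A. It asks for A > 0, which is why the energy bound Q, possibly 0,
    is replaced by some M > Q in the estimates that follow. *)
Lemma sqr_le_of_amgm (R : realFieldType) (X A B : R) : 0 < A -> 0 <= B ->
  0 <= X -> (forall l, 0 < l -> 2 * X <= l * A + l^-1 * B) -> X ^+ 2 <= A * B.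
Proof.
move=> A0 B0; rewrite le_eqVlt => /predU1P[<- H|X0 H].
  by rewrite expr0n/= mulr_ge0 ?(ltW A0).
have := H _ (divr_gt0 X0 A0); rewrite divfK ?gt_eqF// invf_div => {}H.
have : X <= A / X * B by lra.
by rewrite mulrAC ler_pdivlMr// expr2.
Qed.

(** * The energy bound on differences of the profile *)

Section estimates.
Context {R : realType} (N : nat).
Hypothesis N2 : (2 <= N)%N.
Local Notation leb := (@lebesgue_rV R N).
Local Notation ball := (@unit_ball R N).
Local Notation rad := (@rad R N).
Local Notation mu := (@lebesgue_measure R).

Let N0 : (0 < N)%N. Proof. exact: leq_trans N2. Qed.

Variables (u : 'rV[R]_N -> R) (G : 'rV[R]_N -> 'rV[R]_N) (h : R -> R).
Hypothesis mu_ : measurable_fun setT u.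
Hypothesis uG : weak_gradient u G.
Hypothesis mh : measurable_fun setT h.
Hypothesis uh : {ae leb, forall x, ball x -> u x = h (rad x)}.
Variable Q : R.
Hypothesis HQ : (\int[@hvol R N]_x
  ((conf x)^-1 ^+ 2 * enorm (G x) ^+ 2 + u x ^+ 2)%:E <= Q%:E)%E.
Variable al : R.
Hypothesis al1 : 1 - 2 / N%:R <= al.

Lemma integrable_profile b : 0 < b < 1 -> mu.-integrable `[0, b] (EFin \o h).
Proof.
move=> /andP[b0 b1]; have [_ lu _ _] := uG.
pose b2 := b `^ (N%:R / 2)^-1.
have r0 : 0 < N%:R / 2 :> R by rewrite divr_gt0// ltr0n.
have b21 : b2 < 1 by apply: powR_lt1 => //; rewrite invr_gt0.
pose K := [set x : 'rV[R]_N | enorm x ^+ 2 <= b2].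
have mK : measurable K by exact: measurable_ball_sqr.
have Kb : K `<=` ball by exact: ball_sqr_sub.
pose K' := rad @^-1` `[0, b]%classic.
have mK' : measurable K' by rewrite -[X in measurable X]setTI; exact: measurable_rad.
have K'K : K' `<=` K.
  move=> x; rewrite /K' /K/= in_itv/= => /andP[x0 xb].
  have -> : enorm x ^+ 2 = rad x `^ (N%:R / 2)^-1.
    by rewrite radE// -powRrM mulfV ?gt_eqF// powRr1 ?sqr_ge0.
  by apply: ge0_ler_powR; rewrite ?nnegrE ?invr_ge0 ?(ltW r0) ?(ltW b0).
have iu : leb.-integrable K' (EFin \o u).
  by apply: (integrableS mK) => //; apply: lu => //; exact: compact_ball_sqr.
apply: (integrable_rad N0) => //.
- by move=> t /=; rewrite !in_itv/= => /andP[->].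
- exact: measurable_funTS.
have mhr : measurable_fun K' (fun x => (h (rad x))%:E).
  apply/measurable_EFinP/measurable_funTS.
  exact: (measurableT_comp mh (@measurable_rad R N)).
apply/integrableP; split => //; have /integrableP[mu' ] := iu.
apply: le_lt_trans; rewrite le_eqVlt; apply/orP; left; apply/eqP.
apply: ae_eq_integral => //; [exact: measurableT_comp..|].
by apply: filterS uh => x H bx; rewrite /= H//; exact/Kb/K'K.
Qed.


(** For eta one takes a smoothed step at [a] minus one at [b], of a width [ep] small enough for any
    prescribed error. Its support reaches up to b + ep, hence the margin [b' > b] in the bound on
    the weight. *)
Lemma profile_difference_le a b b' l B : 0 < a -> a < b -> b < b' -> b' < 1 ->
  right_lebesgue_pt h a -> right_lebesgue_pt h b -> 0 < l ->
  (\int[mu]_(t in `[a, b']) (weight N al t)%:E <= B%:E)%E ->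
  2 * (N%:R * sigma N * `|h a - h b|) <= l * Q + l^-1 * (sigma N * B).
Proof.
move=> a0 ab bb' b'1 ra rb l0 HB.
have [s [s' [ss ss' ds [s01 s0 s1 s'0]]]] := @smooth_step R.
have sg0 : 0 < @sigma R N by exact: sigma_gt0.
have b'0 : 0 < b' by apply: lt_trans bb'; exact: lt_trans ab.
have ih : mu.-integrable `[0, b'] (EFin \o h) by apply: integrable_profile; rewrite b'0.
have ab' := lt_trans ab bb'; have b0 := lt_trans a0 ab.
apply/ler_addgt0Pr => e e0.
(* Each of the two mollifications costs [e'], and their sum is multiplied by 2 N sigma: the total is
   exactly [e]. *)
pose e' := e / (4 * (N%:R * sigma N)).
have Ns0 : 0 < N%:R * @sigma R N by rewrite mulr_gt0// ltr0n.
have e'0 : 0 < e' by rewrite divr_gt0// mulr_gt0.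
have [da da0 Ha] := mollify ss ss' ds s0 s1 s'0 mh ih a0 ab' b'1 ra e'0.
have [db db0 Hb] := mollify ss ss' ds s0 s1 s'0 mh ih b0 bb' b'1 rb e'0.
pose m := Num.min (Num.min da db) (b' - b).
have m0 : 0 < m by rewrite !lt_min da0 db0 subr_gt0 bb'.
pose ep := m / 2.
have ep0 : 0 < ep by rewrite divr_gt0.
have epm : ep < m by rewrite /ep; lra.
move: (epm); rewrite !lt_min => /andP[/andP[epa epb] epb'].
have {Ha}[ia Ha] := Ha ep ep0 epa; have {Hb}[ib Hb] := Hb ep ep0 epb.
pose eta t := step s a ep t + -1 * step s b ep t.
pose eta' t := step' s' a ep t + -1 * step' s' b ep t.
have se : smooth1 eta.
  apply: smooth1_add; first exact: smooth1_step.
  by apply: smooth1_mul; [exact: smooth1_cst|exact: smooth1_step].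
have de (t : R) : is_derive t (1 : R) eta (eta' t).
  have H1 := is_derive_step ds a ep t; have H2 := is_derive_step ds b ep t.
  have H3 := is_deriveZ (-1) H2.
  exact: is_deriveD H1 H3.
have ed t : t < a -> eta t = 0.
  move=> ta; rewrite /eta /step !step_arg !s0 ?mulr0 ?addr0//.
    by rewrite pmulr_lle0 ?invr_gt0// subr_le0 ltW// (lt_trans ta).
  by rewrite pmulr_lle0 ?invr_gt0// subr_le0 ltW.
have eb t : b' < t -> eta t = 0.
  move=> bt; rewrite /eta /step !step_arg !s1; first by ring.
    by rewrite ler_pdivlMr// mul1r; lra.
  by rewrite ler_pdivlMr// mul1r; lra.
have e1 t : `|eta t| <= 1.
  have := s01 ((t - a) / ep); have := s01 ((t - b) / ep).
  rewrite /eta /step !step_arg => /andP[H1 H2] /andP[H3 H4].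
  by rewrite ler_norml; apply/andP; split; lra.
have := @radial_bound R N N2 u G h mu_ uG mh uh Q HQ eta eta' a b' se de a0 b'0 b'1
  ed eb e1 al al1 l l0.
set A := (\int[mu]_(t in `[0%R, 1%R[) (h t * step' s' a ep t)%:E)%E in Ha *.
set B' := (\int[mu]_(t in `[0%R, 1%R[) (h t * step' s' b ep t)%:E)%E in Hb *.
have Af : A \is a fin_num by exact: integrable_fin_num.
have Bf : B' \is a fin_num by exact: integrable_fin_num.
have -> : (\int[mu]_(t in `[0%R, 1%R[) (h t * eta' t)%:E = A - B')%E.
  rewrite -integralB//; apply: eq_integral => t _; rewrite -EFinB; congr EFin.
  by rewrite /eta'; ring.
move: Ha Hb; rewrite -(fineK Af) -(fineK Bf) -!EFinB !abse_EFin !lee_fin.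
set Ar := fine A; set Br := fine B' => Ha Hb.
rewrite -(EFinM (2 * N%:R)) => H.
have {}H : ((2 * N%:R * `|sigma N * (Ar - Br)|)%:E <= (l * Q + l^-1 * (sigma N * B))%:E)%E.
  apply: (le_trans H); rewrite -EFinM EFinD leeD2l// mulrA [leRHS]EFinM.
  by rewrite lee_wpmul2l// lee_fin mulr_ge0 ?invr_ge0 ?(ltW l0) ?(ltW sg0).
move: H; rewrite lee_fin => H.
have T : `|h a - h b| <= `|Ar - Br| + (e' + e').
  have -> : h a - h b = (Ar - Br) + (- (Ar - h a) + (Br - h b)) by ring.
  apply: (le_trans (ler_normD _ _)); rewrite lerD2l.
  by apply: (le_trans (ler_normD _ _)); rewrite normrN lerD.
apply: (@le_trans _ _ (2 * (N%:R * sigma N * (`|Ar - Br| + (e' + e'))))).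
  by rewrite ler_pM2l// ler_pM2l.
have -> : 2 * (N%:R * sigma N * (`|Ar - Br| + (e' + e'))) =
   2 * N%:R * `|sigma N * (Ar - Br)| + e.
  rewrite normrM (gtr0_norm sg0) /e'; field.
  by rewrite !gt_eqF// ltr0n.
by rewrite lerD2r.
Qed.

(** Optimizing over [l] by [sqr_le_of_amgm] bounds the square of N sigma |h a - h b|; the factor N^2
    >= 1 is then dropped and one sigma cancels. *)
Lemma profile_difference_sqr_le a b b' M B : 0 < a -> a < b -> b < b' -> b' < 1 ->
  right_lebesgue_pt h a -> right_lebesgue_pt h b -> Q < M -> 0 <= Q -> 0 <= B ->
  (\int[mu]_(t in `[a, b']) (weight N al t)%:E <= B%:E)%E ->
  (h a - h b) ^+ 2 <= M * B / sigma N.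
Proof.
move=> a0 ab bb' b'1 ra rb QM Q0 B0 HB.
have sg0 : 0 < @sigma R N by exact: sigma_gt0.
have M0 : 0 < M by exact: le_lt_trans QM.
have Ns0 : 0 < N%:R * @sigma R N by rewrite mulr_gt0// ltr0n.
have : (N%:R * sigma N * `|h a - h b|) ^+ 2 <= M * (sigma N * B).
  apply: sqr_le_of_amgm => //.
  - by rewrite mulr_ge0// ltW.
  - by rewrite mulr_ge0// ltW.
  - move=> l l0; apply: (le_trans (profile_difference_le a0 ab bb' b'1 ra rb l0 HB)).
    by rewrite lerD2r ler_pM2l// ltW.
rewrite exprMn real_normK ?num_real// exprMn => H.
rewrite ler_pdivlMr// -(ler_pM2r sg0).
apply: le_trans (_ : M * (sigma N * B) <= _); last by rewrite mulrA mulrAC.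
apply: le_trans H.
have -> : N%:R ^+ 2 * sigma N ^+ 2 * (h a - h b) ^+ 2 =
  N%:R ^+ 2 * ((h a - h b) ^+ 2 * sigma N * sigma N) by ring.
rewrite ler_peMl//; first by rewrite mulr_ge0 ?(ltW sg0)// mulr_ge0 ?sqr_ge0 ?(ltW sg0).
by rewrite -natrX ler1n expn_gt0 N0.
Qed.

End estimates.

(** * Pointwise decay and equicontinuity of the profile *)

Section decay.
Context {R : realType} (N : nat).
Hypothesis N2 : (2 <= N)%N.
Local Notation mu := (@lebesgue_measure R).
Local Notation sig := (@sigma R N).
Let N0 : (0 < N)%N. Proof. exact: leq_trans N2. Qed.
Let sg0 : 0 < sig. Proof. exact: sigma_gt0. Qed.

Lemma lebesgue_itv_bnd (x y : R) b1 b2 : x < y ->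
  mu [set` Interval (BSide b1 x) (BSide b2 y)] = (y - x)%:E.
Proof. by move=> xy; rewrite lebesgue_measure_itv/= lte_fin xy -EFinB. Qed.

Variable al : R.
Hypothesis al01 : 0 < al <= 1.

Let al0 : 0 < al. Proof. by case/andP: al01. Qed.

Lemma measurable_weight : measurable_fun setT (weight N al).
Proof.
apply: measurable_funM; first exact: measurable_powR.
by apply: measurable_funX; exact: measurable_funB.
Qed.

Lemma integral_powR_itv (a b : R) : 0 < a -> a < b ->
  (\int[mu]_(t in `[a, b]) (t `^ (- 1 - al))%:E = ((a `^ (- al) - b `^ (- al)) / al)%:E)%E.
Proof.
move=> a0 ab.
pose F t := - al^-1 * t `^ (- al).
have dF (t : R) : 0 < t -> is_derive t (1 : R) F (t `^ (- 1 - al)).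
  move=> t0; have := is_deriveZ (- al^-1) (is_derive1_powR (- al) t0).
  move/is_derive_eq; apply; rewrite /GRing.scale/= mulrA mulrNN mulVf ?gt_eqF// mul1r.
  by rewrite addrC.
have cF (t : R) : 0 < t -> F x @[x --> t] --> F t.
  move=> t0; apply: differentiable_continuous; apply/derivable1_diffP.
  by case: (dF _ t0).
rewrite (@continuous_FTC2 _ _ F)//.
- rewrite -EFinB; congr EFin; rewrite /F; field; by rewrite gt_eqF.
- apply: continuous_in_subspaceT => t; rewrite inE/= in_itv/= => /andP[at_ _].
  have t0 : 0 < t by exact: lt_le_trans at_.
  apply: differentiable_continuous; apply/derivable1_diffP.
  by case: (is_derive1_powR (- 1 - al) t0).
- split.
  + move=> t; rewrite in_itv/= => /andP[at_ _].
    by case: (dF _ (lt_trans a0 at_)).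
  + by apply: cvg_at_right_filter; exact: cF.
  + by apply: cvg_at_left_filter; apply: cF; exact: lt_trans ab.
- move=> t; rewrite in_itv/= => /andP[at_ _]; rewrite derive1E.
  by case: (dF _ (lt_trans a0 at_)).
Qed.

Lemma powRN_ge1 (a : R) : 0 < a -> a <= 1 -> 1 <= a `^ (- al).
Proof.
move=> a0 a1; rewrite powRN invf_ge1 ?powR_gt0//.
rewrite [leRHS](_ : 1 = 1 `^ al); last by rewrite powR1.
by apply: ge0_ler_powR; rewrite ?nnegrE ?(ltW al0) ?(ltW a0).
Qed.

(** Bounding (1 - t)^(N-2) by its value at [a] leaves the integral of t^(-1-al). The additional
    factor 1 - a comes from a^(-al) - b^(-al) <= a^(-al) - 1 <= (1 - a) a^(-al), whose last
    inequality is a a^(-al) <= 1, a consequence of al <= 1. *)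
Lemma integral_weight_le (a b : R) : 0 < a -> a < b -> b < 1 ->
  (\int[mu]_(t in `[a, b]) (weight N al t)%:E <=
   ((1 - a) ^+ (N - 1) * a `^ (- al) / al)%:E)%E.
Proof.
move=> a0 ab b1.
have m1 : measurable_fun `[a, b] (fun t => (weight N al t)%:E).
  apply/measurable_EFinP/measurable_funTS; exact: measurable_weight.
have m2 : measurable_fun `[a, b] (fun t : R => (t `^ (- 1 - al))%:E).
  by apply/measurable_EFinP/measurable_funTS; exact: measurable_powR.
apply: (@le_trans _ _ (\int[mu]_(t in `[a, b])
   (((1 - a) ^+ (N - 2))%:E * (t `^ (- 1 - al))%:E))%E).
  apply: ge0_le_integral => //.
  - move=> t /=; rewrite in_itv/= => /andP[at_ tb].
    rewrite lee_fin mulr_ge0 ?powR_ge0// exprn_ge0// subr_ge0.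
    by rewrite (le_trans tb)// ltW.
  - by apply: emeasurable_funM.
  - move=> t /=; rewrite in_itv/= => /andP[at_ tb].
    rewrite -EFinM lee_fin /weight mulrC ler_wpM2r ?powR_ge0//.
    by apply: lerXn2r; rewrite ?nnegrE ?subr_ge0; lra.
rewrite ge0_integralZl//; last 2 first.
- by move=> t _; rewrite lee_fin powR_ge0.
- by rewrite lee_fin exprn_ge0// subr_ge0 ltW// (lt_trans ab).
rewrite integral_powR_itv// -EFinM lee_fin.
have a1 : a < 1 by exact: lt_trans ab b1.
have b0 : 0 < b by exact: lt_trans ab.
have Ha := powRN_ge1 a0 (ltW a1); have Hb := powRN_ge1 b0 (ltW b1).
have Haa : a * a `^ (- al) <= 1.
  rewrite -[X in X * _]powRr1 ?(ltW a0)// -powRD ?(gt_eqF a0) ?implybT//.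
  rewrite [leRHS](_ : 1 = 1 `^ (1 + - al)); last by rewrite powR1.
  apply: ge0_ler_powR; rewrite ?nnegrE ?(ltW a0) ?(ltW a1)//.
  by case/andP: al01 => _; rewrite subr_ge0.
have -> : (N - 1 = (N - 2).+1)%N by case: N N2 => [|[|n]]//= _; rewrite !subSS !subn0.
rewrite exprSr -!mulrA ler_wpM2l ?exprn_ge0 ?subr_ge0 ?(ltW a1)//.
rewrite mulrA ler_pM2r ?invr_gt0//.
lra.
Qed.

(** Linear in b - a with a constant uniform for [a] away from 0: the form suited to equicontinuity,
    as [integral_weight_le] is to decay. *)
Lemma integral_weight_le_length (a b : R) : 0 < a -> a < b -> b < 1 ->
  (\int[mu]_(t in `[a, b]) (weight N al t)%:E <= (a `^ (- 1 - al) * (b - a))%:E)%E.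
Proof.
move=> a0 ab b1.
have m1 : measurable_fun `[a, b] (fun t => (weight N al t)%:E).
  apply/measurable_EFinP/measurable_funTS; exact: measurable_weight.
apply: (@le_trans _ _ (\int[mu]_(t in `[a, b]) (cst (a `^ (- 1 - al))%:E t))%E).
  apply: ge0_le_integral => //.
  - move=> t /=; rewrite in_itv/= => /andP[at_ tb].
    rewrite lee_fin mulr_ge0 ?powR_ge0// exprn_ge0// subr_ge0.
    by rewrite (le_trans tb)// ltW.
  - move=> t /=; rewrite in_itv/= => /andP[at_ tb].
    rewrite lee_fin -[leRHS]mulr1 ler_pM ?powR_ge0//.
    + by rewrite exprn_ge0// subr_ge0 (le_trans tb)// ltW.
    + rewrite (_ : - 1 - al = - (1 + al)); last by ring.
      rewrite !powRN lef_pV2 ?posrE ?powR_gt0 ?(lt_le_trans a0 at_)//.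
      by apply: ge0_ler_powR; rewrite ?nnegrE ?(ltW a0) ?addr_ge0 ?(ltW al0) ?(le_trans (ltW a0) at_).
    + rewrite exprn_ile1 ?subr_ge0 ?(le_trans tb) ?(ltW b1)//.
      by rewrite lerBlDr lerDl (le_trans (ltW a0)).
rewrite integral_cst// [X in (_ * X <= _)%E](_ : _ = (b - a)%:E) ?EFinM//.
exact: lebesgue_itv_bnd.
Qed.

(** From here on the function on the ball is forgotten: decay and continuity follow from the
    difference estimate [Hk] on a set [P] of full measure and from the weighted square integrability
    [Hu]. *)
Variables (h : R -> R) (P : R -> Prop) (Q : R).
Hypothesis mh : measurable_fun setT h.
Hypothesis Q0 : 0 <= Q.
Hypothesis aeP : {ae mu, forall a, 0 < a < 1 -> P a}.
Hypothesis Hk : forall a b b' M B, 0 < a -> a < b -> b < b' -> b' < 1 ->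
  P a -> P b -> Q < M -> 0 <= B ->
  (\int[mu]_(t in `[a, b']) (weight N al t)%:E <= B%:E)%E ->
  (h a - h b) ^+ 2 <= M * B / sig.
Hypothesis Hu : (sig%:E *
  \int[mu]_(t in `[0%R, 1%R[) (h t ^+ 2 * (2 / (1 - t)) ^+ N)%:E <= Q%:E)%E.

Lemma ae_exists_itv (x y : R) : 0 <= x -> x < y -> y <= 1 -> exists2 t, x < t < y & P t.
Proof.
move=> x0 xy y1; apply: contrapT => H.
have [Z [mZ Z0 PZ]] := aeP.
have sub : `]x, y[ `<=` Z.
  move=> t /=; rewrite in_itv/= => xty; apply: PZ => /= Pt; apply: H.
  exists t => //; apply: Pt; case/andP: xty => xt ty.
  by rewrite (le_lt_trans x0 xt) (lt_le_trans ty y1).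
have : (mu `]x, y[%classic <= 0)%E.
  by rewrite -Z0; apply: le_measure; rewrite ?inE.
rewrite lebesgue_measure_itv/= lte_fin xy -EFinB lee_fin subr_le0.
by rewrite leNgt xy.
Qed.

(* Otherwise h^2 (2 / (1 - t))^N would have too large an integral on
   ]a, (1 + a)/2[. *)
Lemma exists_small_value a M : 0 < a -> a < 1 -> Q < M ->
  exists b, [/\ a < b, b < (1 + a) / 2, P b & h b ^+ 2 <= M * (1 - a) ^+ (N - 1) / sig].
Proof.
move=> a0 a1 QM; apply: contrapT => H.
pose y := (1 + a) / 2; have ay : a < y by rewrite /y; lra.
have y1 : y < 1 by rewrite /y; lra.
pose T := M * (1 - a) ^+ (N - 1) / sig.
have M0 : 0 < M by exact: le_lt_trans QM.
have a10 : 0 < 1 - a by lra.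
have T0 : 0 < T by rewrite divr_gt0// mulr_gt0// exprn_gt0.
pose f t := h t ^+ 2 * (2 / (1 - t)) ^+ N.
have mf (D : set R) : measurable D -> D `<=` `[0, 1[ -> measurable_fun D (fun t => (f t)%:E).
  move=> mD D01; apply/measurable_EFinP; apply: measurable_funM.
    by apply: measurable_funTS; exact: (measurable_funX 2 mh).
  exact: measurable_inv_onem.
have f0 t : `[0, 1[%classic t -> 0 <= f t.
  rewrite /= in_itv/= => /andP[_ t1].
  by rewrite mulr_ge0 ?sqr_ge0// exprn_ge0// divr_ge0// subr_ge0 ltW.
have sub : `]a, y[ `<=` `[0, 1[.
  move=> t /=; rewrite !in_itv/= => /andP[at_ ty].
  by rewrite (ltW (lt_trans a0 at_)) (lt_trans ty).
have : ((T * (2 / (1 - a)) ^+ N * (y - a))%:E <=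
   \int[mu]_(t in `[0%R, 1%R[) (f t)%:E)%E.
  apply: (@le_trans _ _ (\int[mu]_(t in `]a, y[) (f t)%:E)%E); last first.
    by apply: ge0_subset_integral => //; exact: mf.
  apply: (@le_trans _ _ (\int[mu]_(t in `]a, y[) (cst (T * (2 / (1 - a)) ^+ N)%:E t))%E).
    rewrite integral_cst// [X in (_ <= _ * X)%E](_ : _ = (y - a)%:E) ?EFinM//.
    exact: lebesgue_itv_bnd.
  apply: ae_ge0_le_integral => //.
  - by move=> t _; rewrite lee_fin mulr_ge0 ?(ltW T0)// exprn_ge0// divr_ge0// ltW.
  - by move=> t /sub/f0; rewrite lee_fin.
  - by apply: mf.
  - have [Z [mZ Z0 PZ]] := aeP; exists Z; split => //.
    apply: subset_trans PZ => t /= H' Pt; apply: H'; rewrite in_itv/= => /andP[at_ ty].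
    have t1 : t < 1 by exact: lt_trans ty y1.
    have t10 : 0 < 1 - t by rewrite subr_gt0.
    have {}Pt : P t by apply: Pt; rewrite t1 (lt_trans a0).
    rewrite lee_fin ler_pM ?(ltW T0) ?exprn_ge0 ?divr_ge0 ?(ltW a10)//.
      rewrite leNgt; apply/negP => hT; apply: H; exists t; split => //.
      exact: ltW.
    apply: lerXn2r; rewrite ?nnegrE ?divr_ge0 ?(ltW a10) ?(ltW t10)//.
    rewrite ler_pM2l// lef_pV2 ?posrE// lerD2l lerN2 ltW//.
move=> Hint.
have {Hint} : ((sig * (T * (2 / (1 - a)) ^+ N * (y - a)))%:E <= Q%:E)%E.
  apply: le_trans Hu; rewrite [leLHS]EFinM lee_wpmul2l// lee_fin ltW//.
rewrite lee_fin leNgt => /negP; apply; apply: (lt_le_trans QM).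
have N1 : (N = (N - 1).+1)%N by rewrite subn1 prednK.
(* Since y - a = (1 - a)/2, the powers of 1 - a cancel: this fixes the exponent N - 1 in the
   statement. *)
have -> : sig * (T * (2 / (1 - a)) ^+ N * (y - a)) = M * 2 ^+ (N - 1).
  rewrite (_ : (2 / (1 - a)) ^+ N = (2 / (1 - a)) ^+ (N - 1) * (2 / (1 - a))); last first.
    by rewrite -exprSr -N1.
  rewrite expr_div_n /T /y; field.
  by rewrite !gt_eqF// exprn_gt0.
by rewrite ler_peMr ?(ltW M0)// -natrX ler1n expn_gt0.
Qed.

(** h(a)^2 <= 2 h(b)^2 + 2 (h(a) - h(b))^2, where b is the point of [exists_small_value]. Both
    squares are at most M w v / (al sig), whence the constant 4; for h(b)^2 the bound is weakened by
    the factor v / al >= 1. *)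
Lemma decay_lt a M : 0 < a -> a < 1 -> P a -> Q < M ->
  h a ^+ 2 <= M * (4 / (al * sig) * ((1 - a) ^+ (N - 1) * a `^ (- al))).
Proof.
move=> a0 a1 Pa QM.
have [b [ab ba Pb Hb]] := exists_small_value a0 a1 QM.
pose b' := (1 + a) / 2; have b'1 : b' < 1 by rewrite /b'; lra.
have M0 : 0 < M by exact: le_lt_trans QM.
have ap := powRN_ge1 a0 (ltW a1).
set w := (1 - a) ^+ (N - 1) in Hb *; set v := a `^ (- al) in ap *.
have w0 : 0 <= w by rewrite exprn_ge0// subr_ge0 ltW.
have ab' : a < b' by exact: lt_trans ba.
have B0 : 0 <= w * v / al.
  by rewrite divr_ge0 ?(ltW al0)// mulr_ge0// (le_trans ler01).
have H := Hk a0 ab ba b'1 Pa Pb QM B0 (integral_weight_le a0 ab' b'1).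
have H2 : h a ^+ 2 <= 2 * h b ^+ 2 + 2 * (h a - h b) ^+ 2.
  rewrite -subr_ge0 (_ : _ - _ = (h a - 2 * h b) ^+ 2); last by ring.
  exact: sqr_ge0.
apply: (le_trans H2).
have H3 : h b ^+ 2 <= M * (w * v / al) / sig.
  apply: (le_trans Hb); rewrite ler_pM2r ?invr_gt0// ler_pM2l//.
  rewrite ler_pdivlMr//; apply: ler_pM => //; first exact: ltW.
  by case/andP: al01 => _ /le_trans; apply.
have -> : M * (4 / (al * sig) * (w * v)) =
    2 * (M * (w * v / al) / sig) + 2 * (M * (w * v / al) / sig).
  by field; rewrite !gt_eqF.
by rewrite lerD// ler_pM2l.
Qed.

(** Letting M tend to Q keeps the estimate proportional to Q, as the boundedness of the embedding
    demands. *)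
Lemma decay a : 0 < a -> a < 1 -> P a ->
  h a ^+ 2 <= Q * (4 / (al * sig) * ((1 - a) ^+ (N - 1) * a `^ (- al))).
Proof.
move=> a0 a1 Pa; set C := _ / _ * _.
have C0 : 0 <= C.
  rewrite mulr_ge0 ?divr_ge0 ?(ltW (mulr_gt0 al0 sg0))//.
  by rewrite mulr_ge0 ?powR_ge0// exprn_ge0// subr_ge0 ltW.
have C1 : 0 < C + 1 by rewrite ltr_wpDl.
apply/ler_addgt0Pr => e e0.
have QM : Q < Q + e / (C + 1) by rewrite ltrDl divr_gt0.
apply: (le_trans (decay_lt a0 a1 Pa QM)); rewrite -/C mulrDl lerD2l.
rewrite mulrAC ler_pdivrMr// ler_wpM2l ?(ltW e0)//.
by rewrite lerDl.
Qed.

(** Here M = Q + 1 suffices, since only uniformity over bounded sequences matters. The auxiliary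
    [b'] stays below 1 and keeps the length of [a, b'] within 2 (b - a). *)
Lemma equicontinuity d a b : 0 < d -> d <= a -> a < b -> b < 1 -> P a -> P b ->
  (h a - h b) ^+ 2 <= (Q + 1) * (d `^ (- 1 - al) * (2 * (b - a))) / sig.
Proof.
move=> d0 da ab b1 Pa Pb; have a0 : 0 < a by exact: lt_le_trans da.
pose b' := Num.min (b + (b - a)) ((b + 1) / 2).
have bb' : b < b' by rewrite lt_min; apply/andP; split; lra.
have b'1 : b' < 1 by rewrite gt_min; apply/orP; right; lra.
have ab' := lt_trans ab bb'.
have b'a : b' - a <= 2 * (b - a).
  have : b' <= b + (b - a) by rewrite ge_min lexx.
  lra.
have QM : Q < Q + 1 by rewrite ltrDl.
apply: (Hk a0 ab bb' b'1 Pa Pb QM).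
  by rewrite mulr_ge0 ?powR_ge0// mulr_ge0// subr_ge0 ltW.
apply: (le_trans (integral_weight_le_length a0 ab' b'1)).
rewrite lee_fin ler_pM ?powR_ge0 ?subr_ge0 ?(ltW ab')//.
rewrite (_ : - 1 - al = - (1 + al)); last by ring.
rewrite !powRN lef_pV2 ?posrE ?powR_gt0//.
by apply: ge0_ler_powR; rewrite ?nnegrE ?(ltW a0) ?(ltW d0) ?addr_ge0 ?(ltW al0).
Qed.

End decay.

(** * From a radial function to its profile *)

Section profile.
Context {R : realType} (N : nat).
Hypothesis N2 : (2 <= N)%N.
Local Notation leb := (@lebesgue_rV R N).
Local Notation ball := (@unit_ball R N).
Local Notation rad := (@rad R N).
Local Notation mu := (@lebesgue_measure R).
Local Notation sig := (@sigma R N).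
Let N0 : (0 < N)%N. Proof. exact: leq_trans N2. Qed.

(** The gradient term is dropped, and [conf] is bounded below by 2 / (1 - s). *)
Lemma integral_sqr_profile (u : 'rV[R]_N -> R) (G : 'rV[R]_N -> 'rV[R]_N) (h : R -> R) (Q : R) :
  measurable_fun setT u -> measurable_fun setT G -> measurable_fun setT h ->
  {ae leb, forall x, ball x -> u x = h (rad x)} ->
  (\int[@hvol R N]_x
    ((conf x)^-1 ^+ 2 * enorm (G x) ^+ 2 + u x ^+ 2)%:E <= Q%:E)%E ->
  (sig%:E * \int[mu]_(t in `[0%R, 1%R[) (h t ^+ 2 * (2 / (1 - t)) ^+ N)%:E <= Q%:E)%E.
Proof.
move=> mu_ mG mh uh HQ.
have mb := @measurable_unit_ball R N.
pose A x := (conf x)^-1 ^+ 2 * enorm (G x) ^+ 2 + u x ^+ 2.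
have mA0 : measurable_fun setT A by exact: measurable_energy.
have A0 x : 0 <= A x by exact: energy_ge0.
have mAE : measurable_fun setT (fun x => (A x)%:E) by exact/measurable_EFinP.
have := HQ; rewrite (ge0_integral_hvol mAE) => [HQ'|x]; last by rewrite lee_fin.
apply: le_trans HQ'.
pose f t := h t ^+ 2 * (2 / (1 - t)) ^+ N.
have I01 : (`[0, 1[%classic : set R) `<=` `[0, +oo[ by move=> t /=; rewrite !in_itv/= => /andP[->].
have mf : measurable_fun (`[0, 1[%classic : set R) (fun t => (f t)%:E).
  apply/measurable_EFinP; apply: measurable_funM.
    by apply: measurable_funTS; exact: (measurable_funX 2 mh).
  exact: measurable_inv_onem.
have f0 t : `[0, 1[%classic t -> (0 <= (f t)%:E)%E.
  rewrite /= in_itv/= => /andP[_ t1].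
  by rewrite lee_fin mulr_ge0 ?sqr_ge0// exprn_ge0// divr_ge0// subr_ge0 ltW.
rewrite -(ge0_integral_rad N0 (g := fun t => (f t)%:E))// -ball_rad//.
have cN : measurable_fun ball (fun x => conf x ^+ N).
  by apply: measurable_funX; exact: measurable_conf.
apply: ae_ge0_le_integral => //.
- by move=> x; rewrite ball_rad// => /f0.
- exact: (measurable_comp_rad N0 mf).
- by move=> x /conf_gt0 c0; rewrite -EFinM lee_fin mulr_ge0// exprn_ge0// ltW.
- apply: emeasurable_funM; last exact/measurable_EFinP.
  exact: measurable_funTS.
- apply: filterS uh => x H bx; rewrite -EFinM lee_fin /f -H//.
  have c1 := conf_ge N2 bx.
  have r1 : rad x < 1 by move: bx; rewrite ball_rad//= in_itv/= => /andP[].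
  have r10 : 0 < 1 - rad x by rewrite subr_gt0.
  apply: ler_pM; rewrite ?sqr_ge0 ?exprn_ge0 ?divr_ge0 ?(ltW r10)//.
    by rewrite /A lerDr; apply: mulr_ge0; exact: sqr_ge0.
  have cg := conf_gt0 bx.
  by apply: lerXn2r; rewrite ?nnegrE ?(ltW cg)// divr_ge0 ?(ltW r10).
Qed.

(** [P] will be the set of right Lebesgue points of [h], and [Q] the square of the norm. They are
    packaged existentially so that a whole sequence of profiles can be chosen later without a return
    to weak gradients. *)
Lemma H1r_profile (u : 'rV[R]_N -> R) (al : R) : 1 - 2 / N%:R <= al -> 0 < al <= 1 ->
  H1r u -> exists h : R -> R, exists P : R -> Prop, exists Q : R,
  [/\ 0 <= Q, H1norm u = ((Q%:E) `^ 2^-1)%E, {ae mu, forall a, 0 < a < 1 -> P a},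
   {ae @hvol R N, forall x, u x = h (rad x)} &
   (forall a, 0 < a -> a < 1 -> P a ->
     h a ^+ 2 <= Q * (4 / (al * sig) * ((1 - a) ^+ (N - 1) * a `^ (- al)))) /\
   (forall d a b, 0 < d -> d <= a -> a < b -> b < 1 -> P a -> P b ->
     (h a - h b) ^+ 2 <= (Q + 1) * (d `^ (- 1 - al) * (2 * (b - a))) / sig)].
Proof.
move=> al1 al01 [[mu_ exG nfin] [f mf uf]].
(* [xget] falls back on its default only if there is no weak gradient, which [exG] excludes. *)
have uG : weak_gradient u (wgrad u) by rewrite /wgrad; case: xgetP => // /forallNP; case.
set I := (\int[@hvol R N]_x (hgrad_sqr u x + u x ^+ 2)%:E)%E.
have I0 : (0 <= I)%E.
  apply: integral_ge0 => x _; rewrite lee_fin addr_ge0 ?sqr_ge0//.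
  by apply: mulr_ge0; exact: sqr_ge0.
have Ifin : I \is a fin_num.
  by rewrite ge0_fin_numE//; apply: lty_poweRy nfin; rewrite gt_eqF// invr_gt0.
pose Q := fine I.
have IQ : I = Q%:E by rewrite fineK.
have HQ : (\int[@hvol R N]_x
  ((conf x)^-1 ^+ 2 * enorm (wgrad u x) ^+ 2 + u x ^+ 2)%:E <= Q%:E)%E by rewrite -IQ.
pose h t := f (t `^ N%:R^-1).
have mh : measurable_fun setT h.
  exact: (measurableT_comp mf (measurable_powR _)).
have uhv : {ae @hvol R N, forall x, u x = h (rad x)}.
  apply: filterS uf => x ->; rewrite /h /rad -powR_mulrn ?enorm_ge0//.
  by rewrite -powRrM mulfV ?powRr1 ?enorm_ge0// pnatr_eq0 gtn_eqF.
have uh := ae_hvol_leb uhv.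
have mG : measurable_fun setT (wgrad u) by case: uG.
have Hu := integral_sqr_profile mu_ mG mh uh HQ.
have Q0 : 0 <= Q by exact: fine_ge0.
have aeP : {ae mu, forall a, 0 < a < 1 -> right_lebesgue_pt h a}.
  by apply: ae_right_lebesgue_pt => // b; exact: (integrable_profile N2 uG mh uh).
have Hk a b b' M B : 0 < a -> a < b -> b < b' -> b' < 1 ->
  right_lebesgue_pt h a -> right_lebesgue_pt h b -> Q < M -> 0 <= B ->
  (\int[mu]_(t in `[a, b']) (weight N al t)%:E <= B%:E)%E ->
  (h a - h b) ^+ 2 <= M * B / sig.
  move=> a0 ab bb' b'1 ra rb QM B0.
  exact: (profile_difference_sqr_le N2 mu_ uG mh uh HQ al1 a0 ab bb' b'1 ra rb QM Q0 B0).
exists h, (right_lebesgue_pt h), Q; split => //; first by rewrite /H1norm -/I IQ.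
split.
  move=> a a0 a1 Pa.
  exact: (@decay R N N2 al al01 h (right_lebesgue_pt h) Q mh Q0 aeP Hk Hu a a0 a1 Pa).
move=> d a b d0 da ab b1 Pa Pb.
exact: (@equicontinuity R N al al01 h (right_lebesgue_pt h) Q Hk d a b d0 da ab b1 Pa Pb).
Qed.

End profile.

(** * Integrability of the pointwise bound *)

Section improper.
Context {R : realType}.
Local Notation mu := (@lebesgue_measure R).

(** The intervals [1/(n + 3), 1 - 1/(n + 3)] are nondegenerate and exhaust ]0, 1[; on each of them
    the fundamental theorem of calculus gives a difference of two values of F, both in [0, C]. *)
Lemma integral_le_primitive (f F : R -> R) (C : R) :
  (forall t : R, 0 < t < 1 -> is_derive t (1 : R) F (f t)) ->
  (forall t : R, 0 < t < 1 -> {for t, continuous f}) ->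
  (forall t : R, 0 < t < 1 -> 0 <= f t) -> (forall t : R, 0 < t < 1 -> 0 <= F t <= C) ->
  measurable_fun (`]0, 1[%classic : set R) f ->
  (\int[mu]_(t in `]0%R, 1%R[) (f t)%:E <= C%:E)%E.
Proof.
move=> dF cf f0 FC mf.
pose a n : R := n.+3%:R^-1.
have a0 n : 0 < a n by rewrite invr_gt0.
have a2 n : a n < 2^-1 by rewrite ltf_pV2 ?posrE// ltr_nat.
pose I n : set R := `[a n, 1 - a n]%classic.
have Isub n t : I n t -> 0 < t < 1.
  rewrite /I/= in_itv/= => /andP[h1 h2]; rewrite (lt_le_trans (a0 n) h1)/=.
  by have := a0 n; lra.
have U : \bigcup_n I n = `]0, 1[%classic.
  apply/seteqP; split => t /=; first by move=> [n _ /Isub]; rewrite in_itv.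
  rewrite in_itv/= => /andP[t0 t1].
  have m0 : 0 < Num.min t (1 - t) by rewrite lt_min t0 subr_gt0.
  have [n _ /(_ n (leqnn _))/= Hn] := near_infty_natSinv_lt (PosNum m0).
  have an : a n < Num.min t (1 - t).
    by apply: le_lt_trans Hn; rewrite lef_pV2 ?posrE// ler_nat; exact: ltnW.
  exists n => //; rewrite /I/= in_itv/=; move: an; rewrite lt_min => /andP[/ltW -> ?].
  by lra.
have ndI : nondecreasing_seq I.
  move=> m n mn; apply/subsetPset => t; rewrite /I/= !in_itv/= => /andP[h1 h2].
  have amn : a n <= a m by rewrite lef_pV2 ?posrE// ler_nat !ltnS.
  by rewrite (le_trans amn h1) (le_trans h2)// lerD2l lerN2.
have mI n : measurable (I n : set (measurableTypeR R)) by exact: measurable_itv.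
have H : (\int[mu]_(x in I i) (f x)%:E @[i --> \oo] --> \int[mu]_(t in `]0%R, 1%R[) (f t)%:E)%E.
  rewrite -U; apply: ge0_nondecreasing_set_cvg_integral => // [n|n t /Isub t01].
    apply/measurable_EFinP; apply: measurable_funS mf => //.
    by rewrite -U; exact: bigcup_sup.
  by rewrite lee_fin f0.
rewrite -(cvg_lim _ H)//; apply: lime_le; first by apply/cvg_ex; eexists; exact: H.
near=> n.
have an1 : a n < 1 - a n by have := a2 n; lra.
have IE t : t \in `[a n, 1 - a n] -> 0 < t < 1 by move=> tI; apply: (Isub n).
have an01 : 0 < a n < 1 by apply: IE; rewrite in_itv/= lexx ltW.
have bn01 : 0 < 1 - a n < 1 by apply: IE; rewrite in_itv/= lexx andbT ltW.
have cF (t : R) : 0 < t < 1 -> F x @[x --> t] --> F t.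
  move=> t01; apply: differentiable_continuous; apply/derivable1_diffP.
  by case: (dF _ t01).
rewrite (@continuous_FTC2 _ _ F)//.
- rewrite -EFinB lee_fin.
  by have /andP[h1 h2] := FC _ an01; have /andP[h3 h4] := FC _ bn01; lra.
- by apply: continuous_in_subspaceT => t; rewrite inE/= => /IE; exact: cf.
- split.
  + by move=> t /subset_itv_oo_cc/IE/dF[].
  + by apply: cvg_at_right_filter; exact: cF.
  + by apply: cvg_at_left_filter; exact: cF.
- by move=> t /subset_itv_oo_cc/IE/dF[? <-]; rewrite derive1E.
Unshelve. all: by end_near. Qed.

Lemma integral_powRN (g : R) : g < 1 ->
  (\int[mu]_(t in `]0%R, 1%R[) (t `^ (- g))%:E <= ((1 - g)^-1)%:E)%E.
Proof.
move=> g1; have g10 : 0 < 1 - g by rewrite subr_gt0.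
apply: (@integral_le_primitive (fun t => t `^ (- g)) (fun t => (1 - g)^-1 * t `^ (1 - g))).
- move=> t /andP[t0 _]; have := is_deriveZ ((1 - g)^-1) (is_derive1_powR (1 - g) t0).
  move/is_derive_eq; apply; rewrite /GRing.scale/= mulrA mulVf ?gt_eqF// mul1r.
  by congr (_ `^ _); ring.
- move=> t /andP[t0 _]; apply: differentiable_continuous; apply/derivable1_diffP.
  by case: (is_derive1_powR (- g) t0).
- by move=> t _; exact: powR_ge0.
- move=> t t01; rewrite mulr_ge0 ?powR_ge0 ?invr_ge0 ?(ltW g10)//=.
  by rewrite ler_piMr ?invr_ge0 ?(ltW g10)// powR01_le1 ?(ltW g10).
- by apply: measurable_funTS; exact: measurable_powR.
Qed.

Lemma integral_powRN_onem (g : R) : g < 1 ->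
  (\int[mu]_(t in `]0%R, 1%R[) ((1 - t) `^ (- g))%:E <= ((1 - g)^-1)%:E)%E.
Proof.
move=> g1; have g10 : 0 < 1 - g by rewrite subr_gt0.
have d1 (t : R) : is_derive t (1 : R) (fun t => 1 - t) (- 1).
  have -> : (fun t : R => 1 - t) = cst 1 - id by [].
  by apply: is_derive_eq; rewrite sub0r.
apply: (@integral_le_primitive (fun t => (1 - t) `^ (- g))
  (fun t => (1 - g)^-1 * (1 - (1 - t) `^ (1 - g)))).
- move=> t /andP[_]; rewrite -subr_gt0 => t0.
  have H := @is_derive1_comp _ (fun s => s `^ (1 - g)) (fun t => 1 - t) t _ _
    (is_derive1_powR (1 - g) t0) (d1 t).
  have H2 := is_deriveB (is_derive_cst (1 : R) t (1 : R)) H.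
  have := is_deriveZ ((1 - g)^-1) H2.
  move/is_derive_eq; apply; rewrite /GRing.scale/= sub0r mulrN1 opprK mulrA mulVf ?gt_eqF// mul1r.
  by congr (_ `^ _); ring.
- move=> t /andP[_]; rewrite -subr_gt0 => t0.
  apply: differentiable_continuous; apply/derivable1_diffP.
  by case: (@is_derive1_comp _ (fun s => s `^ (- g)) (fun t => 1 - t) t _ _
    (is_derive1_powR (- g) t0) (d1 t)).
- by move=> t _; exact: powR_ge0.
- move=> t /andP[t0 t1]; have t01 : 0 < 1 - t < 1 by apply/andP; split; lra.
  have P1 := powR01_le1 (ltW g10) t01; have P0 := powR_ge0 (1 - t) (1 - g).
  rewrite mulr_ge0 ?invr_ge0 ?(ltW g10) ?subr_ge0//=.
  by rewrite ler_piMr ?invr_ge0 ?(ltW g10)// lerBlDr lerDl.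
- apply: (measurableT_comp (measurable_powR _)).
  by apply: measurable_funTS; exact: measurable_funB.
Qed.

End improper.

Section dominating.
Context {R : realType} (N : nat) (p al : R).
Hypothesis N2 : (2 <= N)%N.
Hypotheses (p2 : 2 < p) (al0 : 0 < al) (alp : al * (p / 2) < 1).
Local Notation mu := (@lebesgue_measure R).
Local Notation leb := (@lebesgue_rV R N).
Local Notation ball := (@unit_ball R N).
Local Notation rad := (@rad R N).
Let N0 : (0 < N)%N. Proof. exact: leq_trans N2. Qed.

(** The shape of the bound in [decay], without its constants. *)
Definition envelope (t : R) := (1 - t) ^+ (N - 1) * t `^ (- al).

Lemma measurable_envelope : measurable_fun setT envelope.
Proof.
apply: measurable_funM; last exact: measurable_powR.
by apply: measurable_funX; exact: measurable_funB.
Qed.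

(** At the sphere the exponent is be = (N - 1) p/2 - N, and be > -1 because p > 2; at the origin it
    is -al p/2 > -1. The product of the two singular factors is at most twice their sum, because on
    each half of ]0, 1[ one of them is at most 2. *)
Lemma envelope_bound : exists2 C : R, 0 <= C & exists d e : R, [/\ d < 1, e < 1 &
  forall t, 0 < t < 1 -> envelope t `^ (p / 2) * (2 * N%:R / (1 - t)) ^+ N <=
    C * ((1 - t) `^ (- d) + t `^ (- e))].
Proof.
pose q := p / 2; have q1 : 1 < q by rewrite /q ltr_pdivlMr// mul1r.
pose be := (N - 1)%:R * q - N%:R.
have be1 : - be < 1.
  have : (N - 1)%:R * 1 < (N - 1)%:R * q by rewrite ltr_pM2l// ltr0n subn_gt0.
  by rewrite natrB// mulr1 /be natrB//; lra.
exists ((2 * N%:R) ^+ N * 2); first by rewrite mulr_ge0// exprn_ge0.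
exists (Num.max (- be) 0), (al * q); split => //; first by rewrite gt_max be1 ltr01.
set d := Num.max _ _.
have d0 : 0 <= d by rewrite le_max lexx orbT.
have d1 : d < 1 by rewrite gt_max be1 ltr01.
have dbe : - d <= be by rewrite lerNl le_max lexx.
move=> t /andP[t0 t1]; have s0 : 0 < 1 - t by rewrite subr_gt0.
have -> : envelope t `^ (p / 2) * (2 * N%:R / (1 - t)) ^+ N =
   (2 * N%:R) ^+ N * ((1 - t) `^ be * t `^ (- (al * q))).
  rewrite /envelope -/q powRM ?powR_ge0 ?exprn_ge0 ?(ltW s0)//.
  rewrite -(powR_mulrn (N - 1) (ltW s0)) -!powRrM mulNr expr_div_n.
  rewrite /be powRB ?(gt_eqF s0) ?implybT// (powR_mulrn N (ltW s0)).
  by ring.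
rewrite -mulrA ler_wpM2l ?exprn_ge0//.
have s1 : 1 - t <= 1 by lra.
apply: (@le_trans _ _ ((1 - t) `^ (- d) * t `^ (- (al * q)))).
  by rewrite ler_wpM2r ?powR_ge0//; apply: ger_powR => //; rewrite s0.
have A0 := powR_ge0 (1 - t) (- d); have B0 := powR_ge0 t (- (al * q)).
have alq0 : 0 < al * q by rewrite mulr_gt0// (lt_trans ltr01).
have [t2|t2] := leP t 2^-1.
  have : (1 - t) `^ (- d) <= 2.
    apply: (@le_trans _ _ ((1 - t) `^ (- 1))).
      by apply: ger_powR; [rewrite s0|rewrite lerN2 ltW].
    rewrite powR_inv1 ?(ltW s0)// -[leRHS]invrK lef_pV2 ?posrE//; lra.
  by move=> A2; nra.
have : t `^ (- (al * q)) <= 2.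
  apply: (@le_trans _ _ (t `^ (- 1))).
    by apply: ger_powR; [rewrite t0 ltW|rewrite lerN2 ltW].
  rewrite powR_inv1 ?(ltW t0)// -[leRHS]invrK lef_pV2 ?posrE//; lra.
by move=> B2; nra.
Qed.

Lemma integral_envelope :
  (\int[mu]_(t in `[0%R, 1%R[) (envelope t `^ (p / 2) * (2 * N%:R / (1 - t)) ^+ N)%:E < +oo)%E.
Proof.
have [C C0 [d [e [d1 e1 H]]]] := envelope_bound.
have mf (D : set R) : measurable D -> D `<=` `[0, 1[ ->
    measurable_fun D (fun t => (envelope t `^ (p / 2) * (2 * N%:R / (1 - t)) ^+ N)%:E).
  move=> mD D01; apply/measurable_EFinP; apply: measurable_funM.
    apply: (measurableT_comp (measurable_powR _)).
    by apply: measurable_funTS; exact: measurable_envelope.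
  exact: measurable_inv_onem.
have sub : (`]0, 1[%classic : set R) `<=` `[0, 1[ by exact: subset_itv_oo_co.
rewrite -integral_itv_obnd_cbnd; last first.
  apply: mf => //.
have m1 : measurable_fun (`]0, 1[%classic : set R) (fun t => ((1 - t) `^ (- d))%:E).
  apply/measurable_EFinP; apply: (measurableT_comp (measurable_powR _)).
  by apply: measurable_funTS; exact: measurable_funB.
have m2 : measurable_fun (`]0, 1[%classic : set R) (fun t => (t `^ (- e))%:E).
  by apply/measurable_EFinP/measurable_funTS; exact: measurable_powR.
apply: (@le_lt_trans _ _ (\int[mu]_(t in `]0%R, 1%R[)
   (C%:E * (((1 - t) `^ (- d))%:E + (t `^ (- e))%:E)))%E).
  apply: ge0_le_integral => //.
  - move=> t /=; rewrite in_itv/= => /andP[t0 t1].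
    rewrite lee_fin mulr_ge0 ?powR_ge0// exprn_ge0// divr_ge0 ?mulr_ge0// subr_ge0 ltW//.
  - exact: mf.
  - by apply: emeasurable_funM => //; exact: emeasurable_funD.
rewrite ge0_integralZl//; last 2 first.
  exact: emeasurable_funD.
  by move=> t _; rewrite -EFinD lee_fin addr_ge0 ?powR_ge0.
rewrite ge0_integralD//; last 2 first.
- by move=> t _; rewrite lee_fin powR_ge0.
- by move=> t _; rewrite lee_fin powR_ge0.
apply: (@le_lt_trans _ _ (C%:E * ((1 - d)^-1%:E + (1 - e)^-1%:E))%E).
  by rewrite lee_wpmul2l ?lee_fin// leeD// ?integral_powRN_onem ?integral_powRN.
by rewrite -EFinD -EFinM ltry.
Qed.

Lemma integral_hvol_envelope :
  (\int[@hvol R N]_x (envelope (rad x) `^ (p / 2))%:E < +oo)%E.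
Proof.
have mb := @measurable_unit_ball R N.
have me : measurable_fun setT (fun x : 'rV[R]_N => envelope (rad x) `^ (p / 2)).
  apply: (measurableT_comp (measurable_powR _)).
  exact: (measurableT_comp measurable_envelope (@measurable_rad R N)).
rewrite ge0_integral_hvol; last 2 first.
- exact/measurable_EFinP.
- by move=> x; rewrite lee_fin powR_ge0.
pose f t := envelope t `^ (p / 2) * (2 * N%:R / (1 - t)) ^+ N.
have f0 t : `[0, 1[%classic t -> (0 <= (f t)%:E)%E.
  rewrite /= in_itv/= => /andP[_ t1]; rewrite lee_fin mulr_ge0 ?powR_ge0//.
  by rewrite exprn_ge0// divr_ge0// subr_ge0 ltW.
have mf : measurable_fun (`[0, 1[%classic : set R) (fun t => (f t)%:E).
  apply/measurable_EFinP; apply: measurable_funM.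
    apply: (measurableT_comp (measurable_powR _)).
    by apply: measurable_funTS; exact: measurable_envelope.
  exact: measurable_inv_onem.
apply: (@le_lt_trans _ _ ((sigma N)%:E * \int[mu]_(t in `[0%R, 1%R[) (f t)%:E)%E).
  rewrite -(ge0_integral_rad N0 (g := fun t => (f t)%:E))// -?ball_rad//; last first.
    by move=> t /=; rewrite !in_itv/= => /andP[->].
  apply: ge0_le_integral => //.
  - by move=> x /conf_gt0 c0; rewrite -EFinM lee_fin mulr_ge0 ?powR_ge0// exprn_ge0// ltW.
  - apply: emeasurable_funM; apply/measurable_EFinP; first exact: measurable_funTS.
    by apply: measurable_funX; exact: measurable_conf.
  - exact: (measurable_comp_rad N0 mf).
  - move=> x bx; rewrite -EFinM lee_fin /f ler_wpM2l ?powR_ge0//.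
    have c0 := conf_gt0 bx; have c1 := conf_le N0 bx.
    by apply: lerXn2r; rewrite ?nnegrE ?(le_trans (ltW c0) c1) ?(ltW c0).
have := integral_envelope; rewrite -/(f _).
have I0 : (0 <= \int[mu]_(t in `[0%R, 1%R[) (f t)%:E)%E by exact: integral_ge0.
move=> Ifin; rewrite lte_mul_pinfty ?lee_fin//.
by apply/ltW; exact: sigma_gt0.
Qed.

End dominating.

(** * Extraction of a subsequence *)

Section diagonal.
Context {R : realType}.

Lemma increasing_seq_ge (f : nat -> nat) : increasing_seq f -> forall n, (n <= f n)%N.
Proof.
move=> /increasing_seqP fi; elim=> // n IH; apply: (leq_ltn_trans IH).
by have := fi n; rewrite ltEnat.
Qed.

Lemma diagonal_subsequence (v : nat -> nat -> R) : (forall j, bounded_fun (v j)) ->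
  exists2 k : nat -> nat, increasing_seq k & forall j, cvgn (v j \o k).
Proof.
move=> bv.
have ex (js : nat * (nat -> nat)) : exists t : nat -> nat,
    increasing_seq t /\ cvgn (v js.1 \o (js.2 \o t)).
  have bvs : bounded_fun (v js.1 \o js.2).
    have [M [Mr HM]] := bv js.1.
    by exists M; split => // x Mx y _ /=; exact: HM.
  have [t ti tc] := bolzano_weierstrass bvs.
  by exists t.
have [T HT] := choice ex.
pose S := fix S n := if n is n'.+1 then S n' \o T (n', S n') else id.
have Si n : increasing_seq (S n).
  elim: n => // n IH a b /=; rewrite IH.
  by have [H _] := HT (n, S n); exact: H.
have Sc n : cvgn (v n \o S n.+1) by have [_] := HT (n, S n).
(* From index j + 1 on, each extraction factors through [S j.+1] by some [r] with [i <= r i]. Along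
   the diagonal, [v j] is thus evaluated arbitrarily late in a sequence on which it converges. *)
have Stail j m : exists2 r : nat -> nat, S (j.+1 + m)%N = S j.+1 \o r & forall i, (i <= r i)%N.
  elim: m => [|m [r Sr ri]]; first by exists id => //; rewrite addn0.
  exists (r \o T ((j.+1 + m)%N, S (j.+1 + m)%N)).
    apply/funext => i; rewrite addnS.
    exact: (congr1 (fun f => f (T ((j.+1 + m)%N, S (j.+1 + m)%N) i)) Sr).
  move=> i /=; apply: leq_trans (ri _); apply: increasing_seq_ge.
  by have [] := HT ((j.+1 + m)%N, S (j.+1 + m)%N).
exists (fun n => S n n).
  apply/increasing_seqP => n /=.
  have mono := leqW_mono (Si n).
  rewrite -[(_ < _)%O]/(S n n < S n (T (n, S n) n.+1))%N mono.
  by apply: increasing_seq_ge; have [] := HT (n, S n).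
move=> j; have /cvg_ex[l Hl] := Sc j; apply/cvg_ex; exists l.
apply/cvgrPdist_le => e e0; move/cvgrPdist_le : Hl => /(_ e e0)[n0 _ Hn].
exists (maxn n0 j.+1) => // n /=; rewrite geq_max => /andP[n0n jn].
have [r Sr ri] := Stail j (n - j.+1)%N.
rewrite subnKC// in Sr; rewrite Sr; apply: Hn => /=.
exact: leq_trans (ri n).
Qed.

(** A countable dense subset of [P] is obtained by choosing a point of [P] in each interval ]i/(j +
    1), (i + 1)/(j + 1)[. The diagonal subsequence converges at these points, and the uniform
    Hoelder bound carries convergence over to all of [P]. *)
Lemma profile_subsequence (h : nat -> R -> R) (P : R -> Prop) :
  (forall x y : R, 0 <= x -> x < y -> y <= 1 -> exists2 t, x < t < y & P t) ->
  (forall a, 0 < a -> a < 1 -> P a -> exists B, forall n, `|h n a| <= B) ->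
  (forall d, 0 < d -> exists2 K, 0 <= K & forall n a b, d <= a -> a < b -> b < 1 ->
     P a -> P b -> (h n a - h n b) ^+ 2 <= K * (b - a)) ->
  exists2 k : nat -> nat, increasing_seq k &
    forall a, 0 < a -> a < 1 -> P a -> cvgn (fun n => h (k n) a).
Proof.
move=> dense bnd equi.
have ex (ij : nat * nat) : exists t, [/\ 0 < t < 1, P t & (ij.1 < ij.2.+1)%N ->
    ij.1%:R / ij.2.+1%:R < t < ij.1.+1%:R / ij.2.+1%:R].
  (* For i > j the interval lies beyond 1, and an arbitrary point of [P] is chosen instead. *)
  case: ij => i j /=; have [ij|ij] := ltnP i j.+1; last first.
    by have [t t01 Pt] := dense 0 1 (lexx _) ltr01 (lexx _); exists t.
  have j0 : 0 < j.+1%:R :> R by rewrite ltr0n.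
  have x0 : 0 <= i%:R / j.+1%:R :> R by rewrite divr_ge0.
  have y1 : i.+1%:R / j.+1%:R <= 1 :> R by rewrite ler_pdivrMr// mul1r ler_nat.
  have xy : i%:R / j.+1%:R < i.+1%:R / j.+1%:R :> R by rewrite ltr_pM2r ?invr_gt0// ltr_nat.
  have [t txy Pt] := dense _ _ x0 xy y1; exists t; split => //.
  by case/andP: txy => xt ty; rewrite (le_lt_trans x0 xt) (lt_le_trans ty).
have [pt Hpt] := choice ex.
(* Numbers that code no pair are read as (0, 0), a harmless repetition. *)
pose v m n := h n (pt (odflt (0%N, 0%N) (unpickle m))).
have [k ki kc] : exists2 k : nat -> nat, increasing_seq k & forall j, cvgn (v j \o k).
  apply: diagonal_subsequence => j.
  have [/andP[t0 t1] Pt _] := Hpt (odflt (0%N, 0%N) (unpickle j)).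
  have [B HB] := bnd _ t0 t1 Pt.
  by exists B; split; [exact: num_real|move=> M BM n _ /=; rewrite (le_trans (HB n))// ltW].
exists k => // a a0 a1 Pa.
apply/cauchy_cvgP/cauchy_exP => e e0.
(* The constant is the one for [a/2, 1[; the [m] below keeps the neighbour [t] of [a] in that
   interval and makes K |t - a| at most (e/2)^2. *)
have [K K0 HK] := equi _ (divr_gt0 a0 (ltr0Sn R 1)).
have K1 : 0 < K + 1 by rewrite ltr_wpDl.
pose e1 := e / 2; have e10 : 0 < e1 by rewrite divr_gt0.
pose m := Num.min (a / 2) (e1 ^+ 2 / (K + 1)).
have m0 : 0 < m by rewrite lt_min !divr_gt0// exprn_gt0.
have [j _ /(_ j (leqnn _))/= Hj] := near_infty_natSinv_lt (PosNum m0).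
have j0 : 0 < j.+1%:R :> R by rewrite ltr0n.
(* With [i] the integer part of a (j + 1), the point [a] and the chosen [t] share a cell of width
   1/(j + 1). *)
pose i := Num.truncn (a * j.+1%:R).
have /truncn_itv/andP[i1 i2] : 0 <= a * j.+1%:R by rewrite mulr_ge0 ?ltW.
have ij : (i < j.+1)%N.
  by rewrite -(ltr_nat R) (le_lt_trans i1)// -[ltRHS]mul1r ltr_pM2r.
have [/andP[t0 t1] Pt /(_ ij)/=] := Hpt (i, j).
set t := pt (i, j) in t0 t1 Pt *.
rewrite ltr_pdivrMr// ltr_pdivlMr// => /andP[it ti].
have ta : `|t - a| < j.+1%:R^-1.
  rewrite -div1r ltr_pdivlMr// -[j.+1%:R]gtr0_norm// -normrM mulrBl ltr_norml.
  by move: it ti i1 i2; rewrite -/i -[i.+1%:R]natr1; lra.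
have tam : `|t - a| < m by exact: lt_trans Hj.
have a2t : a / 2 <= t.
  have : `|t - a| < a / 2 by apply: (lt_le_trans tam); rewrite ge_min lexx.
  by rewrite ltr_norml; lra.
have near_t n : `|h n a - h n t| <= e1.
  rewrite -(@ler_pXn2r _ 2)// ?nnegrE ?(ltW e10)// real_normK ?num_real//.
  have KT : K * `|t - a| <= e1 ^+ 2.
    have : `|t - a| <= e1 ^+ 2 / (K + 1).
      by apply/ltW/(lt_le_trans tam); rewrite ge_min lexx orbT.
    rewrite ler_pdivlMr// mulrC => H; apply: le_trans H.
    by rewrite ler_wpM2r// lerDl.
  apply: le_trans KT; have [ta_|ta_|->] := ltgtP t a.
  - rewrite -sqrrN opprB distrC gtr0_norm ?subr_gt0//; exact: HK.
  - by rewrite gtr0_norm ?subr_gt0//; apply: HK => //; lra.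
  - by rewrite !subrr expr0n/= normr0 mulr0.
have := kc (pickle (i, j)) => /cvg_ex[l Hl].
exists l; move/cvgrPdist_lt : Hl => /(_ _ e10)[n0 _ Hn].
exists n0 => // n /Hn; rewrite /v/= pickleK/= -/t => Hl.
rewrite /ball/= (_ : l - _ = (l - h (k n) t) - (h (k n) a - h (k n) t)); last by ring.
apply: (le_lt_trans (ler_normB _ _)).
by rewrite (splitr e) ltr_leD.
Qed.

End diagonal.

(** Subcriticality in reciprocal form; for N = 2 the left-hand side is 0 and every finite p
    qualifies. *)
Lemma critical_exponent_lt (R : realType) (N : nat) (p : R) : (2 <= N)%N -> 2 < p ->
  (p%:E < critical_exponent N)%E -> 1 - 2 / N%:R < 2 / p.
Proof.
move=> N2 p2; have p0 : 0 < p by exact: lt_trans p2.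
rewrite /critical_exponent; case: eqP => [-> _|/eqP N2'].
  by rewrite mulfV ?subrr ?divr_gt0// pnatr_eq0.
have N3 : 0 < N%:R - 2 :> R by rewrite subr_gt0 ltr_nat ltn_neqAle eq_sym N2'.
rewrite lte_fin ltr_pdivlMr// => H.
have NR : 0 < N%:R :> R by rewrite ltr0n (leq_trans _ N2).
rewrite ltr_pdivlMr// -(ltr_pM2l NR).
by rewrite (_ : N%:R * ((1 - 2 / N%:R) * p) = p * (N%:R - 2))
  ?(mulrC N%:R)//; field; rewrite gt_eqF.
Qed.

Lemma cvgn_powR0 (R : realType) (r : nat -> R) (q : R) : 0 < q -> (forall n, 0 <= r n) ->
  r n @[n --> \oo] --> 0 -> r n `^ q @[n --> \oo] --> 0.
Proof.
move=> q0 r0 /cvgr0Pnorm_le H; apply/cvgr0Pnorm_le => e e0.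
have e1 : 0 < e `^ q^-1 by exact: powR_gt0.
apply: filterS (H _ e1) => n; rewrite ger0_norm// => Hn.
rewrite ger0_norm ?powR_ge0//.
have -> : e = (e `^ q^-1) `^ q by rewrite -powRrM mulVf ?powRr1 ?gt_eqF// ltW.
by apply: ge0_ler_powR; rewrite ?nnegrE ?(ltW q0) ?powR_ge0.
Qed.

(** * Compactness in L^p *)

Section compactness.
Context {R : realType} (N : nat) (p : R).
Hypothesis N2 : (2 <= N)%N.
Hypothesis p2 : 2 < p.
Hypothesis pc : (p%:E < critical_exponent N)%E.
Local Notation rad := (@rad R N).
Local Notation hv := (@hvol R N).
Local Notation sig := (@sigma R N).
Local Notation mu := (@lebesgue_measure R).
Let N0 : (0 < N)%N. Proof. exact: leq_trans N2. Qed.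
Let sg0 : 0 < sig. Proof. exact: sigma_gt0. Qed.
Let p0 : 0 < p. Proof. exact: lt_trans p2. Qed.
Let p20 : 0 <= p / 2. Proof. by rewrite divr_ge0// ltW. Qed.

(** The midpoint of the admissible range: above 1 - 2/N for the weight, below 2/p for integrability
    at the origin, and positive even when N = 2. *)
Let al := ((1 - 2 / N%:R) + 2 / p) / 2.

Let al1 : 1 - 2 / N%:R <= al.
Proof. by have := critical_exponent_lt N2 p2 pc; rewrite /al; lra. Qed.

Let al2 : al < 2 / p.
Proof. by have := critical_exponent_lt N2 p2 pc; rewrite /al; lra. Qed.

Let al01 : 0 < al <= 1.
Proof.
have a0 : 0 <= 1 - 2 / N%:R :> R.
  by rewrite subr_ge0 ler_pdivrMr ?ltr0n// mul1r ler_nat.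
have a1 : 2 / p < 1 by rewrite ltr_pdivrMr// mul1r.
have a2 : 0 < 2 / p by rewrite divr_gt0.
by apply/andP; split; [rewrite /al; lra|exact/ltW/(lt_trans al2)].
Qed.

Let al0 : 0 < al. Proof. by case/andP: al01. Qed.

Let alp : al * (p / 2) < 1.
Proof.
move: al2; rewrite ltr_pdivlMr// => H.
by rewrite mulrA ltr_pdivrMr// mul1r.
Qed.

Let env x := envelope N al (rad x).

Let env_ge0 x : unit_ball x -> 0 <= env x.
Proof.
rewrite ball_rad//= in_itv/= => /andP[_ r1].
by rewrite mulr_ge0 ?powR_ge0// exprn_ge0// subr_ge0 ltW.
Qed.

Let ae_ball : {ae hv, forall x, unit_ball x /\ 0 < rad x < 1}.
Proof.
have : {ae hv, forall x, 0 < rad x < 1}.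
  by apply: (@ae_hvol_rad R N N0 (fun t => 0 < t < 1)); apply: aeW.
apply: filterS => x r01; split => //; rewrite ball_rad//= in_itv/=.
by case/andP: r01 => /ltW -> ->.
Qed.

Let menv : measurable_fun setT (fun x => env x `^ (p / 2)).
Proof.
apply: (measurableT_comp (measurable_powR _)).
exact: (measurableT_comp (measurable_envelope N al) (@measurable_rad R N)).
Qed.

Let I := (\int[hv]_x (env x `^ (p / 2))%:E)%E.

Let I0 : (0 <= I)%E.
Proof. by apply: integral_ge0 => x _; rewrite lee_fin powR_ge0. Qed.

Let Ifin : I \is a fin_num.
Proof. by rewrite ge0_fin_numE//; exact: integral_hvol_envelope. Qed.

Let powR_half (y : R) : `|y| `^ p = (y ^+ 2) `^ (p / 2).
Proof.
rewrite -(real_normK (num_real y)) -powR_mulrn// -powRrM; congr (_ `^ _).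
by rewrite mulrCA mulfV ?mulr1.
Qed.

Let ptwise (v : 'rV[R]_N -> R) (K : R) : 0 <= K ->
  {ae hv, forall x, v x ^+ 2 <= K * env x} ->
  {ae hv, forall x, `|v x| `^ p <= K `^ (p / 2) * env x `^ (p / 2)}.
Proof.
move=> K0; apply: filterS2 ae_ball => x [bx _] H.
rewrite powR_half -powRM ?env_ge0//.
have E0 := mulr_ge0 K0 (env_ge0 bx).
by apply: ge0_ler_powR; rewrite ?nnegrE ?p20 ?sqr_ge0.
Qed.

Let integral_bound (v : 'rV[R]_N -> R) (K : R) : measurable_fun setT v -> 0 <= K ->
  {ae hv, forall x, v x ^+ 2 <= K * env x} ->
  (\int[hv]_x (`|v x| `^ p)%:E <= (K `^ (p / 2) * fine I)%:E)%E.
Proof.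
move=> mv K0 Hv; rewrite EFinM fineK// -ge0_integralZl//; last 3 first.
- exact/measurable_EFinP.
- by move=> x _; rewrite lee_fin powR_ge0.
- by rewrite lee_fin powR_ge0.
apply: ae_ge0_le_integral => //.
- apply/measurable_EFinP; apply: (measurableT_comp (measurable_powR _)).
  exact: measurableT_comp.
- by move=> x _; rewrite mule_ge0// lee_fin powR_ge0.
- by apply: emeasurable_funM => //; exact/measurable_EFinP.
- by apply: filterS (ptwise K0 Hv) => x H _; rewrite -EFinM lee_fin.
Qed.

Let LnormE (v : 'rV[R]_N -> R) :
  Lnorm hv p%:E (EFin \o v) = ((\int[hv]_x (`|v x| `^ p)%:E) `^ p^-1)%E.
Proof. by rewrite unlock. Qed.

(** The exponent 1/2 on [K] is what makes the choice K = Q C yield a multiple of the square root of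
    Q, that is, of the norm of H1. *)
Let Lnorm_bound (v : 'rV[R]_N -> R) (K : R) : measurable_fun setT v -> 0 <= K ->
  {ae hv, forall x, v x ^+ 2 <= K * env x} ->
  (Lnorm hv p%:E (EFin \o v) <= (K `^ 2^-1 * fine I `^ p^-1)%:E)%E.
Proof.
move=> mv K0 Hv; rewrite LnormE.
have -> : K `^ 2^-1 * fine I `^ p^-1 = (K `^ (p / 2) * fine I) `^ p^-1.
  rewrite powRM ?powR_ge0 ?fine_ge0// -powRrM; congr (_ `^ _ * _).
  by field; rewrite gt_eqF.
rewrite -poweR_EFin; apply: gt0_ler_poweR.
- by rewrite invr_ge0 ltW.
- by rewrite in_itv/= leey andbT integral_ge0// => x _; rewrite lee_fin powR_ge0.
- by rewrite in_itv/= leey andbT lee_fin mulr_ge0 ?powR_ge0 ?fine_ge0.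
- exact: integral_bound.
Qed.

Let C : R := 4 / (al * sig).
Let C0 : 0 < C. Proof. by rewrite divr_gt0// mulr_gt0. Qed.

Let H1r_bound (u : 'rV[R]_N -> R) : H1r u -> exists Q : R,
  [/\ 0 <= Q, H1norm u = (Q `^ 2^-1)%:E & {ae hv, forall x, u x ^+ 2 <= (Q * C) * env x}].
Proof.
move=> Hu; have [h [P [Q [Q0 nQ aeP uh [dec _]]]]] := H1r_profile N2 al1 al01 Hu.
exists Q; split => //.
apply: filterS3 ae_ball uh (ae_hvol_rad N0 aeP) => x [_ r01] -> Pr.
case/andP: r01 => r0 r1; rewrite -mulrA; exact: dec.
Qed.

Let measurable_H1r (u : 'rV[R]_N -> R) : H1r u -> measurable_fun setT u.
Proof. by move=> [[]]. Qed.

Let Lfun_of_bound (v : 'rV[R]_N -> R) (K : R) : measurable_fun setT v -> 0 <= K ->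
  {ae hv, forall x, v x ^+ 2 <= K * env x} -> v \in Lfun hv p%:E.
Proof.
move=> mv K0 Hv; rewrite inE; apply/andP; split; first by rewrite inE/=.
rewrite inE/= /finite_norm; apply: le_lt_trans (Lnorm_bound mv K0 Hv) _.
exact: ltry.
Qed.

(** Each profile has its own exceptional set; the countable intersection [P] of the good sets still
    has full measure, and extraction takes place there for all profiles at once. *)
Let subsequence (u : nat -> 'rV[R]_N -> R) (M : R) : (forall n, H1r (u n)) ->
  (forall n, (H1norm (u n) <= M%:E)%E) ->
  exists2 k : nat -> nat, increasing_seq k & exists v : 'rV[R]_N -> R, exists2 K : R,
   0 <= K & [/\ measurable_fun setT v, {ae hv, forall x, u (k n) x @[n --> \oo] --> v x},
     {ae hv, forall x n, u n x ^+ 2 <= K * env x} &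
     {ae hv, forall x, v x ^+ 2 <= K * env x}].
Proof.
move=> Hu HM.
have /choice[f Hf] : forall n, exists hPQ : (R -> R) * (R -> Prop) * R,
  [/\ 0 <= hPQ.2, H1norm (u n) = ((hPQ.2%:E) `^ 2^-1)%E,
   {ae mu, forall a, 0 < a < 1 -> hPQ.1.2 a},
   {ae hv, forall x, u n x = hPQ.1.1 (rad x)} &
   (forall a, 0 < a -> a < 1 -> hPQ.1.2 a ->
     hPQ.1.1 a ^+ 2 <= hPQ.2 * (4 / (al * sig) * ((1 - a) ^+ (N - 1) * a `^ (- al)))) /\
   (forall d a b, 0 < d -> d <= a -> a < b -> b < 1 -> hPQ.1.2 a -> hPQ.1.2 b ->
     (hPQ.1.1 a - hPQ.1.1 b) ^+ 2 <= (hPQ.2 + 1) * (d `^ (- 1 - al) * (2 * (b - a))) / sig)].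
  move=> n; have [h [P [Q HH]]] := H1r_profile N2 al1 al01 (Hu n).
  by exists (h, P, Q).
pose h n := (f n).1.1; pose P a := forall n, (f n).1.2 a.
pose K := M ^+ 2 * C.
have QM n : (f n).2 <= M ^+ 2.
  have [Q0 nQ _ _ _] := Hf n; have := HM n; rewrite nQ poweR_EFin lee_fin => H.
  rewrite -(@powRr1 _ (f n).2)// (_ : 1 = 2^-1 * 2%:R); last by rewrite mulVf.
  rewrite powRrM powR_mulrn ?powR_ge0// lerXn2r ?nnegrE ?powR_ge0//.
  exact: le_trans (powR_ge0 _ _) H.
have aeP : {ae mu, forall a, 0 < a < 1 -> P a}.
  have : {ae mu, forall a, forall n, 0 < a < 1 -> (f n).1.2 a}.
    by apply: ae_foralln => n; have [] := Hf n.
  by move=> [Z [mZ Z0 HZ]]; exists Z; split => //; apply: subset_trans HZ => a /= H H';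
     apply: H => a01 n; exact: H'.
have hK n a : 0 < a -> a < 1 -> P a -> h n a ^+ 2 <= K * envelope N al a.
  move=> a0 a1 Pa; have [_ _ _ _ [dec _]] := Hf n.
  apply: (le_trans (dec a a0 a1 (Pa n))); rewrite -/C mulrA ler_wpM2r//.
    by rewrite mulr_ge0 ?powR_ge0// exprn_ge0// subr_ge0 ltW.
  by rewrite ler_wpM2r// ltW.
have [k ki kc] : exists2 k : nat -> nat, increasing_seq k &
    forall a, 0 < a -> a < 1 -> P a -> cvgn (fun n => h (k n) a).
  apply: (profile_subsequence (P := P)).
  - exact: ae_exists_itv.
  - move=> a a0 a1 Pa; exists (K * envelope N al a + 1) => n.
    apply: le_trans (_ : h n a ^+ 2 + 1 <= _); last by rewrite lerD2r hK.
    (* (|y| - 1/2)^2 >= 0 gives |y| <= y^2 + 1. *)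
    have := sqr_ge0 (`|h n a| - 2^-1); rewrite -(real_normK (num_real (h n a))).
    by set y := `|h n a|; nra.
  - move=> d d0; exists ((M ^+ 2 + 1) * (d `^ (- 1 - al) * 2) / sig).
      by rewrite divr_ge0 ?(ltW sg0)// mulr_ge0 ?addr_ge0 ?sqr_ge0// mulr_ge0 ?powR_ge0.
    move=> n a b da ab b1 Pa Pb; have [_ _ _ _ [_ eqc]] := Hf n.
    apply: (le_trans (eqc d a b d0 da ab b1 (Pa n) (Pb n))).
    rewrite [leRHS]mulrAC ler_pM2r ?invr_gt0// -!mulrA ler_pM//.
    + by rewrite addr_ge0//; have [] := Hf n.
    + by rewrite !mulr_ge0 ?powR_ge0// subr_ge0 ltW.
    + by rewrite lerD2r.
exists k => //.
(* The upper limit is defined and measurable everywhere, and it agrees with the limit wherever that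
   exists; [fine] sends infinite values to 0. *)
pose v x := fine (limn_esup (fun n => (u (k n) x)%:E)).
have good : {ae hv, forall x, [/\ unit_ball x, 0 < rad x < 1, P (rad x) &
    forall n, u n x = h n (rad x)]}.
  have ua : {ae hv, forall x, forall n, u n x = h n (rad x)}.
    by apply: ae_foralln => n; have [] := Hf n.
  apply: filterS3 ae_ball ua (ae_hvol_rad N0 aeP) => x [bx r01] ux Px.
  by split => //; exact: Px.
have cv : {ae hv, forall x, u (k n) x @[n --> \oo] --> v x}.
  apply: filterS good => x [_ /andP[r0 r1] Px ux].
  have /cvg_ex[l Hl] := kc _ r0 r1 Px.
  have H : u (k n) x @[n --> \oo] --> l.
    by under eq_fun do rewrite ux; exact: Hl.
  rewrite (_ : v x = l)//.
  have HE : (u (k n) x)%:E @[n --> \oo] --> l%:E by apply: cvg_EFin => //; exact: nearW.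
  rewrite /v is_cvg_limn_esupE; last by apply/cvg_ex; exists l%:E.
  by rewrite (cvg_lim _ HE).
have K0 : 0 <= K by rewrite mulr_ge0 ?sqr_ge0// ltW.
have uK : {ae hv, forall x n, u n x ^+ 2 <= K * env x}.
  by apply: filterS good => x [_ /andP[r0 r1] Px ux] n; rewrite ux; exact: hK.
exists v, K => //; split => //.
- apply: measurableT_comp => //; apply: measurable_fun_limn_esup => n.
  by apply/measurable_EFinP; exact: measurable_H1r.
- apply: filterS2 cv uK => x cx ux.
  have c2 : u (k n) x ^+ 2 @[n --> \oo] --> v x ^+ 2.
    by rewrite expr2; under eq_fun do rewrite expr2; exact: cvgM.
  rewrite -(cvg_lim _ c2)//; apply: limr_le; first by apply/cvg_ex; eexists; exact: c2.
  by apply: nearW => n; exact: ux.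
Qed.

Let Lnorm_cvg (u : nat -> 'rV[R]_N -> R) (v : 'rV[R]_N -> R) (K : R) :
  (forall n, measurable_fun setT (u n)) -> measurable_fun setT v -> 0 <= K ->
  {ae hv, forall x, u n x @[n --> \oo] --> v x} ->
  {ae hv, forall x n, u n x ^+ 2 <= K * env x} ->
  {ae hv, forall x, v x ^+ 2 <= K * env x} ->
  Lnorm hv p%:E (EFin \o (u n - v)) @[n --> \oo] --> 0%E.
Proof.
move=> mu_ mv K0 cv uK vK.
have mw n : measurable_fun setT (u n - v) by exact: measurable_funB.
(* (u - v)^2 <= 2 u^2 + 2 v^2, and both squares are at most K env: hence the factor 4. *)
have w4 : {ae hv, forall x n, (u n - v) x ^+ 2 <= 4 * K * env x}.
  apply: filterS2 uK vK => x ux vx n; have := ux n; rewrite !fctE.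
  have := sqr_ge0 (u n x + v x); lra.
have K40 : 0 <= 4 * K by rewrite mulr_ge0.
pose f_ n x := (`|(u n - v) x| `^ p)%:E.
pose g x := ((4 * K) `^ (p / 2) * env x `^ (p / 2))%:E.
have mf n : measurable_fun setT (f_ n).
  apply/measurable_EFinP; apply: (measurableT_comp (measurable_powR _)).
  exact: measurableT_comp.
have cf : {ae hv, forall x, setT x -> f_ ^~ x @ \oo --> cst 0%E x}.
  apply: filterS cv => x cx _; apply: cvg_EFin; first exact: nearW.
  apply: cvgn_powR0 => //.
  apply/cvgr0Pnorm_le => e e0; move/cvgrPdist_le : cx => /(_ _ e0).
  apply: filterS => n; by rewrite normr_id distrC.
have ig : hv.-integrable setT g.
  apply/integrableP; split.
    by apply/measurable_EFinP; exact: measurable_funM.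
  have -> : (fun x => `|g x|%E) =
      (fun x => ((4 * K) `^ (p / 2))%:E * (env x `^ (p / 2))%:E)%E.
    apply/funext => x; rewrite /g EFinM gee0_abs//.
    by rewrite -EFinM lee_fin; apply: mulr_ge0; exact: powR_ge0.
  rewrite ge0_integralZl//; last 3 first.
  - exact/measurable_EFinP.
  - by move=> x _; rewrite lee_fin powR_ge0.
  - by rewrite lee_fin powR_ge0.
  by rewrite -/I -(fineK Ifin) -EFinM ltry.
have fg : {ae hv, forall x n, setT x -> (`|f_ n x| <= g x)%E}.
  apply: filterS2 ae_ball w4 => x [bx _] wx n _.
  rewrite gee0_abs ?lee_fin ?powR_ge0// powR_half -powRM ?env_ge0//.
  have E0 := mulr_ge0 K40 (env_ge0 bx).
  by apply: ge0_ler_powR; rewrite ?nnegrE ?p20 ?sqr_ge0.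
have [_ _] := @dominated_convergence _ _ R hv setT measurableT f_ (cst 0%E) g mf
  (measurable_cst _) cf ig fg.
rewrite integral_cst// mul0e => H.
have fin n : (\int[hv]_x f_ n x)%E \is a fin_num.
  rewrite ge0_fin_numE; last by apply: integral_ge0 => x _; rewrite lee_fin powR_ge0.
  apply: le_lt_trans (integral_bound (mw n) K40 _) _; last exact: ltry.
  by apply: filterS w4 => x; apply.
have -> : (fun n => Lnorm hv p%:E (EFin \o (u n - v))) =
   (fun n => ((fine (\int[hv]_x f_ n x)%E) `^ p^-1)%:E).
  by apply/funext => n; rewrite LnormE -poweR_EFin fineK.
apply: cvg_EFin; first exact: nearW.
apply: cvgn_powR0; first by rewrite invr_gt0.
  by move=> n; apply: fine_ge0; apply: integral_ge0 => x _; rewrite lee_fin powR_ge0.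
exact: fine_cvg H.
Qed.

Lemma compact_embedding_H1r : compact_embedding (@H1r R N) (@H1norm R N)
    [set u : 'rV[R]_N -> R | u \in Lfun (@hvol R N) p%:E]
    (fun u => Lnorm (@hvol R N) p%:E (EFin \o u)).
Proof.
split.
- move=> u Hu /=; have [Q [Q0 _ uQ]] := H1r_bound Hu.
  by apply: (Lfun_of_bound (K := Q * C)) => //; [exact: measurable_H1r|rewrite mulr_ge0// ltW].
- exists (C `^ 2^-1 * fine I `^ p^-1) => u Hu; have [Q [Q0 -> uQ]] := H1r_bound Hu.
  have QC : 0 <= Q * C by rewrite mulr_ge0// ltW.
  apply: (le_trans (Lnorm_bound (measurable_H1r Hu) QC uQ)).
  rewrite -EFinM lee_fin powRM ?(ltW C0)//.
  by rewrite le_eqVlt; apply/orP; left; apply/eqP; ring.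
- move=> u Hu [M HM].
  have [k ki [v [K K0 [mv cv uK vK]]]] := subsequence Hu HM.
  exists k => //; exists v; first exact: Lfun_of_bound mv K0 vK.
  apply: (Lnorm_cvg (u := fun n => u (k n))) mv K0 cv _ vK.
    by move=> n; exact: measurable_H1r.
  by apply: filterS uK => x H n; exact: H.
Qed.

End compactness.

Theorem theorem3p1 (R : realType) (N : nat) (p : R) :
  (2 <= N)%N -> 2 < p -> (p%:E < critical_exponent N)%E ->
  compact_embedding (@H1r R N) (@H1norm R N)
    [set u : 'rV[R]_N -> R | u \in Lfun (@hvol R N) p%:E]
    (fun u => Lnorm (@hvol R N) p%:E (EFin \o u)).
Proof. exact: compact_embedding_H1r. Qed.
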